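(* Let $1 \le k < n$ be integers. Let $K \subset \mathbb{R}^n$ be either a homogeneous set, or a graph-directed set with one of the following two properties: (1) its transformation group is finite, or (2) the action of its transformation group on $\mathrm{Gr}(n,k)$ has a dense orbit. Then, for all $0 \le s < \dim K$, $$\dim_P \{ V \in \mathrm{Gr}(n,k) : \dim \pi_V(K) \le s \} \le k(n-k) - (k-s).$$
   Context: $\mathrm{Gr}(n,k)$ is the Grassmannian of $k$-dimensional linear subspaces of $\mathbb{R}^n$, with the metric $d(V,W) = \|\pi_V - \pi_W\|$ (operator norm), where $\pi_V : \mathbb{R}^n \to V$ denotes the orthogonal projection onto $V$. The group $O(n)$ acts on $\mathrm{Gr}(n,k)$ by $V \mapsto T(V)$. $\dim$ denotes Hausdorff dimension. For a bounded subset $B$ of a metric space $X$ and $\delta > 0$, $N(B,\delta)$ is the least number of closed balls of radius $\delta$ needed to cover $B$, and the upper box dimension is $\overline{\dim}_B B := \inf\{ r \ge 0 : \limsup_{\delta \downarrow 0} N(B,\delta)\delta^r = 0\}$. The packing dimension of $B \subseteq X$ is $\dim_P B := \inf\{ \sup_{i} \overline{\dim}_B B_i : B = \bigcup_{i=1}^\infty B_i,\ B_i \text{ bounded} \}$. Homogeneous sets. Let $K \subseteq [0,1]^n$ be nonempty and compact. A nonempty closed set $K' \subseteq [0,1]^n$ is a miniset of $K$ if there is an expanding homothety $\varphi(x) = rx + b$ ($r \in \mathbb{R}$, $|r| \ge 1$, $b \in \mathbb{R}^n$) such that $K' \subseteq \varphi(K)$. A nonempty closed set $K'' \subseteq [0,1]^n$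 is a microset of $K$ if it is the limit, in the Hausdorff metric, of a sequence of minisets of $K$. $K$ is homogeneous if every microset of $K$ is a miniset of $K$. A nonempty compact set in $\mathbb{R}^n$ not contained in $[0,1]^n$ is called homogeneous if its image under some map $x \mapsto ax + b$ ($a > 0$, $b \in \mathbb{R}^n$) is contained in $[0,1]^n$ and is homogeneous in this sense. Graph-directed sets. Let $(\mathcal{E},\mathcal{V})$ be a finite directed graph with vertex set $\mathcal{V} = \{1,\dots,N\}$, where edges starting and ending at the same vertex are allowed. Let $\mathcal{E}_{i,j}$ be the set of edges from $i$ to $j$ and $\mathcal{E}_{i,j}^\ell$ the set of paths $(e_1,\dots,e_\ell)$ of length $\ell \ge 1$ from $i$ to $j$. The graph is assumed transitive (strongly connected): for all $i,j \in \mathcal{V}$, at least one $\mathcal{E}_{i,j}^\ell$ is nonempty. Given contracting similarities $(g_e)_{e \in \mathcal{E}}$ of $\mathbb{R}^n$, written $g_e(x) = a_e T_e(x) + b_e$ with $a_e \in (0,1)$, $T_e \in O(n)$, $b_e \in \mathbb{R}^n$, there is a unique tuple $(K_1,\dots,K_N)$ of nonempty compact sets with $K_i = \bigcup_{j=1}^N \bigcup_{e \in \mathcal{E}_{i,j}} g_e(K_j)$ for each $i$. The system $(g_e)_{e\in\mathcal{E}}$ is a graph-directed IFS, the tuple is its attractor, and each $K_i$ is called a graph-directed set. The transformation group of $K_i$ (with respect to this system) is the subgroup of $O(n)$ generated by $\{ T_{e_1} \circ \cdots \circ T_{e_\ell} : (e_1,\dots,e_\ell) \in \mathcal{E}_{i,i}^\ell,\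 \ell \ge 1 \}$. *)

(* Defs.v *)
From HB Require Import structures.
From mathcomp Require Import all_boot all_order all_algebra.
From mathcomp Require Import all_classical all_reals all_analysis.
From mathcomp Require Import ring.

Set Implicit Arguments.
Unset Strict Implicit.
Unset Printing Implicit Defensive.

Import Order.TTheory GRing.Theory Num.Theory.
Import numFieldNormedType.Exports.

Local Open Scope classical_set_scope.
Local Open Scope ring_scope.

Section MetricDimensions.
Context {R : realType} {X : metricType R}.
Implicit Types (A B U : set X) (r s delta : R).
Local Open Scope ereal_scope.

Definition diam U : \bar R :=
  ereal_sup [set (mdist x y)%:E | x in U & y in U].

(* The separate case makes the empty set cost nothing also for s = 0, where
   the library has 0 `^ 0 = 1. *)
Definition diam_pow s U : \bar R := if U == set0 then 0 else diam U `^ s.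

Definition hausdorff_premeasure s delta A : \bar R :=
  ereal_inf [set \sum_(0 <= i <oo) diam_pow s (U i) | U in
    [set U : nat -> set X |
      A `<=` \bigcup_i U i /\ forall i, diam (U i) <= delta%:E]].

Definition hausdorff_measure s A : \bar R :=
  ereal_sup [set hausdorff_premeasure s delta A |
             delta in [set delta : R | (0 < delta)%R]].

Definition hausdorff_dim A : \bar R :=
  ereal_inf [set s%:E | s in
    [set s : R | (0 <= s)%R /\ hausdorff_measure s A = 0]].

Definition mbounded A : Prop :=
  exists M : R, forall x y, A x -> A y -> (mdist x y <= M)%R.

(* Closed balls are {x | d(c, x) <= delta}; the library's [closed_ball] is the
   closure of the open ball, which can be smaller in a metric space. *)
Definition covering_number B delta : \bar R :=
  ereal_inf [set (size cs)%:R%:E | cs in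
    [set cs : seq X |
      forall x, B x -> exists2 c, c \in cs & (mdist c x <= delta)%R]].

Definition upper_box_dim B : \bar R :=
  ereal_inf [set r%:E | r in
    [set r : R | (0 <= r)%R /\
      limf_esup (fun delta : R => covering_number B delta * (delta `^ r)%:E)
        0^'+ = 0]].

Definition packing_dim B : \bar R :=
  ereal_inf [set ereal_sup [set upper_box_dim (Bs i) | i in [set: nat]] | Bs in
    [set Bs : nat -> set X |
      B = \bigcup_i Bs i /\ forall i, mbounded (Bs i)]].

End MetricDimensions.

(* R^n as column vectors with the Euclidean metric; an alias, because the
   library gives 'cV[R]_n itself the sup distance. *)
Definition euclid (R : realType) (n : nat) : Type := 'cV[R]_n.

HB.instance Definition _ (R : realType) n := Choice.on (euclid R n).
HB.instance Definition _ (R : realType) n := GRing.Lmodule.on (euclid R n).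
HB.instance Definition _ (R : realType) n := Vector.on (euclid R n).

Section EuclideanMetric.
Context {R : realType} {n : nat}.
Implicit Types (x y z : euclid R n) (a : R).

Definition dotv x y : R := \sum_(i < n) x i ord0 * y i ord0.

Definition enorm x : R := Num.sqrt (dotv x x).

Lemma dotvC x y : dotv x y = dotv y x.
Proof. by apply: eq_bigr => i _; rewrite mulrC. Qed.

Lemma dotvDl x y z : dotv (x + y) z = dotv x z + dotv y z.
Proof. by rewrite -big_split; apply: eq_bigr => i _; rewrite mxE mulrDl. Qed.

Lemma dotvZl a x z : dotv (a *: x) z = a * dotv x z.
Proof. by rewrite mulr_sumr; apply: eq_bigr => i _; rewrite mxE mulrA. Qed.

Lemma dotvDr x y z : dotv z (x + y) = dotv z x + dotv z y.
Proof. by rewrite !(dotvC z) dotvDl. Qed.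

Lemma dotvZr a x z : dotv z (a *: x) = a * dotv z x.
Proof. by rewrite !(dotvC z) dotvZl. Qed.

Lemma dotvNl x z : dotv (- x) z = - dotv x z.
Proof. by rewrite -scaleN1r dotvZl mulN1r. Qed.

Lemma dotvNr x z : dotv z (- x) = - dotv z x.
Proof. by rewrite !(dotvC z) dotvNl. Qed.

Lemma dotv_ge0 x : 0 <= dotv x x.
Proof. by apply: sumr_ge0 => i _; rewrite -expr2 sqr_ge0. Qed.

Lemma dotv_eq0 x : dotv x x = 0 -> x = 0.
Proof.
move=> /eqP; rewrite psumr_eq0 => [/allP x0|i _]; last by rewrite -expr2 sqr_ge0.
apply/matrixP => i j; rewrite mxE (ord1 j).
by have /implyP/(_ isT) := x0 i (mem_index_enum i); rewrite mulf_eq0 orbb => /eqP.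
Qed.

Lemma enorm_ge0 x : 0 <= enorm x. Proof. exact: sqrtr_ge0. Qed.

Lemma sqr_enorm x : enorm x ^+ 2 = dotv x x.
Proof. by rewrite sqr_sqrtr ?dotv_ge0. Qed.

Lemma enorm_eq0 x : enorm x = 0 -> x = 0.
Proof. by move=> x0; apply: dotv_eq0; rewrite -sqr_enorm x0 expr0n. Qed.

Lemma enorm0 : enorm 0 = 0.
Proof. by rewrite /enorm -(scale0r 0) dotvZl mul0r sqrtr0. Qed.

Lemma enormN x : enorm (- x) = enorm x.
Proof. by rewrite /enorm dotvNl dotvNr opprK. Qed.

Lemma enormZ a x : enorm (a *: x) = `|a| * enorm x.
Proof. by rewrite /enorm dotvZl dotvZr mulrA -expr2 sqrtrM ?sqr_ge0 ?sqrtr_sqr. Qed.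

Lemma dotv_le x y : dotv x y <= enorm x * enorm y.
Proof.
have [->|y0] := eqVneq y 0.
  by rewrite enorm0 mulr0 -(scale0r 0) dotvZr mul0r.
have dy0 : 0 < dotv y y.
  by rewrite lt_def dotv_ge0 andbT; apply: contra y0 => /eqP/dotv_eq0/eqP.
apply: le_trans (ler_norm _) _.
rewrite -ler_sqr ?nnegrE ?mulr_ge0 ?enorm_ge0//.
rewrite real_normK ?num_real// exprMn !sqr_enorm.
have := dotv_ge0 (dotv y y *: x - dotv x y *: y).
rewrite !(dotvDl, dotvDr, dotvNl, dotvNr, dotvZl, dotvZr) (dotvC y x).
set a := dotv x x; set b := dotv x y; set c := dotv y y in dy0 *.
rewrite (_ : _ + _ = c * (a * c - b ^+ 2)); last by ring.
by rewrite pmulr_rge0// subr_ge0.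
Qed.

Lemma enormD x y : enorm (x + y) <= enorm x + enorm y.
Proof.
rewrite -ler_sqr ?nnegrE ?addr_ge0 ?enorm_ge0// sqrrD !sqr_enorm.
rewrite dotvDl !dotvDr (dotvC y x) -addrA -[leRHS]addrA lerD2l addrA lerD2r.
by rewrite -mulr2n lerMn2r dotv_le orbT.
Qed.

End EuclideanMetric.

Section EuclideanMetricInstance.
Context {R : realType} {n : nat}.
Implicit Types (x y z : euclid R n).

Let edist x y : R := enorm (x - y).

Let edistxx x : edist x x = 0. Proof. by rewrite /edist subrr enorm0. Qed.

Let edist_positivity x y : edist x y = 0 -> x = y.
Proof. by move=> /enorm_eq0/eqP; rewrite subr_eq0 => /eqP. Qed.

Let edist_sym x y : edist x y = edist y x.
Proof. by rewrite /edist -enormN opprB. Qed.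

Let edist_triangle y x z : edist x z <= edist x y + edist y z.
Proof. by rewrite /edist -[x - z](subrKA y) enormD. Qed.

HB.instance Definition _ := isMetric.Build R (euclid R n)
  edistxx edist_positivity edist_sym edist_triangle.

End EuclideanMetricInstance.

Section OrthogonalProjection.
Context {R : realType} {n : nat}.
Implicit Types (V W : {vspace euclid R n}) (x : euclid R n).

Definition is_orthproj V x : set (euclid R n) :=
  [set y | y \in V /\ forall v, v \in V -> dotv (x - y) v = 0].

Definition orthproj V x : euclid R n := xget 0 (is_orthproj V x).

Definition opnorm (f : euclid R n -> euclid R n) : R :=
  sup [set enorm (f x) | x in [set x | enorm x <= 1]].


Lemma orthproj_exists V x : exists y, is_orthproj V x y.
Proof.
pose g x : 'cV[R]_(\dim V) := \col_i dotv x (vbasis V)`_i.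
have g_lin : linear g.
  by move=> a u v; apply/colP => i; rewrite !mxE dotvDl dotvZl.
pose gL := GRing.isLinear.Build R (euclid R n) 'cV[R]_(\dim V) _ g g_lin.
pose G : {linear euclid R n -> 'cV[R]_(\dim V)} := HB.pack g gL.
have kerG u : (u \in lker (linfun G)) -> forall v, v \in V -> dotv u v = 0.
  rewrite memv_ker lfunE => /eqP /= gu0 v vV.
  rewrite (coord_vbasis vV) dotvC.
  elim/big_ind: _ => [|v1 v2 h1 h2|i _].
  - by rewrite -(scale0r 0) dotvZl mul0r.
  - by rewrite dotvDl h1 h2 addr0.
  - by rewrite dotvZl dotvC; have /colP/(_ i) := gu0; rewrite !mxE => ->; rewrite mulr0.
have cap0 : (V :&: lker (linfun G) = 0)%VS.
  apply/eqP; rewrite -subv0; apply/subvP => u /memv_capP[uV /kerG/(_ _ uV)].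
  by move=> /dotv_eq0 ->; rewrite mem0v.
have full : (V + lker (linfun G) = fullv)%VS.
  apply/eqP; rewrite -(dimv_leqif_eq (subvf _)) eqn_leq dimvS ?subvf//=.
  rewrite dimv_disjoint_sum// -(limg_ker_dim (linfun G) fullv) capfv addnC.
  by rewrite leq_add2r (leq_trans (dimvS (subvf _)))// dimvf dim_matrix mulr1.
have : x \in (V + lker (linfun G))%VS by rewrite full memvf.
move=> /memv_addP[v vV [w wK ->]]; exists v; split=> // u uV.
by rewrite addrAC subrr add0r (kerG _ wK).
Qed.

Lemma orthprojP V x : is_orthproj V x (orthproj V x).
Proof. exact: xgetPex (orthproj_exists V x). Qed.

Lemma memv_orthproj V x : orthproj V x \in V.
Proof. by have [] := orthprojP V x. Qed.

Lemma orthproj_id V x : x \in V -> orthproj V x = x.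
Proof.
move=> xV; have [pV /(_ (x - orthproj V x))] := orthprojP V x.
by rewrite rpredB// => /(_ isT)/dotv_eq0/eqP; rewrite subr_eq0 => /eqP.
Qed.

Lemma enorm_orthproj V x : enorm (orthproj V x) <= enorm x.
Proof.
have [pV /(_ _ pV)] := orthprojP V x; rewrite dotvDl dotvNl => /eqP.
rewrite subr_eq0 -sqr_enorm => /eqP xp.
have := dotv_le x (orthproj V x); rewrite xp expr2.
have := enorm_ge0 (orthproj V x); rewrite le_eqVlt => /predU1P[<- _|p0].
  exact: enorm_ge0.
by rewrite ler_pM2r.
Qed.

End OrthogonalProjection.

Section Grassmannian.
Context {R : realType} {n k : nat}.

Definition grassmannian : Type := {V : {vspace euclid R n} | \dim V == k}.

HB.instance Definition _ := Choice.on grassmannian.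

Implicit Types (V W : grassmannian).

Let grdist V W : R :=
  opnorm (fun x => orthproj (val V) x - orthproj (val W) x).

Let grset V W : set R :=
  [set enorm (orthproj (val V) x - orthproj (val W) x) |
   x in [set x : euclid R n | enorm x <= 1]].

Let grset_neq0 V W : grset V W !=set0.
Proof. by eexists; exists 0 => //=; rewrite enorm0. Qed.

Let grset_sup V W : has_sup (grset V W).
Proof.
split=> //; exists (1 + 1) => _ [x /= x1 <-].
rewrite (le_trans (enormD _ _))// enormN.
by apply: lerD; rewrite (le_trans (enorm_orthproj _ _)).
Qed.

Let grdist_ub V W x : enorm x <= 1 ->
  enorm (orthproj (val V) x - orthproj (val W) x) <= grdist V W.
Proof. by move=> x1; apply: (sup_upper_bound (grset_sup V W)); exists x. Qed.

Let grdistxx V : grdist V V = 0.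
Proof.
apply/eqP; rewrite eq_le; apply/andP; split.
  apply: sup_le_ub => [|_ [x _ <-]]; first exact: grset_neq0.
  by rewrite subrr enorm0.
by have := @grdist_ub V V 0; rewrite subrr enorm0; apply.
Qed.

Let grdist_sym V W : grdist V W = grdist W V.
Proof.
congr sup; apply/seteqP; split=> _ [x x1 <-]; exists x => //;
  by rewrite -enormN opprB.
Qed.

Let grdist_triangle W V U : grdist V U <= grdist V W + grdist W U.
Proof.
apply: sup_le_ub => [|_ [x x1 <-]]; first exact: grset_neq0.
rewrite -(subrKA (orthproj (val W) x)) (le_trans (enormD _ _))//.
by rewrite lerD// grdist_ub.
Qed.

Let grdist_sub V W : grdist V W = 0 -> (val V <= val W)%VS.
Proof.
move=> VW0; apply/subvP => v vV.
have [->|v0] := eqVneq v 0; first exact: mem0v.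
have nv0 : enorm v != 0 by apply: contra v0 => /eqP/enorm_eq0/eqP.
pose u : euclid R n := (enorm v)^-1 *: v.
have u1 : enorm u <= 1.
  by rewrite enormZ ger0_norm ?invr_ge0 ?enorm_ge0// mulVf.
have uV : u \in val V by rewrite memvZ.
have := grdist_ub V W u1; rewrite VW0 orthproj_id// => u0.
have /enorm_eq0/eqP : enorm (u - orthproj (val W) u) = 0.
  by apply/eqP; rewrite eq_le u0 enorm_ge0.
rewrite subr_eq0 => /eqP uW.
have -> : v = enorm v *: u by rewrite scalerA divff// scale1r.
by rewrite memvZ// uW memv_orthproj.
Qed.

Let grdist_positivity V W : grdist V W = 0 -> V = W.
Proof.
move=> VW0; apply/val_inj/eqP; rewrite eqEsubv grdist_sub//.
by rewrite grdist_sub// grdist_sym.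
Qed.

HB.instance Definition _ := isMetric.Build R grassmannian
  grdistxx grdist_positivity grdist_sym grdist_triangle.

End Grassmannian.
Arguments grassmannian : clear implicits.

Section OrthogonalGroupAction.
Context {R : realType} {n : nat}.
Implicit Types (T : 'M[R]_n) (G : set 'M[R]_n).

Definition orthogonal_group : set 'M[R]_n := [set T | T^T *m T = 1%:M].

Definition is_orthogonal_subgroup G : Prop :=
  [/\ G `<=` orthogonal_group, G 1%:M,
      forall S T, G S -> G T -> G (S *m T) &
      forall T, G T -> G (invmx T)].

Definition image_subspace T (V : {vspace euclid R n}) : {vspace euclid R n} :=
  (linfun (mulmx T : 'cV[R]_n -> 'cV[R]_n) @: V)%VS.

Definition grassmannian_orbit k G (V : grassmannian R n k) :
    set (grassmannian R n k) :=
  [set W | exists2 T, G T & val W = image_subspace T (val V)].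

Definition has_dense_orbit k G : Prop :=
  exists V : grassmannian R n k, dense (grassmannian_orbit G V).

End OrthogonalGroupAction.

Section HomogeneousSets.
Context {R : realType} {n : nat}.
Implicit Types (K A B : set (euclid R n)).

Definition unit_cube : set (euclid R n) :=
  [set x | forall i, 0 <= x i ord0 <= 1].

Definition miniset K A : Prop :=
  [/\ A !=set0, closed A, A `<=` unit_cube &
      exists (r : R) (b : euclid R n),
        1 <= `|r| /\ A `<=` [set r *: x + b | x in K]].

Definition hausdorff_excess A B : \bar R :=
  ereal_sup [set ereal_inf [set (mdist a b)%:E | b in B] | a in A].

Definition hausdorff_dist A B : \bar R :=
  maxe (hausdorff_excess A B) (hausdorff_excess B A).

Definition microset K A : Prop :=
  [/\ A !=set0, closed A, A `<=` unit_cube &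
      exists M : nat -> set (euclid R n),
        (forall m, miniset K (M m)) /\
        hausdorff_dist (M m) A @[m --> \oo] --> (0 : \bar R)].

Definition homogeneous_in_cube K : Prop :=
  [/\ K !=set0, compact K, K `<=` unit_cube &
      forall A, microset K A -> miniset K A].

Definition homogeneous K : Prop :=
  homogeneous_in_cube K \/
  [/\ K !=set0, compact K, ~ (K `<=` unit_cube) &
      exists (a : R) (b : euclid R n),
        0 < a /\ homogeneous_in_cube [set a *: x + b | x in K]].

End HomogeneousSets.

Record graph_directed_ifs (R : realType) (n : nat) := GraphDirectedIFS {
  gd_size : nat;
  gd_edge : finType;
  gd_src : gd_edge -> 'I_gd_size;
  gd_tgt : gd_edge -> 'I_gd_size;
  gd_ratio : gd_edge -> R;
  gd_orth : gd_edge -> 'M[R]_n;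
  gd_transl : gd_edge -> euclid R n;
  gd_ratioP : forall e, 0 < gd_ratio e < 1;
  gd_orthP : forall e, orthogonal_group (gd_orth e)
}.

Section GraphDirectedSets.
Context {R : realType} {n : nat} (S : graph_directed_ifs R n).
Implicit Types (e : gd_edge S) (i j : 'I_(gd_size S)) (p : seq (gd_edge S)).

Definition gd_path i j p : bool :=
  if p is e :: p' then
    [&& gd_src e == i, path (fun e f => gd_tgt e == gd_src f) e p' &
        gd_tgt (last e p') == j]
  else false.

Definition gd_transitive : Prop := forall i j, exists p, gd_path i j p.

Definition gd_map e (x : euclid R n) : euclid R n :=
  gd_ratio e *: (gd_orth e *m x : euclid R n) + gd_transl e.

Definition gd_attractor (F : 'I_(gd_size S) -> set (euclid R n)) : Prop :=
  (forall i, F i !=set0 /\ compact (F i)) /\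
  (forall i, F i =
     \bigcup_j \bigcup_(e in [set e | gd_src e = i /\ gd_tgt e = j])
       (gd_map e @` F j)).

Definition gd_path_orth p : 'M[R]_n :=
  \big[mulmx/1%:M]_(e <- p) gd_orth e.

Definition gd_transformation_group i : set 'M[R]_n :=
  smallest is_orthogonal_subgroup
    [set gd_path_orth p | p in [set p | gd_path i i p]].

End GraphDirectedSets.

(* Main.v *)
(* Fix V with dim pi_V K <= s < dim K. Let N(q) be the largest number of cells
   of side 2^-q met by a zoomed copy of K inside the unit cube, and J(q) the
   largest number of pairs of such cells that collide under pi_V. Both counts
   are submultiplicative and grow like 2^(dq) and 2^(gamma q), where
   d >= dim K. The energy method on extremal configurations gives
   gamma >= 2d - s > d, so most collisions in an extremal configuration occur
   between distant cells. If K is homogeneous, limits of zooms are zooms of K,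
   and the distant collisions are found in K itself at every scale. As a fixed
   vector u satisfies |pi_V u| <= rho |u| for at most about
   rho^k delta^(-k(n-k)) members V of a delta-separated set, double counting
   bounds the number of exceptional V.

   A graph-directed set contains, for every a < dim K and small delta, more
   than delta^-a separated pieces along loops of ratio about delta. If the
   rotations form a finite group, some of these loops have a common rotation,
   which a further fixed loop undoes; they generate a separated
   self-homothetic subset of almost full dimension, and limits of its zooms
   are again contained in zooms, so that the first argument applies. If the
   group has a dense orbit and s < k, there are no exceptional V: for words of
   loops, the entropy of the projected pieces is large on average over a finite
   family of subspaces, finitely many loops steer every V close to a subspace
   with large entropy, and a Cantor set of dimension > s is found in pi_V K. *)

From HB Require Import structures.
Require Import Defs.
From mathcomp Require Import all_boot all_order all_algebra.
From mathcomp Require Import all_classical all_reals all_analysis.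
From mathcomp Require Import ring lra zify finmap.

Set Implicit Arguments.
Unset Strict Implicit.
Unset Printing Implicit Defensive.

Import Order.TTheory GRing.Theory Num.Theory.
Import numFieldNormedType.Exports.

Local Open Scope classical_set_scope.
Local Open Scope ring_scope.

(** The growth rate d may exceed dim K, but it cancels. Let E be a 2^-q-separated set of exceptional
    subspaces. Each V in E has about 2^((2d-s)q) distant colliding pairs among at most 2^(2dq) pairs
    of cells of K, and one such pair collides for at most 2^((k(n-k)-k)q) members V of E. So |E| is
    at most 2^((k(n-k)-k+s)q), up to small losses in the exponent. The rate d is reached by zooms
    and perhaps not by K, and the record scales of extremal configurations may be sparse. The
    ancestors of one such configuration serve all smaller q, and compactness of zooms brings their
    collisions back to K. The constants lost on the way depend on V. Sorting the exceptional V by an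
    integer that bounds these constants gives a countable union, which is why the packing dimension
    appears. In the dense case an average over a finite family of subspaces can be carried along all
    rotations, because the estimate for |pi_V u| holds for every vector u and |T u| = |u|. *)

Section Euclid.
Context {R : realType} {n : nat}.
Implicit Types (x y z : euclid R n) (V W : {vspace euclid R n}).

Lemma edistE x y : mdist x y = enorm (x - y). Proof. by []. Qed.

Lemma enormB x y : enorm (x - y) = enorm (y - x).
Proof. by rewrite -enormN opprB. Qed.

Lemma enorm_coord x i : `|x i ord0| <= enorm x.
Proof.
rewrite -ler_sqr ?nnegrE ?enorm_ge0// sqr_enorm real_normK ?num_real//.
rewrite /dotv (bigD1 i)//= -expr2 lerDl sumr_ge0// => j _.
by rewrite -expr2 sqr_ge0.
Qed.

Lemma enorm_le_sum x : enorm x <= \sum_i `|x i ord0|.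
Proof.
have s0 : 0 <= \sum_i `|x i ord0| by rewrite sumr_ge0.
rewrite -ler_sqr ?nnegrE ?enorm_ge0// sqr_enorm expr2 mulr_suml.
apply: ler_sum => i _; rewrite (le_trans (ler_norm _))// normrM.
by rewrite ler_wpM2l// (bigD1 i)//= lerDl sumr_ge0.
Qed.

Lemma enorm_le_coord x (c : R) : (forall i, `|x i ord0| <= c) ->
  enorm x <= n%:R * c.
Proof.
move=> h; rewrite (le_trans (enorm_le_sum x))//.
rewrite (le_trans (ler_sum _ (fun i _ => h i)))//.
by rewrite sumr_const card_ord mulr_natl.
Qed.

Lemma dotv_norm x y : `|dotv x y| <= enorm x * enorm y.
Proof.
rewrite ler_norml dotv_le andbT lerNl -dotvNl -(enormN x); exact: dotv_le.
Qed.

Lemma dotvBl x y z : dotv (x - y) z = dotv x z - dotv y z.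
Proof. by rewrite dotvDl dotvNl. Qed.

Lemma orthproj_uniq V x y : is_orthproj V x y -> orthproj V x = y.
Proof.
move=> [yV y0]; have [pV p0] := orthprojP V x.
have dV : orthproj V x - y \in V by rewrite rpredB.
apply/eqP; rewrite -subr_eq0; apply/eqP; apply: dotv_eq0.
have E : orthproj V x - y = (x - y) - (x - orthproj V x).
  by rewrite opprB [RHS]addrC subrKA.
by rewrite [X in dotv X _]E dotvBl (y0 _ dV) (p0 _ dV) subrr.
Qed.

Lemma dotv_orthproj V x v : v \in V -> dotv (orthproj V x) v = dotv x v.
Proof.
move=> vV; have [_ /(_ _ vV)] := orthprojP V x.
by rewrite dotvBl => /eqP; rewrite subr_eq0 => /eqP.
Qed.

Lemma orthprojD V x y : orthproj V (x + y) = orthproj V x + orthproj V y.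
Proof.
apply: orthproj_uniq; split; first by rewrite rpredD ?memv_orthproj.
by move=> v vV; rewrite dotvBl !dotvDl !dotv_orthproj// subrr.
Qed.

Lemma orthprojZ V a x : orthproj V (a *: x) = a *: orthproj V x.
Proof.
apply: orthproj_uniq; split; first by rewrite rpredZ ?memv_orthproj.
by move=> v vV; rewrite dotvBl !dotvZl !dotv_orthproj// subrr.
Qed.

Lemma orthprojN V x : orthproj V (- x) = - orthproj V x.
Proof. by rewrite -(scaleN1r x) orthprojZ scaleN1r. Qed.

Lemma orthprojB V x y : orthproj V (x - y) = orthproj V x - orthproj V y.
Proof. by rewrite orthprojD orthprojN. Qed.

End Euclid.

Section GrDist.
Context {R : realType} {n k : nat}.
Implicit Types (V W : grassmannian R n k) (x : euclid R n).

Lemma opnorm_ub V W x : enorm x <= 1 ->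
  enorm (orthproj (val V) x - orthproj (val W) x) <= mdist V W.
Proof.
move=> x1; apply: sup_upper_bound; last by exists x.
split; first by eexists; exists 0 => //=; rewrite enorm0.
exists (1 + 1) => _ [y /= y1 <-].
rewrite (le_trans (enormD _ _))// enormN.
by apply: lerD; rewrite (le_trans (enorm_orthproj _ _)).
Qed.

Lemma mdist_Gr_le V W (c : R) :
  (forall x, enorm (orthproj (val V) x - orthproj (val W) x) <= c * enorm x) ->
  0 <= c -> mdist V W <= c.
Proof.
move=> h c0; apply: sup_le_ub; first by eexists; exists 0 => //=; rewrite enorm0.
by move=> _ [x /= x1 <-]; rewrite (le_trans (h x))// ler_piMr.
Qed.

Lemma mdist_Gr_ub V W x :
  enorm (orthproj (val V) x - orthproj (val W) x) <= mdist V W * enorm x.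
Proof.
have [->|x0] := eqVneq x 0.
  by rewrite -(scale0r 0) !orthprojZ !scale0r subrr !enorm0 mulr0.
have nx0 : 0 < enorm x.
  by rewrite lt_def enorm_ge0 andbT; apply: contra x0 => /eqP/enorm_eq0/eqP.
rewrite -ler_pdivrMr// -[_ / _]mulrC -[(enorm x)^-1]ger0_norm ?invr_ge0 ?enorm_ge0//.
rewrite -enormZ scalerBr -!orthprojZ opnorm_ub// enormZ.
by rewrite ger0_norm ?invr_ge0 ?enorm_ge0// mulVf// gt_eqF.
Qed.

Lemma mdist_Gr_le2 V W : mdist V W <= 2.
Proof.
apply: mdist_Gr_le => // x; rewrite (le_trans (enormD _ _))// enormN.
by rewrite mulrDl mul1r lerD// enorm_orthproj.
Qed.

End GrDist.

(** * Lower bounds for the Hausdorff dimension *)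

Section Ex2.
Context {R : realType}.
Implicit Types (x y a : R).

Definition exp2 x : R := 2 `^ x.

Lemma exp2_gt0 x : 0 < exp2 x. Proof. exact: powR_gt0. Qed.
Lemma exp2_ge0 x : 0 <= exp2 x. Proof. exact: powR_ge0. Qed.
Lemma exp2_neq0 x : exp2 x != 0. Proof. by rewrite gt_eqF ?exp2_gt0. Qed.
Lemma exp2D x y : exp2 (x + y) = exp2 x * exp2 y.
Proof. by rewrite /exp2 powRD// pnatr_eq0 implybT. Qed.
Lemma exp20 : exp2 0 = 1. Proof. by rewrite /exp2 powRr0. Qed.
Lemma exp2N x : exp2 (- x) = (exp2 x)^-1. Proof. by rewrite /exp2 powRN. Qed.
Lemma exp2_nat q : exp2 q%:R = 2 ^+ q. Proof. by rewrite /exp2 powR_mulrn. Qed.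
Lemma exp2M x y : exp2 (x * y) = exp2 x `^ y. Proof. by rewrite /exp2 powRrM. Qed.
Lemma exp2_le x y : x <= y -> exp2 x <= exp2 y.
Proof. by move=> xy; rewrite /exp2 ler_powR// ler1n. Qed.
Lemma exp2_le1 x : x <= 0 -> exp2 x <= 1.
Proof. by move=> x0; rewrite -[leRHS]exp20 exp2_le. Qed.
Lemma exp2S q : exp2 q.+1%:R = 2 * exp2 q%:R.
Proof. by rewrite !exp2_nat exprS. Qed.
Lemma exp2NS q : exp2 (- q.+1%:R) = exp2 (- q%:R) / 2.
Proof. by rewrite !exp2N exp2S invfM mulrC. Qed.

Lemma exp2_inj_lt x y : exp2 x < exp2 y -> x < y.
Proof. by move=> h; rewrite ltNge; apply/negP => /exp2_le; rewrite leNgt h. Qed.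

Lemma ln2_gt0 : 0 < ln (2 : R). Proof. by rewrite ln_gt0// ltr1n. Qed.

Lemma exp2_expR x : exp2 x = expR (x * ln 2).
Proof. by rewrite /exp2 /powR pnatr_eq0. Qed.

Lemma exp2_lb x : 0 <= x -> x * ln 2 <= exp2 x.
Proof.
by move=> x0; rewrite exp2_expR (le_trans _ (expR_ge1Dx _))// lerDr.
Qed.

Lemma exp2_unbounded a (c : R) : 0 < a -> exists q0, forall q, (q0 <= q)%N ->
  c <= exp2 (a * q%:R).
Proof.
move=> a0.
have al0 : 0 < a * ln 2 by rewrite mulr_gt0// ln2_gt0.
exists (Num.truncn (c / (a * ln 2))).+1 => q hq.
have aq : 0 <= a * q%:R by rewrite mulr_ge0// ltW.
rewrite (le_trans _ (exp2_lb aq))// -mulrA [q%:R * _]mulrC mulrA mulrC.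
rewrite -ler_pdivrMr// ltW// (lt_le_trans (truncnS_gt _))//.
by rewrite ler_nat.
Qed.

Lemma exp2_small a (c : R) : 0 < a -> 0 < c -> exists q0, forall q, (q0 <= q)%N ->
  exp2 (- (a * q%:R)) <= c.
Proof.
move=> a0 c0; have [q0 h] := exp2_unbounded c^-1 a0.
exists q0 => q /h; rewrite exp2N => {}h.
by rewrite -[leRHS]invrK lef_pV2 ?posrE ?invr_gt0 ?exp2_gt0.
Qed.

Lemma dyadic_scale (d : R) : 0 < d -> d <= 1 ->
  exists q : nat, d <= exp2 (- q%:R) /\ exp2 (- q%:R) < 2 * d.
Proof.
move=> d0 d1.
have [q0 h0] := @exp2_small 1 d ltr01 d0.
have ex : exists q, ~~ (d <= exp2 (- q.+1%:R)).
  exists q0; rewrite -ltNge.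
  have := h0 q0 (leqnn _); rewrite mul1r => h.
  by rewrite (lt_le_trans _ h)// exp2NS ltr_pdivrMr// ltr_pMr ?ltr1n// exp2_gt0.
case: (ex_minnP ex) => q; rewrite -ltNge => hq hmin.
exists q; split; last by rewrite -ltr_pdivrMl// mulrC -exp2NS.
case: q hq hmin => [|q] hq hmin; first by rewrite oppr0 exp20.
by apply: contraT => /hmin; rewrite ltnn.
Qed.

Lemma exp2_geom (a : R) : 0 < a -> exists2 C : R, 0 < C &
  forall m, \sum_(0 <= q < m) exp2 (- (a * q%:R)) <= C.
Proof.
move=> a0; set r := exp2 (- a).
have r0 : 0 < r := exp2_gt0 _.
have r1 : r < 1.
  rewrite /r exp2N invf_lt1 ?exp2_gt0// -exp20 /exp2 ltNge; apply/negP => h.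
  have := @exp2_lb a (ltW a0).
  have : expR (a * ln 2) <= expR 0 by rewrite -exp2_expR expR0 -(powRr0 2).
  by rewrite ler_expR leNgt mulr_gt0// ln2_gt0.
exists (1 - r)^-1; first by rewrite invr_gt0 subr_gt0.
move=> m; rewrite -[leRHS]mul1r ler_pdivlMr ?subr_gt0//.
have E : \sum_(0 <= q < m) exp2 (- (a * q%:R)) = \sum_(i < m) r ^+ i.
  rewrite big_mkord; apply: eq_bigr => i _.
  by rewrite -powR_mulrn ?ltW// /r -exp2M mulNr.
rewrite E mulrC.
have -> : (1 - r) * \sum_(i < m) r ^+ i = 1 - r ^+ m.
  by rewrite -[in RHS](expr1n _ m) subrXX; congr (_ * _); apply: eq_bigr => i _; rewrite expr1n mul1r.
by rewrite gerBl exprn_ge0// ltW.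
Qed.

End Ex2.

(* AM-GM in each fibre: N_j^2 / (w_j L) + L w_j >= 2 N_j. *)
Lemma sum_fiber_sq (R : realType) (I J : finType) (g : I -> J) (w : J -> R) (L : R) :
  0 < L -> (forall j, 0 < w j) ->
  2 * #|I|%:R <= (\sum_(p : I * I | g p.1 == g p.2) (w (g p.1))^-1) / L
                 + L * \sum_j w j.
Proof.
move=> L0 w0.
pose N j : R := #|[pred a | g a == j]|%:R.
have E1 : #|I|%:R = \sum_j N j.
  rewrite -sum1_card natr_sum (partition_big g predT)//=.
  by apply: eq_bigr => j _; rewrite /N -sum1_card natr_sum.
have E2 : \sum_(p : I * I | g p.1 == g p.2) (w (g p.1))^-1 = \sum_j N j ^+ 2 / w j.
  rewrite (partition_big (fun p => g p.1) predT)//=; apply: eq_bigr => j _.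
  transitivity (\sum_(p : I * I | (g p.1 == j) && (g p.2 == j)) (w j)^-1).
    apply: eq_big => [p|p /andP[_ /eqP ->]//].
    by case: (g p.1 =P j) => [->|_]; rewrite ?andbF ?andbT// eq_sym.
  rewrite -(pair_big (fun a => g a == j) (fun a => g a == j) (fun _ _ => (w j)^-1))/=.
  rewrite (eq_bigr (fun _ => N j / w j)) => [|a _]; last first.
    by rewrite sumr_const -mulr_natl /N.
  by rewrite sumr_const -mulr_natl -/(N j) mulrA expr2.
rewrite E1 E2 mulr_sumr mulr_suml mulr_sumr -big_split /=.
apply: ler_sum => j _.
have wj := w0 j; rewrite -subr_ge0.
have -> : N j ^+ 2 / w j / L + L * w j - 2 * N j = (N j - L * w j) ^+ 2 / (w j * L).
  by field; rewrite !gt_eqF.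
by rewrite divr_ge0 ?sqr_ge0// mulr_ge0 ?ltW.
Qed.

Section Content.
Context {R : realType} {n : nat}.
Implicit Types (B U : set (euclid R n)).

Lemma diam_ge (X : metricType R) (U : set X) x y : U x -> U y -> ((mdist x y)%:E <= diam U)%E.
Proof. by move=> Ux Uy; apply: ereal_sup_ubound; exists x => //; exists y. Qed.

Lemma diam_ge0 (X : metricType R) (U : set X) : U !=set0 -> (0 <= diam U)%E.
Proof.
by move=> [x Ux]; rewrite (le_trans _ (diam_ge Ux Ux))// mdistxx.
Qed.

Lemma diam_le (X : metricType R) (U : set X) (c : R) :
  (forall x y, U x -> U y -> mdist x y <= c) -> (diam U <= c%:E)%E.
Proof.
by move=> h; apply: ge_ereal_sup => _ [x Ux [y Uy <-]]; rewrite lee_fin h.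
Qed.

Lemma diam_pow_ge0 (X : metricType R) s (U : set X) : (0 <= diam_pow s U)%E.
Proof. by rewrite /diam_pow; case: ifP => // _; exact: poweR_ge0. Qed.

Lemma hausdorff_measure0 (X : metricType R) (s : R) (A : set X) (delta eta : R) :
  hausdorff_measure s A = 0 -> 0 < delta -> 0 < eta ->
  exists U : nat -> set X, [/\ A `<=` \bigcup_i U i,
    forall i, (diam (U i) <= delta%:E)%E &
    forall I : nat, (\sum_(0 <= i < I) diam_pow s (U i) <= eta%:E)%E].
Proof.
move=> h d0 e0.
have : (hausdorff_premeasure s delta A < eta%:E)%E.
  rewrite (@le_lt_trans _ _ 0%E) ?lte_fin// -h.
  by apply: ereal_sup_ubound; exists delta.
move=> /ereal_inf_lt [_ [U /= [AU Ud] <-] /ltW Ue].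
exists U; split => // I; apply: le_trans Ue.
by apply: nneseries_lim_ge => *; exact: diam_pow_ge0.
Qed.

(** Members of a cover are replaced by dyadic scales 2^-q between 4 and 8 times their diameter; the
    factor 4 leaves room for enlarging them to open sets. A set of diameter 0 has no such scale and
    gets one so small that [eta] pays for it. *)
Lemma choose_scale (X : metricType R) (U : set X) (s1 s2 eta : R) :
  0 <= s1 -> s1 <= s2 -> 0 < s2 -> 0 < eta -> (diam U <= (8^-1)%:E)%E ->
  exists q : nat, (forall x y, U x -> U y -> mdist x y <= exp2 (- q%:R) / 4) /\
    ((exp2 (- (s2 * q%:R)))%:E <= (8 `^ s2)%:E * diam_pow s1 U + eta%:E)%E.
Proof.
move=> s10 s12 s20 e0 dU.
have [q0 hq0] := exp2_small s20 e0.
have [U0|/set0P Un] := eqVneq U set0.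
  exists q0; split; first by rewrite U0.
  rewrite (@le_trans _ _ eta%:E) ?lee_fin ?hq0//.
  by rewrite leeDr// mule_ge0 ?diam_pow_ge0// lee_fin powR_ge0.
have dU0 := diam_ge0 Un.
have dfin : diam U = (fine (diam U))%:E.
  rewrite fineK// fin_numElt (lt_le_trans _ dU0) ?ltNy0//=.
  by rewrite (le_lt_trans dU)// ltry.
set d := fine (diam U) in dfin; rewrite dfin in dU0 dU *; rewrite !lee_fin in dU0 dU.
have dxy x y : U x -> U y -> mdist x y <= d.
  by move=> Ux Uy; rewrite -lee_fin -dfin diam_ge.
have [d0|d0] := eqVneq d 0.
  exists q0; split.
    by move=> x y Ux Uy; rewrite (le_trans (dxy _ _ Ux Uy))// d0 divr_ge0// exp2_ge0.
  rewrite (@le_trans _ _ eta%:E) ?lee_fin ?hq0//.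
  by rewrite leeDr// mule_ge0 ?diam_pow_ge0// lee_fin powR_ge0.
have dpos : 0 < d by rewrite lt_def d0.
have [||q [h1 h2]] := @dyadic_scale R (4 * d); [by lra|by lra|].
exists q; split.
  by move=> x y Ux Uy; rewrite (le_trans (dxy _ _ Ux Uy))// ler_pdivlMr// mulrC.
rewrite /diam_pow; case: ifPn => [/eqP U0|_].
  by case: Un => x; rewrite U0.
rewrite dfin poweR_EFin -EFinM -EFinD lee_fin.
rewrite (@le_trans _ _ (8 `^ s2 * d `^ s1))//; last by rewrite lerDl ltW.
have -> : exp2 (- (s2 * q%:R)) = exp2 (- q%:R) `^ s2 by rewrite -exp2M mulNr mulrC.
rewrite (@le_trans _ _ ((8 * d) `^ s2))//.
  apply: ge0_ler_powR; rewrite ?nnegrE ?exp2_ge0 ?ltW//; lra.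
rewrite powRM//; apply: ler_wpM2l; first exact: powR_ge0.
by apply: ger_powR => //; rewrite dpos/=; lra.
Qed.

Lemma compact_finite_subcover B (f : nat -> set (euclid R n)) :
  compact B -> (forall i, open (f i)) -> B `<=` cover setT f ->
  finite_subset_cover [set: nat] f B.
Proof.
pose iP := isPointed.Build (euclid R n) 0.
pose P : ptopologicalType := HB.pack (euclid R n) iP.
move=> cB fo Bf.
have : @cover_compact P B by rewrite -(@compact_cover P).
by move=> /(_ nat setT f); apply.
Qed.

Lemma metric_ball_open (X : metricType R) (x : X) (r : R) : open (ball x r).
Proof.
rewrite openE => y; rewrite ballEmdist/= => xy.
have ry : 0 < r - mdist x y by rewrite subr_gt0.
apply: filterS (nbhsx_ballx y _ ry) => z; rewrite !ballEmdist/= => yz.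
by rewrite (le_lt_trans (metric_triangle x y z))// -ltrBrDl.
Qed.

Lemma ler_sum_uniq_sub (T : eqType) (s t : seq T) (f : T -> R) :
  uniq s -> uniq t -> {subset s <= t} -> (forall i, 0 <= f i) ->
  \sum_(i <- s) f i <= \sum_(i <- t) f i.
Proof.
move=> us ut st f0.
have -> : \sum_(i <- s) f i = \sum_(i <- t | i \in s) f i.
  have h : perm_eq s [seq i <- t | i \in s].
    apply: uniq_perm => //; first exact: filter_uniq.
    by move=> i; rewrite mem_filter; case: (boolP (i \in s)) => // /st ->.
  by rewrite -[RHS]big_filter; exact: perm_big.
by rewrite [leRHS](bigID (mem s))/= lerDl sumr_ge0.
Qed.

Lemma exp2_geom_half m : \sum_(0 <= i < m) exp2 (- i.+1%:R) <= 1 :> R.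
Proof.
suff -> : \sum_(0 <= i < m) exp2 (- i.+1%:R) = 1 - exp2 (- m%:R) :> R.
  by rewrite gerBl exp2_ge0.
elim: m => [|m ih]; first by rewrite big_nil oppr0 exp20 subrr.
by rewrite big_nat_recr//= ih exp2NS; lra.
Qed.

Lemma cover_weight (X : metricType R) (U : nat -> set X) (q : nat -> nat)
    (s1 s2 eta : R) (D : {fset nat}) :
  0 <= eta ->
  (forall I : nat, (\sum_(0 <= i < I) diam_pow s1 (U i) <= eta%:E)%E) ->
  (forall i, ((exp2 (- (s2 * (q i)%:R)))%:E <=
     (8 `^ s2)%:E * diam_pow s1 (U i) + (eta * exp2 (- i.+1%:R))%:E)%E) ->
  \sum_(i : D) exp2 (- (s2 * (q (val i))%:R)) <= (8 `^ s2 + 1) * eta.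
Proof.
move=> eta0 SU hq.
pose I := (\max_(i <- D) i).+1.
rewrite -(big_seq_fsetE _ _ predT (fun i => exp2 (- (s2 * (q i)%:R))))/=.
rewrite (@le_trans _ _ (\sum_(0 <= i < I) exp2 (- (s2 * (q i)%:R))))//.
  apply: ler_sum_uniq_sub => [||i iD|i]; rewrite ?fset_uniq ?iota_uniq ?exp2_ge0//.
  by rewrite mem_index_iota/= ltnS; apply: leq_bigmax_seq.
rewrite -lee_fin -sumEFin (le_trans (lee_sum _ (fun i _ => hq i)))//.
rewrite big_split/= -ge0_sume_distrr; last by move=> *; exact: diam_pow_ge0.
rewrite sumEFin -mulr_sumr mulrDl mul1r EFinD leeD//.
  by rewrite EFinM lee_wpmul2l// lee_fin powR_ge0.
by rewrite lee_fin -[leRHS]mulr1 ler_wpM2l// exp2_geom_half.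
Qed.

(* A discrete energy method, without a limit measure: the points are distributed
   over the members of a hypothetical efficient cover, and [sum_fiber_sq] bounds
   their number by the weighted number of close pairs. *)
Lemma content_dim B (C lam : R) : compact B -> 0 <= lam -> 0 <= C ->
  (forall (eps : R) (M : nat), 0 < eps -> exists m : nat, (M <= m)%N /\
    exists (I : finType) (x : I -> euclid R n), [/\ (0 < #|I|)%N,
      forall i, exists2 y, B y & enorm (x i - y) <= eps &
      forall q : nat, (q <= m)%N ->
        #|[pred p : I * I | enorm (x p.1 - x p.2) <= exp2 (- q%:R)]|%:R <=
          C * exp2 (- (lam * q%:R)) * #|I|%:R ^+ 2]) ->
  (lam%:E <= hausdorff_dim B)%E.
Proof.
move=> cB lam0 C0 H; apply: le_ereal_inf_tmp => _ [s1 /= [s10 hs1] <-].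
rewrite lee_fin leNgt; apply/negP => s1lam.
pose s2 := (s1 + lam) / 2.
have s12 : s1 < s2 by rewrite /s2; lra.
have s2l : s2 < lam by rewrite /s2; lra.
have s20 : 0 < s2 by lra.
have [G G0 hG] := @exp2_geom R (lam - s2) ltac:(by lra).
have G'0 : 0 < (C * G + 1) by rewrite ltr_wpDl// mulr_ge0// ltW.
(* With L = (C G + 1) |I| in [sum_fiber_sq], the term of close pairs is at most |I|, and total
   weight [W] makes the other term at most |I| / 2. Together they stay below 2 |I|, a
   contradiction. *)
pose W := (2 * (C * G + 1))^-1.
have W0 : 0 < W by rewrite invr_gt0 mulr_gt0.
pose A8 : R := 8 `^ s2 + 1.
have A80 : 0 < A8 by rewrite ltr_wpDl// powR_ge0.
pose eta := W / A8.
have eta0 : 0 < eta by rewrite divr_gt0.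
have d8 : 0 < 8^-1 :> R by [].
have [U [BU dU SU]] := hausdorff_measure0 hs1 d8 eta0.
have e_i (i : nat) : 0 < eta * exp2 (- i.+1%:R) by rewrite mulr_gt0// exp2_gt0.
have /choice [q hq] : forall i, exists q : nat,
    (forall x y, U i x -> U i y -> mdist x y <= exp2 (- q%:R) / 4) /\
    ((exp2 (- (s2 * q%:R)))%:E <= (8 `^ s2)%:E * diam_pow s1 (U i)
        + (eta * exp2 (- i.+1%:R))%:E)%E.
  by move=> i; apply: choose_scale => //; exact: ltW.
have SW (D : {fset nat}) : \sum_(i : D) exp2 (- (s2 * (q (val i))%:R)) <= W.
  rewrite (le_trans (cover_weight _ (ltW eta0) SU _)) ?(fun i => (hq i).2)//.
    by move=> i; have [] := hq i.
  by rewrite /eta mulrC divfK// gt_eqF.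
(* The neighbourhoods with r = 8 cover B. The points [x a] are only within [e] of B and lie in those
   with r = 4, where two points are at distance at most 3/4 of 2^-q. *)
pose O (i : nat) (r : R) : set (euclid R n) :=
  \bigcup_(u in U i) ball u (exp2 (- (q i)%:R) / r).
have Oopen i r : open (O i r).
  by apply: bigcup_open => u _; exact: metric_ball_open.
have [D _ BD] : finite_subset_cover [set: nat] (fun i => O i 8) B.
  apply: (compact_finite_subcover cB); first by move=> i; apply: Oopen.
  move=> x /BU [i _ Ux]; exists i => //; exists x => //.
  by apply: ballxx; rewrite divr_gt0// exp2_gt0.
pose Q := (\max_(i <- D) q i)%N.
have qQ i : i \in D -> (q i <= Q)%N by move=> iD; apply: leq_bigmax_seq.
pose e : R := exp2 (- Q%:R) / 8.
have e0 : 0 < e by rewrite divr_gt0// exp2_gt0.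
have he i : i \in D -> e <= exp2 (- (q i)%:R) / 8.
  by move=> /qQ iQ; rewrite ler_pM2r// exp2_le// lerN2 ler_nat.
have [m [hm [I [x [I0 xB hx]]]]] := H e Q e0.
have /choice [g hg] : forall a, exists i : D, O (val i) 4 (x a).
  move=> a; have [y /BD[i iD [u Uu uy]] xy] := xB a.
  exists [` iD]%fset => /=; exists u => //.
  have {}xy : mdist y (x a) <= e by rewrite edistE enormB.
  move: uy; rewrite !ballEmdist/= => uy.
  rewrite (le_lt_trans (metric_triangle _ y _))//.
  have := he _ iD; lra.
have gq a b : g a = g b -> enorm (x a - x b) <= exp2 (- (q (val (g a)))%:R).
  move=> gab; have := hg b; rewrite -gab; have := hg a.
  move=> [u Uu]; rewrite ballEmdist/= => ua [v Uv]; rewrite ballEmdist/= => vb.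
  have [/(_ u v Uu Uv) uv _] := hq (val (g a)).
  have := metric_triangle (x a) u (x b).
  have := metric_triangle u v (x b).
  move: uv; rewrite -edistE (metric_sym (x a) u) /= => h1 h2 h3.
  rewrite (le_trans h3)//.
  rewrite (le_trans (lerD (ltW ua) h2))//.
  rewrite (le_trans (lerD (lexx _) (lerD h1 (ltW vb))))//.
  have := exp2_gt0 (- (q (fsval (g a)))%:R : R); lra.
have N0 : 0 < (#|I|%:R : R) by rewrite ltr0n.
have S1 : \sum_(p : I * I | g p.1 == g p.2) (exp2 (- (s2 * (q (val (g p.1)))%:R)))^-1
    <= C * G * #|I|%:R ^+ 2.
  (* Two points assigned to the same set are close at its scale, so their weight is one term of the
     sum over all scales. The full sum is a discrete energy, bounded because s2 < lam. *)
  rewrite (@le_trans _ _ (\sum_(p : I * I) \sum_(0 <= j < m.+1)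
     exp2 (s2 * j%:R) * (enorm (x p.1 - x p.2) <= exp2 (- j%:R))%R%:R))//.
    rewrite [leRHS](bigID (fun p : I * I => g p.1 == g p.2))/=.
    rewrite -[leLHS]addr0 lerD//; last first.
      by apply: sumr_ge0 => p _; apply: sumr_ge0 => j _; rewrite mulr_ge0// exp2_ge0.
    apply: ler_sum => p /eqP gp; rewrite -exp2N opprK.
    rewrite (bigD1_seq (q (val (g p.1)))) ?iota_uniq//=; last first.
      by rewrite mem_index_iota/= ltnS (leq_trans (qQ _ _) hm)// fsvalP.
    rewrite gq// mulr1 lerDl; apply: sumr_ge0 => j _.
    by rewrite mulr_ge0// exp2_ge0.
  rewrite exchange_big/=.
  rewrite (@le_trans _ _ (\sum_(0 <= j < m.+1)
    C * #|I|%:R ^+ 2 * exp2 (- ((lam - s2) * j%:R))))//; last first.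
    rewrite -mulr_sumr mulrAC ler_wpM2r// ?mulr_ge0 ?sqr_ge0//.
    by rewrite ler_wpM2l.
  rewrite big_nat [leRHS]big_nat; apply: ler_sum => j /andP[_ jm].
  rewrite -mulr_sumr.
  have -> : \sum_(p : I * I) (enorm (x p.1 - x p.2) <= exp2 (- j%:R))%R%:R =
     #|[pred p : I * I | enorm (x p.1 - x p.2) <= exp2 (- j%:R)]|%:R :> R.
    by rewrite -sum1_card natr_sum [RHS]big_mkcond/=; apply: eq_bigr => p _; rewrite inE; case: ifP.
  have -> : - ((lam - s2) * j%:R) = s2 * j%:R + - (lam * j%:R) :> R by ring.
  rewrite exp2D mulrCA ler_wpM2l ?exp2_ge0//.
  by rewrite mulrAC; apply: hx; rewrite -ltnS.
have L0 : 0 < (C * G + 1) * #|I|%:R by rewrite mulr_gt0.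
have := @sum_fiber_sq R I D g (fun i => exp2 (- (s2 * (q (val i))%:R))) _ L0
  (fun _ => exp2_gt0 _).
apply/negP; rewrite -ltNge.
have h1 : (C * G + 1) * #|I|%:R * (\sum_(i : D) exp2 (- (s2 * (q (val i))%:R))) <= #|I|%:R / 2.
  rewrite (@le_trans _ _ ((C * G + 1) * #|I|%:R * W))//.
    by rewrite ler_wpM2l// ltW.
  by rewrite /W le_eqVlt; apply/orP; left; apply/eqP; field; rewrite gt_eqF.
have h2 : (\sum_(p : I * I | g p.1 == g p.2) (exp2 (- (s2 * (q (val (g p.1)))%:R)))^-1)
    / ((C * G + 1) * #|I|%:R) <= #|I|%:R.
  rewrite ler_pdivrMr// (le_trans S1)//.
  have -> : #|I|%:R * ((C * G + 1) * #|I|%:R) = (C * G + 1) * #|I|%:R ^+ 2 :> R by ring.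
  rewrite ler_wpM2r ?sqr_ge0//.
  by rewrite lerDl.
rewrite (le_lt_trans (lerD h2 h1))//; lra.
Qed.

End Content.

Section HausdorffDim.
Context {R : realType}.

Lemma hausdorff_measure_eq0 (X : metricType R) (s : R) (A : set X) :
  (forall delta eta : R, 0 < delta -> 0 < eta ->
    exists U : nat -> set X, [/\ A `<=` \bigcup_i U i,
      forall i, (diam (U i) <= delta%:E)%E &
      forall I : nat, (\sum_(0 <= i < I) diam_pow s (U i) <= eta%:E)%E]) ->
  hausdorff_measure s A = 0.
Proof.
move=> H.
have h0 (delta : R) : 0 < delta -> hausdorff_premeasure s delta A = 0.
  move=> d0; apply/eqP; rewrite eq_le; apply/andP; split.
    apply/lee_addgt0Pr => eta e0; rewrite add0e.
    have [U [AU Ud SU]] := H _ _ d0 e0.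
    apply: (@le_trans _ _ (\sum_(0 <= i <oo) diam_pow s (U i))%E).
      by apply: ereal_inf_lbound; exists U.
    apply: lime_le; first by apply: is_cvg_nneseries => *; exact: diam_pow_ge0.
    by apply: nearW => I; exact: SU.
  apply: le_ereal_inf_tmp => _ [U _ <-].
  by apply: nneseries_ge0 => *; exact: diam_pow_ge0.
apply/eqP; rewrite eq_le; apply/andP; split.
  by apply: ge_ereal_sup => _ [d d0 <-]; rewrite h0.
by rewrite -(h0 1 ltr01); apply: ereal_sup_ubound; exists 1 => //=.
Qed.

Lemma hausdorff_dim_lipschitz (X Y : metricType R) (A : set X) (f : X -> Y) (L : R) :
  0 < L -> (forall x y, A x -> A y -> mdist (f x) (f y) <= L * mdist x y) ->
  (hausdorff_dim (f @` A) <= hausdorff_dim A)%E.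
Proof.
move=> L0 fL; apply: le_ereal_inf_tmp => _ [s /= [s0 hs] <-].
apply: ereal_inf_lbound; exists s => //; split => //.
apply: hausdorff_measure_eq0 => delta eta d0 e0.
have d'0 : 0 < delta / L by rewrite divr_gt0.
have Ls0 : 0 < L `^ s by rewrite powR_gt0.
have e'0 : 0 < eta / L `^ s by rewrite divr_gt0.
have [U [AU Ud SU]] := hausdorff_measure0 hs d'0 e'0.
have dU (i : nat) : (diam (f @` (U i `&` A)) <= L%:E * diam (U i))%E.
  apply: ge_ereal_sup => _ [_ [x [Ux Ax] <-] [_ [y [Uy Ay] <-] <-]].
  rewrite (@le_trans _ _ (L%:E * (mdist x y)%:E)%E) ?lee_fin ?fL//.
  by apply: lee_wpmul2l; [rewrite lee_fin ltW|exact: diam_ge].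
have dpU (i : nat) : (diam_pow s (f @` (U i `&` A)) <= (L `^ s)%:E * diam_pow s (U i))%E.
  rewrite {1}/diam_pow; case: ifPn => [_|/set0P fU].
    by rewrite mule_ge0 ?diam_pow_ge0// lee_fin ltW.
  have Ui : U i !=set0 by case: fU => _ [x [Ux _] _]; exists x.
  rewrite /diam_pow; case: ifPn => [/eqP E|_]; first by move: Ui; rewrite E => -[].
  have L0' : 0 <= L := ltW L0.
  rewrite -poweR_EFin -poweRM ?lee_fin ?diam_ge0//.
  apply: gt0_ler_poweR => //; rewrite ?in_itv/= ?leey ?andbT ?diam_ge0//.
  by rewrite mule_ge0 ?diam_ge0// lee_fin ltW.
exists (fun i => f @` (U i `&` A)); split.
- by move=> _ [x Ax <-]; have [i _ Ux] := AU _ Ax; exists i => //; exists x.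
- move=> i; rewrite (le_trans (dU i))//.
  rewrite (le_trans (lee_wpmul2l _ (Ud i))) ?lee_fin ?(ltW L0)//.
  by rewrite mulrC divfK// gt_eqF.
- move=> I; rewrite (le_trans (lee_sum _ (fun i _ => dpU i)))//.
  rewrite -ge0_sume_distrr; last by move=> *; exact: diam_pow_ge0.
  rewrite (le_trans (lee_wpmul2l _ (SU I))) ?lee_fin ?(ltW Ls0)//.
  by rewrite mulrC divfK// gt_eqF.
Qed.

(** Covers at some arbitrarily small scales suffice, since an extra exponent e turns the bound c
    into a multiple of delta^e. Read contrapositively, a dimension above a forces many balls at
    every small scale; [loops_separated] uses it in this form. *)
Lemma hausdorff_dim_le_cover (X : metricType R) (A : set X) (a c : R) :
  0 <= a -> 0 <= c ->
  (forall eps : R, 0 < eps -> exists delta : R, [/\ 0 < delta, delta <= eps &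
    exists cs : seq X, (size cs)%:R * delta `^ a <= c /\
      forall x, A x -> exists2 y, y \in cs & mdist y x <= delta]) ->
  (hausdorff_dim A <= a%:E)%E.
Proof.
move=> a0 c0 H; apply/lee_addgt0Pr => e e0; rewrite -EFinD.
apply: ereal_inf_lbound; exists (a + e) => //; split; first by rewrite addr_ge0// ltW.
apply: hausdorff_measure_eq0 => delta eta d0 eta0.
set K := 2 `^ (a + e) * c + 1.
have K0 : 0 < K by rewrite ltr_wpDl// mulr_ge0// powR_ge0.
have r0 : 0 < (eta / K) `^ e^-1 by rewrite powR_gt0// divr_gt0.
have m0 : 0 < Num.min (delta / 2) ((eta / K) `^ e^-1) by rewrite lt_min divr_gt0.
have [d [dpos dle [cs [hsz hcs]]]] := H _ m0.
move: dle; rewrite le_min => /andP[dd dr].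
have de : d `^ e <= eta / K.
  rewrite (@le_trans _ _ (((eta / K) `^ e^-1) `^ e))//.
    by apply: ge0_ler_powR; rewrite ?nnegrE//; exact: ltW.
  by rewrite -powRrM mulVf ?gt_eqF// powRr1// ltW// divr_gt0.
(* The inner match supplies a default point for [nth], as X may be empty. *)
pose U (i : nat) : set X := if (i < size cs)%N then
   (if cs is c0 :: _ then [set x | mdist (nth c0 cs i) x <= d] else set0) else set0.
have diamU (i : nat) : (diam (U i) <= (2 * d)%:E)%E.
  apply: diam_le => x y; rewrite /U; case: ifP => // _; case: cs {hsz hcs U} => // z cs /= zx zy.
  rewrite (le_trans (metric_triangle _ (nth z (z :: cs) i) _))// metric_sym.
  by rewrite mulrDl !mul1r lerD.
exists U; split.
- move=> x /hcs [y ycs yx]; exists (index y cs) => //.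
  rewrite /U index_mem ycs; case: cs ycs {hsz hcs U diamU} => // z cs ycs.
  by rewrite /= nth_index.
- by move=> i; rewrite (le_trans (diamU i))// lee_fin mulrC -ler_pdivlMr.
- move=> I.
  have dp (i : nat) : (diam_pow (a + e) (U i) <=
      (if (i < size cs)%N then (2 * d) `^ (a + e) else 0)%:E)%E.
    rewrite /diam_pow; case: ifPn => [_|Ui].
      by rewrite lee_fin; case: ifP => //; rewrite powR_ge0.
    have -> : (i < size cs)%N by move: Ui; rewrite /U; case: ifP => //; rewrite eqxx.
    rewrite -poweR_EFin; apply: gt0_ler_poweR; rewrite ?in_itv/= ?leey ?andbT//.
    + by rewrite addr_ge0// ltW.
    + by rewrite diam_ge0//; exact/set0P.
    + by rewrite lee_fin mulr_ge0// ltW.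
  rewrite (le_trans (lee_sum _ (fun i _ => dp i)))// sumEFin lee_fin.
  rewrite -big_mkcond/=.
  rewrite (@le_trans _ _ ((size cs)%:R * (2 * d) `^ (a + e)))//.
    rewrite -big_filter big_const_seq count_predT iter_addr_0 -[leLHS]mulr_natl.
    rewrite ler_wpM2r ?powR_ge0// ler_nat.
    rewrite -(size_iota 0 (size cs)) uniq_leq_size ?filter_uniq ?iota_uniq//.
    by move=> i; rewrite mem_filter mem_iota !size_iota => /andP[-> _].
  rewrite powRM ?(ltW dpos)// [d `^ _]powRD; last by rewrite (gt_eqF dpos) implybT.
  have -> : (size cs)%:R * (2 `^ (a + e) * (d `^ a * d `^ e)) =
     2 `^ (a + e) * ((size cs)%:R * d `^ a) * d `^ e by ring.
  rewrite (@le_trans _ _ (K * (eta / K)))//; last by rewrite mulrC divfK// gt_eqF.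
  apply: ler_pM => //; rewrite ?mulr_ge0 ?powR_ge0//.
  rewrite /K (le_trans (ler_wpM2l _ hsz)) ?powR_ge0//.
  by rewrite lerDl.
Qed.

End HausdorffDim.

(** * Counting subspaces with a small projection of a vector *)

Section Chart.
Context {R : realType} {n k : nat}.
Implicit Types (V W : {vspace euclid R n}) (M : 'M[R]_(n, k)) (f : {ffun 'I_k -> 'I_n}).

(* [V] is the column space of a matrix with identity rows at [f] and entries in
   [-1, 1]; the identity block comes from a minor of largest absolute value. *)
Definition chart f M V : Prop :=
  [/\ injective f,
      forall j l, M (f j) l = (j == l)%:R,
      forall i l, `|M i l| <= 1,
      forall c : 'cV[R]_k, (M *m c : euclid R n) \in V &
      forall v : euclid R n, v \in V -> v = M *m \col_l v (f l) ord0].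

Lemma det_replace_row (M : 'M[R]_k) (l : 'I_k) :
  (forall i j, i != l -> M i j = (i == j)%:R) -> \det M = M l l.
Proof.
move=> h; rewrite (expand_det_col M l) (bigD1 l)//= big1 ?addr0; last first.
  by move=> j jl; rewrite h// (negbTE jl) mul0r.
rewrite /cofactor -signr_odd addnn odd_double expr0 mul1r.
have -> : row' l (col' l M) = 1%:M.
  apply/matrixP => a b; rewrite !mxE h ?neq_lift//; last by rewrite eq_sym neq_lift.
  by rewrite (inj_eq lift_inj).
by rewrite det1 mulr1.
Qed.

Lemma rowsub_mulmx m p q (g : 'I_m -> 'I_p) (A : 'M[R]_(p, q)) r (B : 'M[R]_(q, r)) :
  rowsub g (A *m B) = rowsub g A *m B.
Proof. by apply/matrixP => i j; rewrite !mxE; apply: eq_bigr => a _; rewrite !mxE. Qed.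

Lemma exists_chart V : \dim V = k -> exists f M, chart f M V.
Proof.
move=> dV.
have [X bX] : exists X : k.-tuple (euclid R n), basis_of V X.
  exists (tcast dV (vbasis V)); have := vbasisP V.
  by rewrite -[X in basis_of V X -> _](val_tcast dV).
pose B : 'M[R]_(n, k) := \matrix_(i, j) (X`_j : euclid R n) i ord0.
have Bsum (c : 'cV[R]_k) : (B *m c : euclid R n) = \sum_(j < k) c j ord0 *: (X`_j : euclid R n).
  apply/colP => i; rewrite summxE mxE; apply: eq_bigr => j _.
  by rewrite !mxE mulrC.
have fX : free X := basis_free bX.
have Bfull : row_full B.
  rewrite /row_full -mxrank_tr -/(row_free B^T).
  apply: inj_row_free => v vB.
  have {}vB : B *m v^T = 0 by rewrite -[B]trmxK -trmx_mul vB trmx0.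
  have := Bsum v^T; rewrite vB => /esym/(freeP fX (fun j => v^T j ord0)) E.
  by apply/rowP => j; have := E j; rewrite !mxE.
have [f0 uf0] : exists f : {ffun 'I_k -> 'I_n}, \det (rowsub f B) != 0.
  exists (finfun (fullrankfun Bfull)).
  rewrite -unitfE -unitmxE.
  rewrite (_ : rowsub _ B = rowsub (fullrankfun Bfull) B) ?fullrowsub_unit//.
  by apply/matrixP => i j; rewrite !mxE ffunE.
pose f := [arg max_(g > f0) `|\det (rowsub g B)|]%O.
have fmax (g : {ffun 'I_k -> 'I_n}) : `|\det (rowsub g B)| <= `|\det (rowsub f B)|.
  by rewrite /f; case: arg_maxP => // h _; apply.
have df : \det (rowsub f B) != 0.
  by rewrite -normr_gt0 (lt_le_trans _ (fmax f0))// normr_gt0.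
pose D := rowsub f B.
have uD : D \in unitmx by rewrite unitmxE unitfE.
pose M := B *m invmx D.
have fM : rowsub f M = 1%:M by rewrite rowsub_mulmx mulmxV.
have MfE j l : M (f j) l = (j == l)%:R.
  by have /matrixP/(_ j l) := fM; rewrite mxE [RHS]mxE.
exists f, M; split => //.
- move=> a b fab; apply/eqP; move: (MfE a b); rewrite fab MfE eqxx.
  by case: (a == b) => //= /eqP; rewrite oner_eq0.
- move=> i l.
  (* Cramer's rule: putting row i in place of row [f l] multiplies the minor by [M i l], and the
     minor at [f] has the largest absolute value. *)
  pose g := [ffun j => if j == l then i else f j].
  have E : rowsub g B = rowsub g M *m D.
    by rewrite -rowsub_mulmx /M mulmxKV.
  have := fmax g; rewrite E det_mulmx normrM -[leRHS]mul1r ler_pM2r ?normr_gt0//.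
  rewrite (@det_replace_row _ l) ?mxE ?ffunE ?eqxx// => a b al.
  by rewrite mxE ffunE (negbTE al) MfE.
- move=> c; rewrite /M -mulmxA Bsum rpred_sum// => j _; rewrite rpredZ//.
  by apply: (basis_mem bX); rewrite mem_nth// size_tuple.
- move=> v vV.
  have [c vc] : exists c : 'cV[R]_k, v = M *m c.
    exists (D *m \col_j coord X j v); rewrite /M mulmxA mulmxKV// Bsum.
    rewrite [LHS](coord_basis bX vV); apply: eq_bigr => j _.
    by rewrite mxE.
  rewrite {1}vc; congr (_ *m _).
  have : rowsub f v = \col_l v (f l) ord0 by apply/colP => l; rewrite !mxE.
  by move=> <-; rewrite vc rowsub_mulmx fM mul1mx.
Qed.

End Chart.

Section GrCompare.
Context {R : realType} {n : nat}.
Implicit Types (V W : {vspace euclid R n}).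

Lemma orthproj_min W (u w : euclid R n) : w \in W ->
  enorm (u - orthproj W u) <= enorm (u - w).
Proof.
move=> wW; set d := u - orthproj W u.
have [d0|d0] := eqVneq (enorm d) 0; first by rewrite d0 enorm_ge0.
have dpos : 0 < enorm d by rewrite lt_def d0 enorm_ge0.
rewrite -(ler_pM2l dpos) -expr2 sqr_enorm.
have -> : dotv d d = dotv d (u - w); last exact: dotv_le.
have -> : u - w = d + (orthproj W u - w) by rewrite /d addrA subrK.
rewrite dotvDr [X in _ = _ + X](_ : _ = 0) ?addr0//.
by have [_ ->] := orthprojP W u; rewrite // rpredB// memv_orthproj.
Qed.

Lemma enorm_orthcomp W (u : euclid R n) : enorm (u - orthproj W u) <= enorm u.
Proof. by have := @orthproj_min W u 0 (mem0v _); rewrite subr0. Qed.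

Lemma orthproj_close V W (eta : R) : 0 <= eta ->
  (forall v, v \in V -> exists2 w, w \in W & enorm (v - w) <= eta * enorm v) ->
  (forall w, w \in W -> exists2 v, v \in V & enorm (w - v) <= eta * enorm w) ->
  forall x, enorm (orthproj V x - orthproj W x) <= 2 * eta * enorm x.
Proof.
move=> eta0 VW WV x.
have -> : orthproj V x - orthproj W x =
   (orthproj V x - orthproj W (orthproj V x)) - orthproj W (x - orthproj V x).
  by rewrite orthprojB opprB addrC subrKA addrC.
rewrite (le_trans (enormD _ _))// enormN -mulrA mulrDl !mul1r lerD//.
  have [w wW vw] := VW _ (memv_orthproj V x).
  rewrite (le_trans (orthproj_min _ wW))// (le_trans vw)//.
  by rewrite ler_wpM2l// enorm_orthproj.
set z := x - orthproj V x; set w := orthproj W z.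
have [->|w0] := eqVneq (enorm w) 0; first by rewrite mulr_ge0// enorm_ge0.
have wpos : 0 < enorm w by rewrite lt_def w0 enorm_ge0.
rewrite -(ler_pM2l wpos) -expr2 sqr_enorm.
have -> : dotv w w = dotv (w - orthproj V w) z.
  rewrite dotvBl [X in _ = _ - X](_ : _ = 0).
    by rewrite subr0 /w dotv_orthproj ?memv_orthproj// dotvC.
  by rewrite dotvC; have [_ ->] := orthprojP V x; rewrite // memv_orthproj.
rewrite (le_trans (dotv_le _ _))//.
have [v vV wv] := WV w (memv_orthproj W z).
rewrite mulrA [enorm w * _]mulrC ler_pM ?enorm_ge0//; last exact: enorm_orthcomp.
by rewrite (le_trans (orthproj_min _ vV)).
Qed.

End GrCompare.

Section ChartDist.
Context {R : realType} {n k : nat}.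
Implicit Types (V W : grassmannian R n k).

(** Vectors of V and W with the same coordinates at the identity rows are matched. These coordinates
    are bounded by the norm, so entrywise closeness passes to vectors at the cost of a factor n
    k. *)
Lemma chart_dist V W (f : {ffun 'I_k -> 'I_n}) (M N : 'M[R]_(n, k)) (h : R) :
  0 <= h -> chart f M (val V) -> chart f N (val W) ->
  (forall i l, `|M i l - N i l| <= h) -> mdist V W <= 2 * (n%:R * (k%:R * h)).
Proof.
move=> h0 [_ _ _ MV VM] [_ _ _ NW WN] MN.
have key (P Q : 'M[R]_(n, k)) (U : {vspace euclid R n}) :
    (forall i l, `|P i l - Q i l| <= h) ->
    (forall v : euclid R n, v \in U -> v = P *m \col_l v (f l) ord0) ->
    forall v : euclid R n, v \in U ->
      enorm (v - Q *m \col_l v (f l) ord0) <= n%:R * (k%:R * h) * enorm v.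
  move=> PQ UP v vU; rewrite -mulrA; apply: enorm_le_coord => i.
  have -> : (v - Q *m \col_l v (f l) ord0) i ord0 = \sum_l (P i l - Q i l) * v (f l) ord0.
    rewrite mxE {1}(UP v vU) mxE [X in _ + X]mxE [in X in _ + X]mxE -sumrB.
    by apply: eq_bigr => l _; rewrite !mxE mulrBl.
  rewrite (le_trans (ler_norm_sum _ _ _))//.
  rewrite (@le_trans _ _ (\sum_(l < k) h * enorm v))//.
    apply: ler_sum => l _; rewrite normrM ler_pM//; exact: enorm_coord.
  by rewrite sumr_const card_ord -[leLHS]mulr_natl mulrA.
apply: mdist_Gr_le => [x|]; last by rewrite !mulr_ge0.
apply: orthproj_close; first by rewrite !mulr_ge0.
- by move=> v vV; eexists; [exact: (NW (\col_l v (f l) ord0))|exact: (key M N (val V))].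
- move=> w wW; eexists; first exact: (MV (\col_l w (f l) ord0)).
  by apply: (key N M (val W)) => // i l; rewrite distrC.
Qed.

End ChartDist.

Lemma card_le_fibers (T U : finType) (S : {set T}) (Y : {set U}) (g : T -> U) (B : nat) :
  (forall x, x \in S -> g x \in Y) ->
  (forall y, y \in Y -> (#|[set x in S | g x == y]%SET| <= B)%N) ->
  (#|S| <= #|Y| * B)%N.
Proof.
move=> gY hB; rewrite -sum1_card (partition_big g (mem Y))//=.
rewrite -sum_nat_const; apply: leq_sum => y yY.
by rewrite (leq_trans _ (hB y yY))// -sum1_card; apply: eq_leq; apply: eq_bigl => x; rewrite !inE.
Qed.

Lemma card_close_le (R : realType) (N : nat) (A : {set 'I_N}) (L : R) : 0 <= L ->
  (forall a b, a \in A -> b \in A -> `|(a : nat)%:R - (b : nat)%:R| <= L) ->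
  (#|A|%:R <= L + 1 :> R).
Proof.
move=> L0 h; have [->|/set0Pn[a0 a0A]] := eqVneq A finset.set0.
  by rewrite cards0 addr_ge0.
have [a aA amin] : exists2 a, a \in A & forall b, b \in A -> (a <= b)%N.
  by have := @arg_minnP _ a0 (mem A) (@nat_of_ord N) a0A; case=> a aA ha; exists a.
pose L' := Num.truncn L.
have hb b : b \in A -> (b - a < L'.+1)%N.
  move=> bA; rewrite -(ltr_nat R) natrB ?amin//.
  by rewrite (le_lt_trans _ (truncnS_gt _))// (le_trans (ler_norm _))// h.
pose g (b : 'I_N) : 'I_L'.+1 := inord (b - a).
have : (#|A| <= #|'I_L'.+1|)%N.
  apply: (@leq_card_in _ _ g) => b c bA cA /(congr1 val); rewrite /= !inordK ?hb// => E.
  by apply: val_inj => /=; rewrite -(subnK (amin b bA)) E subnK// amin.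
rewrite card_ord => hA.
rewrite (@le_trans _ _ L'.+1%:R) ?ler_nat// -natr1 lerD2r.
by rewrite truncn_le.
Qed.

Lemma card_family_prod (aT rT : finType) (F : aT -> {pred rT}) :
  #|family F| = (\prod_x #|F x|)%N.
Proof. by rewrite card_family foldrE big_map big_enum. Qed.

Section CodeCount.
Context {R : realType} {n k : nat}.
Implicit Types (f : {ffun 'I_k -> 'I_n}) (u : euclid R n).

(* Quantized columns of chart matrices of subspaces V with |pi_V u| <= rho |u|:
   a column v lies in V, so |<u, v>| = |<pi_V u, v>| is small. The conditions on
   the columns are independent, which gives the exponent k in [code_count]. *)
Definition colcode f (m : nat) u (rho : R) (l : 'I_k) : {set {ffun 'I_n -> 'I_m.+1}} :=
  [set c : {ffun 'I_n -> 'I_m.+1} | [forall i, (i \in codom f) ==> (c i == ord0)] &&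
    `[< exists v : euclid R n, [/\
      forall i, i \notin codom f -> `|v i ord0 - ((c i : nat)%:R * 2 / m%:R - 1)| <= 2 / m%:R,
      forall i, i \in codom f -> v i ord0 = (i == f l)%:R &
      `|dotv u v| <= rho * enorm u] >]]%SET.

Lemma card_offcodom f : injective f -> #|[pred i | i \notin codom f]| = (n - k)%N.
Proof.
move=> fi; have := cardC (mem (codom f)); rewrite card_codom// !card_ord => E.
have -> : (n - k)%N = (k + #|[predC codom f]| - k)%N by rewrite E.
rewrite addnC addnK; apply: eq_card => i; rewrite !inE.
by [].
Qed.

Lemma card_zero_off (m : nat) (P : pred 'I_n) :
  #|[set c : {ffun 'I_n -> 'I_m.+1} | [forall i, ~~ P i ==> (c i == ord0)]]%SET| = (m.+1 ^ #|P|)%N.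
Proof.
have <- : #|pffun_on (ord0 : 'I_m.+1) P predT| = (m.+1 ^ #|P|)%N.
  by rewrite card_pffun_on card_ord.
apply: eq_card => c; rewrite !inE; apply/forallP/pffun_onP => [h|[h _] i].
  split=> //; apply/fintype.subsetP => i; rewrite !inE; apply: contraR => /(implyP (h i)).
  by [].
apply/implyP => Pi; apply: contraR Pi => ci.
by have /fintype.subsetP/(_ i) := h; apply; rewrite inE.
Qed.

Lemma colcode_le f m u rho l : injective f ->
  (#|colcode f m u rho l| <= m.+1 ^ (n - k))%N.
Proof.
move=> fi; rewrite -(card_offcodom fi) -card_zero_off subset_leq_card//.
apply/fintype.subsetP => c; rewrite !inE => /andP[/forallP h _]; apply/forallP => i.
by rewrite negbK.
Qed.

(* A large coordinate of [u] outside the identity rows determines the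
   corresponding entry of the column up to O(rho). *)
Lemma colcode_near f m u rho l (C : R) i0 : injective f -> (0 < m)%N ->
  0 <= C -> m%:R^-1 <= rho -> i0 \notin codom f -> u != 0 ->
  enorm u <= C * `|u i0 ord0| ->
  #|colcode f m u rho l|%:R <=
    (C * (2 + 4 * n%:R) + 6) * rho * (m.+1 ^ (n - k))%:R.
Proof.
move=> fi m0 C0 rm i0f u0 hu.
have nu : 0 < enorm u.
  by rewrite lt_def enorm_ge0 andbT; apply: contra u0 => /eqP/enorm_eq0/eqP.
have mR : 0 < m%:R :> R by rewrite ltr0n.
have r0 : 0 < rho by rewrite (lt_le_trans _ rm)// invr_gt0.
have mr1 : 1 <= m%:R * rho by rewrite -ler_pdivrMl// mulr1.
pose P' : pred 'I_n := [pred i | (i \notin codom f) && (i != i0)].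
have cP' : #|P'|.+1 = (n - k)%N.
  rewrite -(card_offcodom fi) [in RHS](cardD1 i0).
  have -> : (i0 \in [pred i | i \notin codom f]) = true by rewrite inE.
  rewrite add1n; congr S.
  by apply: eq_card => i; rewrite !inE andbC.
pose g (c : {ffun 'I_n -> 'I_m.+1}) : {ffun 'I_n -> 'I_m.+1} :=
  [ffun i => if i == i0 then ord0 else c i].
pose Y := [set c : {ffun 'I_n -> 'I_m.+1} | [forall i, ~~ P' i ==> (c i == ord0)]]%SET.
(* [X] bounds the variation of entry i0 within a fibre of [g]. The two inner products contribute 2
   rho |u|. The other entries differ by at most 4/m <= 4 rho and contribute 4 n rho |u|. Dividing by
   the coordinate of u at i0 costs [C]. *)
pose X := (2 + 4 * n%:R) * C * rho.
have X0 : 0 <= X by rewrite !mulr_ge0 ?(ltW r0)// addr_ge0.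
pose L := m%:R * X / 2 + 2.
have L0 : 0 <= L by rewrite addr_ge0// divr_ge0// mulr_ge0// ltW.
have L01 : 0 <= L + 1 by rewrite addr_ge0.
have ui0 : 0 < `|u i0 ord0|.
  rewrite lt_def normr_ge0 andbT; apply: contraTneq hu => ->.
  by rewrite mulr0 -ltNge.
have hB y : y \in Y -> (#|[set x in colcode f m u rho l | g x == y]%SET| <= Num.truncn (L + 1))%N.
  move=> _; set F := [set x in _ | _]%SET.
  rewrite -(card_in_imset (f := fun c : {ffun 'I_n -> 'I_m.+1} => c i0)); last first.
    move=> c d; rewrite !inE => /andP[_ /eqP gc] /andP[_ /eqP gd] cd.
    apply/ffunP => i; have [->//|ii0] := eqVneq i i0.
    by move: gc; rewrite -gd => /ffunP/(_ i); rewrite !ffunE (negbTE ii0).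
  rewrite truncn_ge_nat//.
  apply: (card_close_le (L := L)) => //.
  move=> _ _ /imsetP[c cF ->] /imsetP[d dF ->].
  move: cF dF; rewrite !inE => /andP[/andP[_ /asboolP[v [v1 v2 v3]]] /eqP gc].
  move=> /andP[/andP[_ /asboolP[w [w1 w2 w3]]] /eqP gd].
  have vw : `|v i0 ord0 - w i0 ord0| <= X.
    have E : u i0 ord0 * (v i0 ord0 - w i0 ord0) =
       dotv u v - dotv u w - \sum_(i | i != i0) u i ord0 * (v i ord0 - w i ord0).
      rewrite /dotv -sumrB (bigD1 i0)//= -[LHS]addr0 -addrA; congr (_ + _).
        by rewrite mulrBr.
      by apply/esym/eqP; rewrite subr_eq0; apply/eqP; apply: eq_bigr => i _; rewrite mulrBr.
    rewrite -(ler_pM2l ui0) -normrM E.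
    rewrite (le_trans (ler_normB _ _))//.
    have h1 : `|dotv u v - dotv u w| <= 2 * rho * enorm u.
      by rewrite (le_trans (ler_normB _ _))//; lra.
    have h2 : `|\sum_(i | i != i0) u i ord0 * (v i ord0 - w i ord0)| <= n%:R * (4 * rho * enorm u).
      rewrite (le_trans (ler_norm_sum _ _ _))//.
      rewrite (@le_trans _ _ (\sum_(i < n) (4 * rho * enorm u)))//; last first.
        by rewrite sumr_const card_ord -[leLHS]mulr_natl.
      rewrite [leRHS](bigID (fun i => i != i0))/= -[leLHS]addr0 lerD//; last first.
        by apply: sumr_ge0 => i _; rewrite !mulr_ge0 ?(ltW r0)// enorm_ge0.
      apply: ler_sum => i ii0; rewrite normrM mulrC ler_pM//; last exact: enorm_coord.
      have [fi'|fi'] := boolP (i \in codom f).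
        by rewrite v2// w2// subrr normr0 mulr_ge0// ltW.
      have ci : c i = d i by move: gc; rewrite -gd => /ffunP/(_ i); rewrite !ffunE (negbTE ii0).
      have := v1 i fi'; have := w1 i fi'; rewrite ci.
      set z := (_ - 1) => hw hv.
      have -> : v i ord0 - w i ord0 = (v i ord0 - z) - (w i ord0 - z) by ring.
      rewrite (le_trans (ler_normB _ _))// (le_trans (lerD hv hw))//.
      rewrite -mulrDl; have -> : 2 + 2 = 4 :> R by lra.
      by rewrite ler_wpM2l.
    have h3 : rho * enorm u <= rho * (C * `|u i0 ord0|) by rewrite ler_wpM2l// ltW.
    rewrite (le_trans (lerD h1 h2))// /X.
    have -> : 2 * rho * enorm u + n%:R * (4 * rho * enorm u) = (2 + 4 * n%:R) * (rho * enorm u) by ring.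
    have -> : `|u i0 ord0| * ((2 + 4 * n%:R) * C * rho) = (2 + 4 * n%:R) * (rho * (C * `|u i0 ord0|)) by ring.
    by rewrite ler_wpM2l// addr_ge0.
  have := v1 i0 i0f; have := w1 i0 i0f.
  set a := (c i0 : nat)%:R; set b := (d i0 : nat)%:R => hb ha.
  have hab : `|a * 2 / m%:R - b * 2 / m%:R| <= X + 4 / m%:R.
    move: vw ha hb; rewrite !ler_norml => /andP[? ?] /andP[? ?] /andP[? ?].
    by apply/andP; split; lra.
  have -> : a - b = m%:R / 2 * (a * 2 / m%:R - b * 2 / m%:R) by field; rewrite gt_eqF.
  rewrite normrM ger0_norm ?divr_ge0 ?(ltW mR)//.
  rewrite (le_trans (ler_wpM2l _ hab)) ?divr_ge0 ?(ltW mR)//.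
  by rewrite /L le_eqVlt; apply/orP; left; apply/eqP; field; rewrite gt_eqF.
have gY x : x \in colcode f m u rho l -> g x \in Y.
  rewrite !inE => /andP[/forallP h _]; apply/forallP => i; apply/implyP.
  rewrite ffunE negb_and negbK; case: eqP => //= _; rewrite orbF => fi'.
  by have := h i; rewrite fi'.
have := card_le_fibers gY hB; rewrite card_zero_off => hcard.
rewrite (@le_trans _ _ ((m.+1 ^ #|P'|)%:R * (L + 1)))//.
  rewrite (@le_trans _ _ ((m.+1 ^ #|P'|)%:R * (Num.truncn (L + 1))%:R))//.
    by rewrite -natrM ler_nat.
  by rewrite ler_wpM2l// truncn_le.
rewrite -cP' expnS natrM.
set Q := (_ ^ _)%:R; have Q0 : 0 <= Q :> R by [].
have m1 : m%:R <= m.+1%:R :> R by rewrite ler_nat.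
have -> : (C * (2 + 4 * n%:R) + 6) * rho * (m.+1%:R * Q) = Q * ((C * (2 + 4 * n%:R) + 6) * (rho * m.+1%:R)) by ring.
rewrite ler_wpM2l//.
rewrite (@le_trans _ _ ((C * (2 + 4 * n%:R) + 6) * (rho * m%:R)))//; last first.
  rewrite ler_wpM2l//; last by rewrite ler_wpM2l// ltW.
  by rewrite addr_ge0// mulr_ge0// addr_ge0.
rewrite /L /X.
have : 0 <= C * (2 + 4 * n%:R) * (rho * m%:R).
  by rewrite !mulr_ge0 ?(ltW mR) ?(ltW r0)// addr_ge0.
nra.
Qed.

(* Otherwise [u] is concentrated on the identity rows, and the column whose unit
   entry meets a large coordinate of [u] is not almost orthogonal to [u]. *)
Lemma colcode_far f m u rho : injective f -> (0 < n)%N -> (0 < m)%N -> u != 0 ->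
  rho < (4 * n%:R)^-1 ->
  (forall i, i \notin codom f -> `|u i ord0| <= enorm u / (12 * n%:R ^+ 2)) ->
  exists l, colcode f m u rho l = finset.set0.
Proof.
move=> fi n0 m0 u0 hr hu.
have nR : 1 <= n%:R :> R by rewrite ler1n.
have mR : 1 <= m%:R :> R by rewrite ler1n.
have nu : 0 < enorm u.
  by rewrite lt_def enorm_ge0 andbT; apply: contra u0 => /eqP/enorm_eq0/eqP.
have [i hi] : exists i, enorm u / (2 * n%:R) <= `|u i ord0|.
  apply: contrapT => /forallNP h.
  have : enorm u <= n%:R * (enorm u / (2 * n%:R)).
    by apply: enorm_le_coord => i; rewrite leNgt; apply/negP => /ltW; exact: h.
  have -> : n%:R * (enorm u / (2 * n%:R)) = enorm u / 2 by field; rewrite gt_eqF//; lra.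
  lra.
have [fi'|fi'] := boolP (i \in codom f); last first.
  have := le_trans hi (hu i fi').
  rewrite ler_pM2l// lef_pV2 ?posrE; [|nra|nra].
  move=> h; exfalso; nra.
have /codomP[l il] := fi'.
exists l; apply/eqP; rewrite -finset.subset0; apply/fintype.subsetP => c.
rewrite !inE => /andP[_ /asboolP[v [v1 v2 v3]]]; exfalso.
have E : dotv u v = u i ord0 + \sum_(j | j \notin codom f) u j ord0 * v j ord0.
  rewrite /dotv (bigID (mem (codom f)))/=; congr (_ + _).
  rewrite (bigD1 i)//= v2// il eqxx mulr1 big1 ?addr0// => j /andP[jf ji].
  by rewrite v2// (negbTE ji) mulr0.
(* Column entries are at most 1 + 2/m <= 3 in absolute value. The constant 12 n^2 then makes the sum
   at most |u| / (4n), half the lower bound for the large coordinate; rho < 1/(4n) rules out the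
   other half. *)
have hs : `|\sum_(j | j \notin codom f) u j ord0 * v j ord0| <= n%:R * (enorm u / (12 * n%:R ^+ 2) * 3).
  rewrite (le_trans (ler_norm_sum _ _ _))//.
  rewrite (@le_trans _ _ (\sum_(j < n) (enorm u / (12 * n%:R ^+ 2) * 3)))//; last first.
    by rewrite sumr_const card_ord -[leLHS]mulr_natl.
  rewrite [leRHS](bigID (fun j => j \notin codom f))/= -[leLHS]addr0 lerD//; last first.
    by apply: sumr_ge0 => j _; rewrite mulr_ge0// divr_ge0 ?(ltW nu)// mulr_ge0// exprn_ge0.
  apply: ler_sum => j jf; rewrite normrM ler_pM ?hu//.
  have := v1 j jf.
  have c0 : 0 <= (c j : nat)%:R * 2 / m%:R :> R by rewrite divr_ge0.
  have c2 : (c j : nat)%:R * 2 / m%:R <= 2 :> R.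
    rewrite ler_pdivrMr ?(lt_le_trans _ mR)// mulrC ler_wpM2l// ler_nat -ltnS.
    exact: ltn_ord.
  have m2 : 2 / m%:R <= 2 :> R by rewrite ler_pdivrMr ?(lt_le_trans _ mR)//; lra.
  by rewrite !ler_norml => /andP[? ?]; apply/andP; split; lra.
have Es : n%:R * (enorm u / (12 * n%:R ^+ 2) * 3) = enorm u / (4 * n%:R) :> R.
  by field; rewrite ?gt_eqF//; lra.
have Ei : enorm u / (2 * n%:R) = 2 * (enorm u / (4 * n%:R)) :> R.
  by field; rewrite ?gt_eqF//; lra.
have : rho * enorm u < enorm u / (4 * n%:R) by rewrite mulrC ltr_pM2l.
rewrite Es in hs; rewrite Ei in hi.
have : `|u i ord0| <= `|dotv u v| + `|\sum_(j | j \notin codom f) u j ord0 * v j ord0|.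
  have -> : u i ord0 = dotv u v - \sum_(j | j \notin codom f) u j ord0 * v j ord0 by rewrite E addrK.
  exact: ler_normB.
lra.
Qed.

Lemma code_count : (0 < n)%N -> exists2 C : R, 0 < C &
  forall f m u rho, injective f -> (0 < m)%N -> u != 0 -> m%:R^-1 <= rho ->
  (\prod_l #|colcode f m u rho l|)%:R <= (C * rho) ^+ k * ((m.+1 ^ (n - k)) ^ k)%:R.
Proof.
move=> n0; pose c1 : R := 12 * n%:R ^+ 2 * (2 + 4 * n%:R) + 6.
have nR : 1 <= n%:R :> R by rewrite ler1n.
have c10 : 0 < c1 by rewrite /c1; nra.
exists (4 * n%:R + c1); first lra.
move=> f m u rho fi m0 u0 hr.
have r0 : 0 < rho by rewrite (lt_le_trans _ hr)// invr_gt0 ltr0n.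
have key : (forall l, #|colcode f m u rho l|%:R <= (4 * n%:R + c1) * rho * (m.+1 ^ (n - k))%:R) ->
   (\prod_l #|colcode f m u rho l|)%:R <= ((4 * n%:R + c1) * rho) ^+ k * ((m.+1 ^ (n - k)) ^ k)%:R.
  move=> h; rewrite natr_prod.
  apply: (@le_trans _ _ (\prod_(l < k) ((4 * n%:R + c1) * rho * (m.+1 ^ (n - k))%:R))).
    by apply: ler_prod => l _; rewrite h andbT.
  rewrite prodr_const card_ord exprMn.
  by rewrite [in leRHS]natrX.
have pos : 0 <= (m.+1 ^ (n - k))%:R :> R by [].
have [rb|rb] := leP (4 * n%:R)^-1 rho.
  apply: key => l; rewrite (@le_trans _ _ (m.+1 ^ (n - k))%:R)//.
    by rewrite ler_nat colcode_le.
  rewrite ler_peMl// (@le_trans _ _ ((4 * n%:R) * rho))//.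
    by rewrite -ler_pdivrMl ?mulr1//; lra.
  by rewrite ler_wpM2r ?(ltW r0)//; lra.
have [[i0 i0f hi0]|hno] := pselect (exists2 i, i \notin codom f & enorm u < `|u i ord0| * (12 * n%:R ^+ 2)).
  apply: key => l; rewrite (le_trans (colcode_near l (C := 12 * n%:R ^+ 2) fi m0 _ hr i0f u0 _))//.
  - by rewrite mulrC ltW.
  - by rewrite ler_wpM2r// ler_wpM2r ?(ltW r0)// /c1; lra.
have [|l hl] := colcode_far fi n0 m0 u0 rb.
  move=> i fi'; rewrite ler_pdivlMr ?mulr_gt0 ?exprn_gt0 ?ltr0n//.
  by rewrite leNgt; apply/negP => h; apply: hno; exists i.
rewrite (bigD1 l)//= hl cards0 mul0n mulr_ge0// exprn_ge0// mulr_ge0 ?(ltW r0)//; lra.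
Qed.

End CodeCount.

Section GrCount.
Context {R : realType} {n k : nat}.
Implicit Types (V W : grassmannian R n k).

Definition code (m : nat) (x : R) : 'I_m.+1 := inord (Num.truncn ((x + 1) * m%:R / 2)).

Lemma codeP m (x : R) : (0 < m)%N -> `|x| <= 1 ->
  `|x - ((code m x : nat)%:R * 2 / m%:R - 1)| <= 2 / m%:R.
Proof.
move=> m0; rewrite ler_norml => /andP[x1 x2].
have mR : 0 < m%:R :> R by rewrite ltr0n.
set y := (x + 1) * m%:R / 2.
have y0 : 0 <= y by rewrite divr_ge0// mulr_ge0//; lra.
have ym : y <= m%:R by rewrite /y; nra.
have -> : (code m x : nat) = Num.truncn y.
  by rewrite inordK// ltnS -(ler_nat R) (le_trans _ ym)// truncn_le.
have h1 : (Num.truncn y)%:R <= y by rewrite truncn_le.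
have h2 : y < (Num.truncn y).+1%:R by rewrite truncnS_gt.
move: h1 h2; rewrite -natr1; set t : R := (Num.truncn y)%:R => h1 h2.
have -> : x - (t * 2 / m%:R - 1) = (y - t) * (2 / m%:R) by rewrite /y; field; rewrite gt_eqF.
have t0 : 0 <= 2 / m%:R :> R by rewrite divr_ge0// ltW.
rewrite normrM (ger0_norm t0) ler_piMl ?divr_ge0 ?(ltW mR)//.
by rewrite ler_norml; apply/andP; split; lra.
Qed.

Definition separated (X : metricType R) (delta : R) (E : seq X) : Prop :=
  uniq E /\ forall x y, x \in E -> y \in E -> x != y -> delta < mdist x y.

(** There are k(n-k) free chart entries, each with about 1/delta values, and smallness of pi_V u
    removes a factor rho per column. With rho = 1 and any nonzero u this is also the box-counting
    bound for the whole Grassmannian. *)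
Lemma Gr_count : (0 < n)%N -> exists2 C : R, 0 < C &
  forall (delta rho : R) (u : euclid R n) (E : seq (grassmannian R n k)),
  0 < delta -> delta <= 1 -> delta <= rho -> u != 0 -> separated delta E ->
  (forall V, V \in E -> enorm (orthproj (val V) u) <= rho * enorm u) ->
  (size E)%:R <= C * rho ^+ k * delta^-1 ^+ (k * (n - k)).
Proof.
move=> n0; have [C0 C00 hC0] := @code_count R n k n0.
have nR : 1 <= n%:R :> R by rewrite ler1n.
pose K1 : R := 8 * n%:R * (k%:R + 1) + 2.
have K10 : 1 <= K1 by rewrite /K1; have : 0 <= n%:R * (k%:R + 1) :> R; [rewrite mulr_ge0// addr_ge0|lra].
exists ((n ^ k)%:R * (C0 * n%:R) ^+ k * K1 ^+ (k * (n - k))).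
  by rewrite !mulr_gt0 ?exprn_gt0 ?mulr_gt0 ?ltr0n ?expn_gt0 ?n0//; lra.
move=> delta rho u E d0 d1 dr u0 [uE sE] hE.
(* Subspaces with equal codes have chart entries within 4/m, hence by [chart_dist] distance at most
   8 n k / m <= delta: the code is injective on E. *)
pose m := (Num.truncn (8 * n%:R * (k%:R + 1) / delta)).+1.
have q0 : 0 <= 8 * n%:R * (k%:R + 1) :> R by rewrite !mulr_ge0// addr_ge0.
have m1 : 8 * n%:R * (k%:R + 1) / delta < m%:R by rewrite truncnS_gt.
have m2 : m.+1%:R <= K1 / delta.
  have : (Num.truncn (8 * n%:R * (k%:R + 1) / delta))%:R <= 8 * n%:R * (k%:R + 1) / delta.
    by rewrite truncn_le divr_ge0// ltW.
  rewrite /m; set t := Num.truncn _.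
  have -> : t.+2%:R = t%:R + 2 :> R by rewrite -addn2 natrD.
  rewrite /K1 mulrDl.
  have : 1 <= delta^-1 by rewrite invf_ge1.
  move=> h1 h2; rewrite mulrDl lerD// ler_peMr//.
have m0' : (0 < m)%N by [].
have mR : 0 < m%:R :> R by rewrite ltr0n.
have hm : 8 * n%:R * (k%:R + 1) < m%:R * delta by rewrite -ltr_pdivrMr.
have md : m%:R^-1 <= n%:R * rho.
  have r0 : 0 < rho := lt_le_trans d0 dr.
  rewrite -[m%:R^-1]mul1r ler_pdivrMr//.
  have h1 : 1 <= 8 * n%:R * (k%:R + 1) :> R.
    have : 0 <= n%:R * k%:R :> R by rewrite mulr_ge0.
    lra.
  rewrite (le_trans h1)// (le_trans (ltW hm))// mulrC ler_wpM2r ?(ltW mR)//.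
  by rewrite (le_trans dr)// ler_peMl// ltW.
have /choice [fM hfM] : forall V, exists fM : {ffun 'I_k -> 'I_n} * 'M[R]_(n, k), chart fM.1 fM.2 (val V).
  by move=> V; have [f [M h]] := exists_chart (eqP (valP V)); exists (f, M).
pose T1 : finType := {ffun 'I_k -> {ffun 'I_n -> 'I_m.+1}}.
(* The factor n in [n%:R * rho] bounds the norm of a column of a chart matrix. *)
pose S (f : {ffun 'I_k -> 'I_n}) : pred T1 :=
  family (fun l => mem (colcode f m u (n%:R * rho) l)).
pose A := [set p : {ffun 'I_k -> 'I_n} * T1 | `[< injective p.1 >] && S p.1 p.2]%SET.
pose g V : {ffun 'I_k -> 'I_n} * T1 :=
  ((fM V).1, [ffun l => [ffun i => if i \in codom (fM V).1 then ord0 else code m ((fM V).2 i l)]]).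
have gA V : V \in E -> g V \in A.
  move=> VE; have [fi Mf M1 MV _] := hfM V; rewrite inE /=; apply/andP; split; first exact/asboolP.
  apply/familyP => l; rewrite ffunE inE; apply/andP; split.
    by apply/forallP => i; apply/implyP => fi'; rewrite ffunE fi'.
  apply/asboolP; pose v : euclid R n := \col_i (fM V).2 i l.
  exists v; split.
  - by move=> i fi'; rewrite ffunE (negbTE fi') mxE codeP// M1.
  - by move=> i /codomP[j ->]; rewrite mxE Mf (inj_eq fi).
  - have vV : v \in val V.
      have <- : (fM V).2 *m delta_mx l ord0 = v by rewrite -colE; apply/colP => i; rewrite !mxE.
      exact: MV.
    rewrite -(dotv_orthproj u vV) (le_trans (dotv_norm _ _))//.
    have vn : enorm v <= n%:R.
      by rewrite -[leRHS]mulr1; apply: enorm_le_coord => i; rewrite mxE M1.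
    have -> : n%:R * rho * enorm u = rho * enorm u * n%:R by ring.
    by rewrite ler_pM ?enorm_ge0// hE.
have gI : {in E &, injective g}.
  move=> V W VE WE [fVW /ffunP cVW]; apply/eqP; apply/negPn/negP => VW.
  have := sE V W VE WE VW; apply/negP; rewrite -leNgt.
  have cW := hfM W; have cV := hfM V; rewrite -fVW in cW.
  have h0 : 0 <= 4 / m%:R :> R by rewrite divr_ge0// ltW.
  rewrite (le_trans (chart_dist h0 cV cW _))//.
    move=> i l; have [_ MV M1 _ _] := cV; have [_ NW N1 _ _] := cW.
    have [/codomP[j ->]|fi'] := boolP (i \in codom (fM V).1).
      by rewrite MV NW subrr normr0.
    have := cVW l; rewrite !ffunE => /ffunP/(_ i); rewrite !ffunE -fVW (negbTE fi') => E1.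
    have := codeP m0' (M1 i l); have := codeP m0' (N1 i l); rewrite E1.
    set z := (_ - 1) => hw hv.
    have -> : (fM V).2 i l - (fM W).2 i l = ((fM V).2 i l - z) - ((fM W).2 i l - z) by ring.
    rewrite (le_trans (ler_normB _ _))// (le_trans (lerD hv hw))//.
    by rewrite -mulrDl; have -> : 2 + 2 = 4 :> R by lra.
  have -> : 2 * (n%:R * (k%:R * (4 / m%:R))) = 8 * n%:R * k%:R / m%:R :> R by ring.
  rewrite ler_pdivrMr// [delta * _]mulrC (le_trans _ (ltW hm))//.
  by rewrite ler_wpM2l ?mulr_ge0// lerDl.
pose B : R := (C0 * (n%:R * rho)) ^+ k * ((m.+1 ^ (n - k)) ^ k)%:R.
have B0 : 0 <= B.
  by rewrite mulr_ge0// exprn_ge0// !mulr_ge0 ?(ltW C00)// ltW// (lt_le_trans d0).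
have hA : (#|A| <= #|[set: {ffun 'I_k -> 'I_n}]%SET| * Num.truncn B)%N.
  apply: (card_le_fibers (g := fst)) => [p _|f _]; first by rewrite inE.
  have [fi|fni] := pselect (injective f); last first.
    rewrite (_ : [set x in A | x.1 == f]%SET = finset.set0) ?cards0//.
    apply/setP => p; rewrite !inE; apply/negP => /andP[/andP[/asboolP h _] /eqP E1].
    by apply: fni; rewrite -E1.
  rewrite truncn_ge_nat// -(card_in_imset (f := snd)); last first.
    by move=> [p1 p2] [q1 q2]; rewrite !inE /= => /andP[_ /eqP ->] /andP[_ /eqP ->] ->.
  rewrite (le_trans _ (hC0 _ _ _ _ fi m0' u0 md))// ler_nat.
  rewrite -(card_family_prod (fun l => mem (colcode f m u (n%:R * rho) l))).
  apply: subset_leq_card; apply/fintype.subsetP => _ /imsetP[[p1 p2] + ->].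
  by rewrite !inE /= => /andP[/andP[_ h] /eqP <-].
have sA : (size E <= #|A|)%N.
  rewrite -(size_map g) -(card_uniqP _) ?map_inj_in_uniq//.
  by apply: subset_leq_card; apply/fintype.subsetP => _ /mapP[V VE ->]; exact: gA.
rewrite (@le_trans _ _ ((n ^ k)%:R * B))//.
  rewrite (@le_trans _ _ ((n ^ k)%:R * (Num.truncn B)%:R))//; last first.
    by rewrite ler_wpM2l// truncn_le.
  rewrite -natrM ler_nat (leq_trans sA)// (leq_trans hA)//.
  by rewrite cardsT card_ffun !card_ord.
rewrite /B (mulrA C0) exprMn !mulrA.
have -> : (n ^ k)%:R * (C0 * n%:R) ^+ k * K1 ^+ (k * (n - k)) * rho ^+ k * delta^-1 ^+ (k * (n - k))
   = (n ^ k)%:R * (C0 * n%:R) ^+ k * rho ^+ k * (K1 / delta) ^+ (k * (n - k)) :> R.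
  by rewrite [(K1 / delta) ^+ _]exprMn; ring.
apply: ler_wpM2l.
  by rewrite !mulr_ge0 ?exprn_ge0 ?mulr_ge0 ?(ltW C00)// ltW// (lt_le_trans d0).
rewrite -expnM mulnC natrX.
by apply: lerXn2r => //; rewrite nnegrE// divr_ge0 ?(ltW d0)// (le_trans ler01).
Qed.

End GrCount.

(** * Packing dimension *)

Section Packing.
Context {R : realType}.

Lemma exists_maximal_seq (T : Type) (P : seq T -> Prop) (N : R) :
  P [::] -> (forall E, P E -> (size E)%:R <= N) ->
  exists2 E, P E & forall E', P E' -> (size E' <= size E)%N.
Proof.
move=> P0 PN.
pose Q (m : nat) := `[< exists2 E, P E & size E = m >].
have Q0 : exists m, Q m by exists 0%N; apply/asboolP; exists [::].
have QN m : Q m -> (m <= Num.truncn N)%N.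
  move=> /asboolP[E PE <-]; rewrite truncn_ge_nat ?PN//.
  by rewrite (le_trans _ (PN _ P0)).
case: (ex_maxnP Q0 QN) => m /asboolP[E PE <-] h; exists E => // E' PE'.
by apply: h; apply/asboolP; exists E'.
Qed.

Lemma maximal_separated (X : metricType R) (B : set X) (delta N : R) : 0 <= delta ->
  (forall E, separated delta E -> (forall x, x \in E -> B x) -> (size E)%:R <= N) ->
  exists E, [/\ separated delta E, forall x, x \in E -> B x &
    forall x, B x -> exists2 y, y \in E & mdist y x <= delta].
Proof.
move=> d0 h.
have [||E [sE EB] mE] := @exists_maximal_seq X
   (fun E => separated delta E /\ forall x, x \in E -> B x) N.
- by split; [split|].
- by move=> E [? ?]; exact: h.
exists E; split=> // x Bx; apply: contrapT => hx.
have xE y : y \in E -> delta < mdist x y.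
  by move=> yE; rewrite ltNge metric_sym; apply/negP => hxy; apply: hx; exists y.
suff /mE : separated delta (x :: E) /\ forall y, y \in x :: E -> B y by rewrite /= ltnn.
have [uE sE'] := sE; split; last by move=> y; rewrite inE => /predU1P[->//|/EB].
split=> [/=|y z].
  rewrite uE andbT; apply/negP => xE'; have := xE _ xE'.
  by rewrite mdistxx ltNge d0.
rewrite !inE => /predU1P[->|yE] /predU1P[->|zE] yz; rewrite ?eqxx// in yz *.
- exact: xE.
- by rewrite metric_sym; exact: xE.
- exact: sE'.
Qed.

Lemma covering_number_ge0 (X : metricType R) (B : set X) (delta : R) :
  (0 <= covering_number B delta)%E.
Proof. by apply: le_ereal_inf_tmp => _ [cs _ <-]; rewrite lee_fin. Qed.

(** A maximal separated set is the set of centres of a cover, so counting separated sets at dyadic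
    scales controls covering numbers at all radii. An arbitrarily small extra exponent sends the
    limit to 0. *)
Lemma upper_box_dim_le (X : metricType R) (B : set X) (r C : R) (q0 : nat) :
  0 <= r -> 0 <= C ->
  (forall q E, (q0 <= q)%N -> separated (exp2 (- q%:R)) E ->
     (forall x, x \in E -> B x) -> (size E)%:R <= C * exp2 (r * q%:R)) ->
  (upper_box_dim B <= r%:E)%E.
Proof.
move=> r0 C0 h; apply/lee_addgt0Pr => e e0; rewrite -EFinD.
apply: ereal_inf_lbound; exists (r + e) => //; split; first by rewrite addr_ge0// ltW.
set f := fun delta : R => _.
apply/eqP; rewrite eq_le; apply/andP; split; last first.
  apply: limf_esup_ge0 => [|x]; first exact: filter_not_empty.
  by rewrite /f mule_ge0 ?covering_number_ge0// lee_fin powR_ge0.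
apply/lee_addgt0Pr => eta eta0; rewrite add0e limf_esupE.
pose D : R := C * 2 `^ r + 1.
have D0 : 0 < D by rewrite ltr_wpDl// mulr_ge0// powR_ge0.
pose d0 := Num.min (exp2 (- q0%:R)) ((eta / D) `^ e^-1).
have d00 : 0 < d0 by rewrite lt_min exp2_gt0 powR_gt0// divr_gt0.
have d01 : d0 <= 1 by rewrite ge_min exp2_le1// oppr_le0.
apply: (@le_trans _ _ (ereal_sup [set f x | x in [set x | 0 < x < d0]])).
  apply: ereal_inf_lbound; exists [set x : R | 0 < x < d0] => //.
  near=> x; apply/andP; split; first by near: x; exact: nbhs_right_gt.
  by near: x; apply: nbhs_right_lt.
apply: ge_ereal_sup => _ [x /andP[x0 xd] <-].
have [q1 [h1 h2]] := dyadic_scale x0 (le_trans (ltW xd) d01).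
have qx : exp2 (- q1.+1%:R) <= x by rewrite exp2NS; lra.
have q01 : (q0 <= q1.+1)%N.
  have : exp2 (- q1.+1%:R) < exp2 (- q0%:R) :> R.
    by rewrite (le_lt_trans qx)// (lt_le_trans xd)// ge_min lexx.
  by move=> /exp2_inj_lt; rewrite ltrN2 ltr_nat => /ltnW.
have [E [sE EB cE]] := maximal_separated (exp2_ge0 _) (fun E => h _ E q01).
have cn : (covering_number B x <= (size E)%:R%:E)%E.
  apply: ereal_inf_lbound; exists E => // y /cE[z zE zy].
  by exists z => //; rewrite (le_trans zy).
rewrite /f (le_trans (lee_wpmul2r _ cn)) ?lee_fin ?powR_ge0//.
have hs := h _ _ q01 sE EB.
rewrite (le_trans (ler_wpM2r (powR_ge0 _ _) hs))//.
have hx : exp2 (r * q1.+1%:R) <= 2 `^ r * (x `^ r)^-1.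
  rewrite mulrC exp2M.
  have xr0 : 0 < x `^ r by rewrite powR_gt0.
  have -> : (x `^ r)^-1 = x^-1 `^ r.
    apply: (mulfI (lt0r_neq0 xr0)); rewrite mulfV ?gt_eqF// -powRM ?invr_ge0 ?(ltW x0)//.
    by rewrite mulfV ?gt_eqF// powR1.
  rewrite -powRM ?invr_ge0 ?(ltW x0)//; apply: ge0_ler_powR => //.
  - by rewrite nnegrE exp2_ge0.
  - by rewrite nnegrE mulr_ge0// invr_ge0 ltW.
  - rewrite -[leLHS]invrK -exp2N exp2NS invfM invrK mulrC ler_pM2l//.
    by rewrite lef_pV2 ?posrE ?exp2_gt0.
rewrite (le_trans (ler_wpM2r (powR_ge0 _ _) (ler_wpM2l C0 hx)))//.
rewrite powRD; last by rewrite (gt_eqF x0) implybT.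
have xr0 : 0 < x `^ r by rewrite powR_gt0.
have -> : C * (2 `^ r * (x `^ r)^-1) * (x `^ r * x `^ e) = C * 2 `^ r * x `^ e.
  by field; rewrite gt_eqF.
have xe : x `^ e <= eta / D.
  rewrite (@le_trans _ _ (((eta / D) `^ e^-1) `^ e))//.
    apply: ge0_ler_powR; rewrite ?nnegrE; [exact: ltW|exact: ltW|exact: powR_ge0|].
    by rewrite (le_trans (ltW xd))// ge_min lexx orbT.
  by rewrite -powRrM mulVf ?gt_eqF// powRr1// ltW// divr_gt0.
rewrite (@le_trans _ _ (D * (eta / D)))//; last by rewrite mulrC divfK// gt_eqF.
apply: ler_pM => //; first by rewrite mulr_ge0// powR_ge0.
  exact: powR_ge0.
by rewrite /D lerDl.
Unshelve. all: by end_near.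
Qed.

(** Each piece has its own constant and starting scale, so estimates that are not uniform over F can
    be used. *)
Lemma packing_dim_le (X : metricType R) (F : set X) (Fs : nat -> set X) (r : R) :
  mbounded [set: X] -> 0 <= r -> F `<=` \bigcup_j Fs j ->
  (forall j, exists C : R, 0 <= C /\ exists q0 : nat,
     forall q E, (q0 <= q)%N -> separated (exp2 (- q%:R)) E ->
     (forall x, x \in E -> Fs j x) -> (size E)%:R <= C * exp2 (r * q%:R)) ->
  (packing_dim F <= r%:E)%E.
Proof.
move=> [M hM] r0 FF h.
apply: (@le_trans _ _ (ereal_sup [set upper_box_dim (F `&` Fs i) | i in [set: nat]])).
  apply: ereal_inf_lbound; exists (fun i => F `&` Fs i) => //; split.
    apply/seteqP; split=> [x Fx|x [i _ []//]].
    by have [i _ Fi] := FF _ Fx; exists i.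
  by move=> i; exists M => x y _ _; exact: hM.
apply: ge_ereal_sup => _ [i _ <-].
have [C [C0 [q0 hC]]] := h i.
apply: (@upper_box_dim_le _ _ r C q0) => // q E qq sE EF.
by apply: hC => // x /EF[].
Qed.

End Packing.

(** * Zoomed configurations and their collisions *)

Section PairCount.

Lemma sum_eq_seq (T : eqType) (S : seq T) (x : T) (h : T -> nat) :
  uniq S -> x \in S -> (\sum_(t <- S) (x == t) * h t = h x)%N.
Proof.
move=> uS xS; rewrite (bigD1_seq x)//= eqxx mul1n big1 ?addn0// => t tx.
by rewrite eq_sym (negbTE tx).
Qed.

(** Grouped by the common value t, the claim is the sum over t of 2 a_t b_t <= a_t^2 + b_t^2. *)
Lemma pair_eq_le (T : eqType) (I I' : Type) (Y : seq I) (Y' : seq I') (f : I -> T) (g : I' -> T) :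
  (2 * (\sum_(z <- Y) \sum_(z' <- Y') (f z == g z')) <=
   \sum_(z <- Y) \sum_(z' <- Y) (f z == f z') + \sum_(z <- Y') \sum_(z' <- Y') (g z == g z'))%N.
Proof.
pose S := undup (map f Y ++ map g Y').
have uS : uniq S := undup_uniq _.
pose a t := (\sum_(z <- Y) (f z == t))%N.
pose b t := (\sum_(z <- Y') (g z == t))%N.
have key (A B : Type) (P : seq A) (Q : seq B) (u : A -> T) (v : B -> T) :
    (forall i, i \in map u P -> i \in S) ->
    (\sum_(z <- P) \sum_(z' <- Q) (u z == v z') =
     \sum_(t <- S) (\sum_(z <- P) (u z == t)) * (\sum_(z' <- Q) (v z' == t)))%N.
  move=> uP; under [RHS]eq_bigr do rewrite big_distrl/=.
  rewrite [RHS]exchange_big/=.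
  elim: P uP => [|z P ih] uP; first by rewrite !big_nil.
  rewrite !big_cons ih; last by move=> i iP; apply: uP; rewrite inE iP orbT.
  congr (_ + _)%N; rewrite sum_eq_seq//; last by apply: uP; rewrite inE eqxx.
  by apply: eq_bigr => z' _; rewrite eq_sym.
rewrite !key => [|i|i|i]; rewrite ?mem_undup ?mem_cat; try by move=> ->; rewrite ?orbT.
rewrite big_distrr -big_split /=; apply: leq_sum => t _.
by have := (nat_Cauchy (a t) (b t)).1; rewrite -!mulnn.
Qed.

End PairCount.

Section Cells.
Context {R : realType} {n : nat}.
Local Notation Z := 'cV[int]_n.
Implicit Types (x y : euclid R n) (z w : Z) (q p : nat).

Definition zvec z : euclid R n := \col_i (z i ord0)%:~R.
Definition cell q x : Z := \col_i Num.floor (2 ^+ q * x i ord0).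
(** The dyadic cell p generations above the cell [z]. *)
Definition anc p z : Z := \col_i (z i ord0 %/ (2 ^+ p : int))%Z.

Lemma zvecB z w : zvec (z - w) = zvec z - zvec w.
Proof. by apply/colP => i; rewrite !mxE intrD mulrNz. Qed.

Lemma cell_approx q x : enorm (2 ^+ q *: x - zvec (cell q x)) <= n%:R.
Proof.
rewrite -[leRHS]mulr1; apply: enorm_le_coord => i; rewrite !mxE.
set y := _ * _; have := floor_le y; have := floorD1_gt y.
by rewrite intrD ler_norml => h1 h2; apply/andP; split; lra.
Qed.

Lemma pow2z_gt0 p : 0 < (2 ^+ p : int). Proof. by rewrite exprn_gt0. Qed.

Lemma floor_unique (y : R) (m : int) : m%:~R <= y -> y < (m + 1)%:~R -> Num.floor y = m.
Proof. by move=> h1 h2; apply/eqP; rewrite floor_eq h1 h2. Qed.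

Lemma floor_divz p (y : R) :
  Num.floor y = (Num.floor (2 ^+ p * y) %/ (2 ^+ p : int))%Z.
Proof.
set z := Num.floor (2 ^+ p * y); set d := (z %/ _)%Z.
have P0 : 0 < (2 ^+ p : R) by rewrite exprn_gt0.
have e : z = d * 2 ^+ p + (z %% (2 ^+ p : int))%Z := divz_eq _ _.
have m0 : 0 <= (z %% (2 ^+ p : int))%Z by rewrite modz_ge0// gt_eqF// pow2z_gt0.
have m1 : (z %% (2 ^+ p : int))%Z + 1 <= (2 ^+ p : int).
  by have := ltz_mod z (lt0r_neq0 (pow2z_gt0 p)); rewrite gtr0_norm ?pow2z_gt0// -lezD1.
have E2 : ((2 ^+ p : int)%:~R : R) = 2 ^+ p by rewrite rmorphXn.
apply: floor_unique.
  rewrite -(ler_pM2l P0) (le_trans _ (floor_le _))// -/z e -E2 -intrM ler_int mulrC lerDl//.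
rewrite -(ltr_pM2l P0) (lt_le_trans (floorD1_gt _))// -/z -E2 -intrM ler_int.
rewrite e; nia.
Qed.

Lemma anc_cell q p x : anc p (cell (q + p) x) = cell q x.
Proof.
apply/colP => i; rewrite !mxE [RHS](floor_divz p); congr (Num.floor _ %/ _)%Z.
by rewrite mulrA -exprD addnC.
Qed.

Lemma anc_approx p z : enorm (zvec z - 2 ^+ p *: zvec (anc p z)) <= n%:R * 2 ^+ p.
Proof.
apply: enorm_le_coord => i; rewrite !mxE.
have e := divz_eq (z i ord0) (2 ^+ p).
rewrite {1}e intrD intrM rmorphXn/= mulrC [X in X - _]addrC addrK.
have m0 : 0 <= (z i ord0 %% (2 ^+ p : int))%Z by rewrite modz_ge0// gt_eqF// pow2z_gt0.
have := ltz_mod (z i ord0) (lt0r_neq0 (pow2z_gt0 p)); rewrite gtr0_norm ?pow2z_gt0// => m1.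
have -> : 2 ^+ p = (2 ^+ p : int)%:~R :> R by rewrite rmorphXn.
by rewrite ger0_norm ?ler0z// ler_int ltW.
Qed.

(* Cells met by an expanding homothetic copy of [K] within the unit cube. The
   descendants of a cell are again such a configuration after a translation,
   which makes extremal counts submultiplicative in [q]. *)
Definition conf (K : set (euclid R n)) q (Zs : {fset Z}) : Prop :=
  exists (r : R) (b : euclid R n), 1 <= `|r| /\
    forall z, z \in Zs -> exists x, [/\ K x, unit_cube (r *: x + b) & cell q (r *: x + b) = z].

Variable K : set (euclid R n).

Lemma conf_anc q p (A : {fset Z}) : conf K (q + p) A -> conf K q [fset anc p z | z in A]%fset.
Proof.
move=> [r [b [r1 h]]]; exists r, b; split=> // _ /imfsetP[z /= zA ->].
have [x [Kx cx <-]] := h z zA; exists x; split=> //.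
by rewrite anc_cell.
Qed.

Definition desc p (A : {fset Z}) (w : Z) : {fset Z} := [fset z in A | anc p z == w]%fset.

Lemma conf_desc q p (A : {fset Z}) w : conf K (q + p) A ->
  conf K p [fset z - 2 ^+ p *: w | z in desc p A w]%fset.
Proof.
move=> [r [b [r1 h]]].
exists (2 ^+ q * r), (2 ^+ q *: b - zvec w); split.
  by rewrite normrM ger0_norm ?exprn_ge0// -[leLHS]mulr1 ler_pM// exprn_ege1// ler1n.
move=> _ /imfsetP[z /= + ->]; rewrite !inE => /andP[zA /eqP zw].
have [x [Kx cx cz]] := h z zA; exists x.
have E : (2 ^+ q * r) *: x + (2 ^+ q *: b - zvec w) = 2 ^+ q *: (r *: x + b) - zvec w.
  by rewrite scalerDr scalerA addrA.
rewrite E; split=> //.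
  move=> i; rewrite -zw -cz anc_cell !mxE.
  set y := _ * _; have := floor_le y; have := floorD1_gt y.
  by rewrite intrD => h1 h2; apply/andP; split; lra.
apply/colP => i; rewrite -cz !mxE.
have -> : 2 ^+ p * (2 ^+ q * (r * x i ord0 + b i ord0) - (w i ord0)%:~R) =
    2 ^+ (q + p) * (r * x i ord0 + b i ord0) + (- (2 ^+ p * w i ord0))%:~R :> R.
  by rewrite mulrBr mulrA -exprD addnC mulrNz intrM rmorphXn.
by rewrite floorDrz ?intr_int// intrKfloor.
Qed.

Lemma conf_card q (A : {fset Z}) : conf K q A -> (#|` A| <= (2 ^ q).+1 ^ n)%N.
Proof.
move=> [r [b [r1 h]]].
have zb z : z \in A -> forall i, (0 <= z i ord0)%R /\ (`|z i ord0|%N <= 2 ^ q)%N.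
  move=> /h[x [_ cx <-]] i; rewrite mxE; have /andP[c0 c1] := cx i.
  set y := _ * _.
  have y0 : 0 <= y by rewrite mulr_ge0// exprn_ge0.
  have y1 : y <= 2 ^+ q by rewrite ler_piMr// exprn_ge0.
  rewrite floor_ge0 y0; split=> //.
  rewrite -lez_nat gez0_abs ?floor_ge0// -(ler_int R) (le_trans (floor_le _))//.
  by rewrite -pmulrn natrX.
pose g z : {ffun 'I_n -> 'I_(2 ^ q).+1} := [ffun i => inord `|z i ord0|%N].
have gI : {in A &, injective g}.
  move=> z w /zb hz /zb hw /ffunP E; apply/colP => i.
  have := E i; rewrite !ffunE => /(congr1 val) /=.
  have [z0 z1] := hz i; have [w0 w1] := hw i.
  by rewrite !inordK// => E'; rewrite -(gez0_abs z0) -(gez0_abs w0) E'.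
have -> : #|` A| = #|` [fset g z | z in A]%fset| by rewrite card_in_imfset.
rewrite -[leqRHS](_ : #|{ffun 'I_n -> 'I_(2 ^ q).+1}| = _); last first.
  by rewrite card_ffun !card_ord.
rewrite -(card_uniqP (fset_uniq _)); exact: max_card.
Qed.

Lemma conf0 q : conf K q fset0.
Proof. by exists 1, 0; split=> [|z]; rewrite ?normr1// inE. Qed.

Lemma exists_conf_max (G : {fset Z} -> nat) (B : nat -> nat) :
  (forall q A, conf K q A -> (G A <= B q)%N) ->
  exists g : nat -> nat, forall q,
    (exists2 A, conf K q A & G A = g q) /\ forall A, conf K q A -> (G A <= g q)%N.
Proof.
move=> hB.
suff /choice[g hg] : forall q, exists m, (exists2 A, conf K q A & G A = m) /\
   forall A, conf K q A -> (G A <= m)%N by exists g.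
move=> q.
pose P m := `[< exists2 A, conf K q A & G A = m >].
have P0 : exists m, P m by exists (G fset0); apply/asboolP; exists fset0 => //; exact: conf0.
have PB m : P m -> (m <= B q)%N by move=> /asboolP[A cA <-]; exact: hB.
case: (ex_maxnP P0 PB) => m /asboolP[A cA Am] h; exists m; split; first by exists A.
by move=> A' cA'; apply: h; apply/asboolP; exists A'.
Qed.

End Cells.

Section Collisions.
Context {R : realType} {n : nat}.
Local Notation Z := 'cV[int]_n.
Implicit Types (V : {vspace euclid R n}) (A B : {fset Z}).
Variable V : {vspace euclid R n}.

(** The threshold 4n makes collisions pass to ancestors ([coll_anc]): rounding costs 2n 2^p, and 4n
    + 2n 2^p <= 4n 2^p for p >= 1. *)
Definition coll (z w : Z) : bool :=
  (enorm (orthproj V (zvec z - zvec w)) <= (4 * n)%:R :> R).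

Definition cross A B := (\sum_(z <- A) \sum_(w <- B) coll z w)%N.
Definition J A := cross A A.

Lemma coll_refl z : coll z z.
Proof. by rewrite /coll subrr -(scale0r 0) orthprojZ scale0r enorm0. Qed.

Lemma collD z w c : coll (z + c) (w + c) = coll z w.
Proof. by rewrite /coll -!zvecB opprD addrACA subrr addr0. Qed.

Definition tube (z : Z) : Z := \col_i Num.floor ((orthproj V (zvec z) : euclid R n) i ord0).

Lemma tube_coll z w : tube z = tube w -> coll z w.
Proof.
move=> /colP E; rewrite /coll (@le_trans _ _ n%:R)//; last by rewrite ler_nat leq_pmull.
rewrite -[leRHS]mulr1; apply: enorm_le_coord => i.
have := E i; rewrite orthprojB !mxE.
set a := (orthproj V _ : euclid R n) i ord0; set b := (orthproj V _ : euclid R n) i ord0 => Ei.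
have := floor_le a; have := floorD1_gt a; have := floor_le b; have := floorD1_gt b.
rewrite Ei intrD ler_norml => *; apply/andP; split; lra.
Qed.

(** Projections of colliding cells differ by at most 4n in each coordinate and their integer parts
    by at most 4n + 1, which leaves 8n + 3 values. *)
Definition shift (e : {ffun 'I_n -> 'I_(8 * n + 3)}) : Z :=
  \col_i ((e i : nat)%:Z - (4 * n + 1)%:Z).

Lemma coll_tube z w : coll z w -> exists e, tube w = tube z + shift e.
Proof.
move=> zw.
have h i : exists e : 'I_(8 * n + 3), tube w i ord0 = tube z i ord0 + ((e : nat)%:Z - (4 * n + 1)%:Z).
  have := le_trans (enorm_coord _ i) zw; rewrite orthprojB !mxE.
  set a := (orthproj V _ : euclid R n) i ord0; set b := (orthproj V _ : euclid R n) i ord0.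
  rewrite ler_norml => /andP[h1 h2].
  have := floor_le a; have := floorD1_gt a; have := floor_le b; have := floorD1_gt b.
  set fa := Num.floor a; set fb := Num.floor b; rewrite !intrD => h3 h4 h5 h6.
  have h7 : (fb - fa <= (4 * n + 1)%:Z)%R.
    rewrite -(ler_int R) rmorphB /= -[(_%:Z)%:~R]/((4 * n + 1)%:R) natrD; lra.
  have h8 : (- (4 * n + 1)%:Z <= fb - fa)%R.
    rewrite -(ler_int R) rmorphB rmorphN /= -[(_%:Z)%:~R]/((4 * n + 1)%:R) natrD; lra.
  have h9 : (`|(fa - fb + (4 * n + 1)%:Z)%R|%N < 8 * n + 3)%N by lia.
  by exists (Ordinal h9) => /=; lia.
have /choice[e he] := h.
by exists (finfun e); apply/colP => i; rewrite [LHS]he !mxE ffunE.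
Qed.

(* Cauchy-Schwarz over the tubes, i.e. the cells of the projection. *)
Lemma cross_le A B : (2 * cross A B <= (8 * n + 3) ^ n * (J A + J B))%N.
Proof.
have h : (cross A B <= \sum_e \sum_(z <- A) \sum_(w <- B) ((tube z + shift e)%R == tube w))%N.
  rewrite exchange_big; apply: leq_sum => z _; rewrite exchange_big; apply: leq_sum => w _.
  case: (boolP (coll z w)) => // /coll_tube[e he].
  by rewrite (bigD1 e)//= -he eqxx.
rewrite (leq_trans (leq_mul (leqnn 2) h))// big_distrr/=.
have -> : ((8 * n + 3) ^ n = #|{ffun 'I_n -> 'I_(8 * n + 3)}|)%N by rewrite card_ffun !card_ord.
rewrite -sum_nat_const; apply: leq_sum => e _.
rewrite (leq_trans (pair_eq_le _ _ _ _))// leq_add//.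
  apply: leq_sum => z _; apply: leq_sum => w _.
  case: eqP => // /addIr/tube_coll ->//.
apply: leq_sum => z _; apply: leq_sum => w _.
by case: eqP => // /tube_coll ->.
Qed.

Lemma J_translate A (c : Z) : J [fset z - c | z in A]%fset = J A.
Proof.
have inj : injective (fun z : Z => z - c) by move=> x y /addIr.
rewrite /J /cross big_imfset/=; last by move=> ? ? _ _ /inj.
apply: eq_bigr => z _; rewrite big_imfset/=; last by move=> ? ? _ _ /inj.
by apply: eq_bigr => w _; rewrite collD.
Qed.

Lemma J_le A : (J A <= #|` A| ^ 2)%N.
Proof.
rewrite /J /cross (@leq_trans (\sum_(z <- A) \sum_(w <- A) 1))//.
  by apply: leq_sum => z _; apply: leq_sum => w _; case: coll.
by under eq_bigr do rewrite sum1_size; rewrite big_const_seq count_predT iter_addn addn0 mulnn.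
Qed.

Lemma J_ge A : (#|` A| <= J A)%N.
Proof.
rewrite /J /cross -sum1_size big_seq [leqRHS]big_seq; apply: leq_sum => z zA.
by rewrite (bigD1_seq z)//= coll_refl.
Qed.

Lemma cross_max A B (m : nat) : (J A <= m)%N -> (J B <= m)%N -> (cross A B <= (8 * n + 3) ^ n * m)%N.
Proof.
move=> hA hB; rewrite -(leq_pmul2l (ltn0Sn 1)) (leq_trans (cross_le _ _))//.
by rewrite mulnCA leq_mul2l; apply/orP; right; lia.
Qed.

End Collisions.

Section Growth.
Context {R : realType}.

(* In the last clause, [m] is a record scale of g(q) / 2^((alpha - e) q); there the
   extremal configurations satisfy a Frostman condition. *)
Lemma growth_exponent (g : nat -> R) (c A : R) : (forall q, 1 <= g q) ->
  (forall q, g q <= c * exp2 (A * q%:R)) ->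
  exists alpha : R, [/\ 0 <= alpha,
    forall e, 0 < e -> exists2 C, 0 < C & forall q, g q <= C * exp2 ((alpha + e) * q%:R) &
    (forall e M, 0 < e -> exists m, (M <= m)%N /\
       forall q, (q <= m)%N -> exp2 ((alpha - e) * q%:R) * g (m - q)%N <= g m)].
Proof.
move=> g1 gA.
pose S := [set a : R | exists2 C, 0 < C & forall q, g q <= C * exp2 (a * q%:R)].
have SA : S A.
  exists (`|c| + 1); first by rewrite ltr_wpDl.
  move=> q; rewrite (le_trans (gA q))// ler_wpM2r ?exp2_ge0//.
  by rewrite (le_trans (ler_norm _))// lerDl.
have S0 : lbound S 0.
  move=> a [C C0 h]; rewrite leNgt; apply/negP => a0.
  have C'0 : 0 < (2 * C)^-1 by rewrite invr_gt0 mulr_gt0.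
  have a0' : 0 < - a by rewrite oppr_gt0.
  have [q hq] := exp2_small a0' C'0.
  have := h q; have := hq q (leqnn q); rewrite mulNr opprK => h1 h2.
  have := le_trans (g1 q) (le_trans h2 (ler_wpM2l (ltW C0) h1)).
  have -> : C / (2 * C) = 2^-1 by field; rewrite gt_eqF.
  by lra.
have hS : has_inf S by split; [exists A|exists 0].
exists (inf S); split.
  exact: lb_le_inf hS.1 S0.
  move=> e e0; have [a [C C0 ha] ae] := inf_adherent e0 hS.
  exists C => // q; rewrite (le_trans (ha q))// ler_wpM2l ?(ltW C0)// exp2_le//.
  by rewrite ler_wpM2r// ltW.
move=> e M e0.
set a := inf S - e.
have aS : ~ S a.
  by move=> /(ge_inf hS.2); apply/negP; rewrite -ltNge /a gtrBl.
pose y q := g q * exp2 (- (a * q%:R)).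
have y0 q : 0 < y q by rewrite mulr_gt0 ?exp2_gt0// (lt_le_trans ltr01).
(* [B] bounds [y] before M, so the first index at which [y] exceeds [B] is at least M and is a
   record. It exists, since a bounded [y] would put [inf S - e] into [S]. *)
pose B := \sum_(0 <= j < M) y j + 1.
have Bp : 0 < B by rewrite ltr_wpDl// sumr_ge0// => j _; exact: ltW.
have yB j : (j < M)%N -> y j <= B.
  move=> jM; rewrite /B big_mkord (bigD1 (Ordinal jM))//= -addrA lerDl addr_ge0//.
  by rewrite sumr_ge0// => i _; exact: ltW.
have ex : exists m, B < y m.
  apply: contrapT => /forallNP h; apply: aS; exists B => // q.
  have /negP := h q; rewrite -leNgt /y exp2N ler_pdivrMr ?exp2_gt0//.
case: (ex_minnP ex) => m hm hmin; exists m; split.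
  by rewrite leqNgt; apply/negP => /yB; rewrite leNgt hm.
move=> q qm.
have : y (m - q)%N <= y m.
  have [->|q0] := posnP q; first by rewrite subn0.
  rewrite (le_trans _ (ltW hm))// leNgt; apply/negP => /hmin.
  by rewrite leqNgt; rewrite ltn_subrL q0 (leq_trans q0 qm).
rewrite /y natrB// mulrBr opprB exp2D mulrA ler_pM2r ?exp2_gt0//.
by rewrite mulrC.
Qed.

End Growth.

Section Submult.
Context {R : realType} {n : nat}.
Local Notation Z := 'cV[int]_n.
Variable V : {vspace euclid R n}.
Implicit Types (A B : {fset Z}).

Lemma anc0 (z : Z) : anc 0 z = z.
Proof. by apply/colP => i; rewrite mxE expr0 divz1. Qed.

Lemma coll_anc p (z w : Z) : coll V z w -> coll V (anc p z) (anc p w).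
Proof.
case: p => [|p]; first by rewrite !anc0.
rewrite /coll => h; set P : R := 2 ^+ p.+1.
have P2 : 2 <= P by rewrite /P exprS ler_pMr// exprn_ege1// ler1n.
have P0 : 0 < P by lra.
rewrite -(ler_pM2l P0).
rewrite -[P * enorm _](_ : enorm (orthproj V (P *: (zvec (anc p.+1 z) - zvec (anc p.+1 w)))) = _); last first.
  by rewrite orthprojZ enormZ gtr0_norm.
have -> : P *: (zvec (anc p.+1 z) - zvec (anc p.+1 w)) =
   (zvec z - zvec w) - (zvec z - P *: zvec (anc p.+1 z)) + (zvec w - P *: zvec (anc p.+1 w)) :> euclid R n.
  rewrite scalerBr; set a := zvec z; set b := zvec w; set c := P *: _; set d := P *: _.
  by apply/matrixP => i j; rewrite !mxE; ring.
rewrite orthprojD orthprojB (le_trans (enormD _ _))// (le_trans (lerD (enormD _ _) (lexx _)))//.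
rewrite enormN.
have hz := le_trans (enorm_orthproj V _) (anc_approx p.+1 z).
have hw := le_trans (enorm_orthproj V _) (anc_approx p.+1 w).
rewrite (le_trans (lerD (lerD h hz) hw))// natrM -/P.
have : 0 <= n%:R * (P - 2) :> R by rewrite mulr_ge0// subr_ge0.
by move: P2; clear; clearbody P; move=> *; lra.
Qed.

Lemma sum_anc p A (F : Z -> nat) :
  (\sum_(z <- A) F z = \sum_(w <- [fset anc p z | z in A]%fset) \sum_(z <- desc p A w) F z)%N.
Proof.
rewrite (partition_big_imfset _ (anc p)) /=; apply: eq_bigr => w _.
by rewrite big_fset_condE.
Qed.

(** Colliding cells have colliding ancestors, and collisions between the descendants of two
    ancestors are controlled through [cross_max] by those within one family. *)
Lemma J_submult (K : set (euclid R n)) q p A (Jp : nat) : conf K (q + p) A ->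
  (forall B, conf K p B -> (J V B <= Jp)%N) ->
  (J V A <= (8 * n + 3) ^ n * J V [fset anc p z | z in A]%fset * Jp)%N.
Proof.
move=> cA hJp; set W := [fset anc p z | z in A]%fset.
have hd w : (J V (desc p A w) <= Jp)%N.
  by rewrite -(J_translate V _ (2 ^+ p *: w)); apply: hJp; exact: conf_desc cA.
rewrite {1}/J /cross (sum_anc p) -/W.
have -> : ((8 * n + 3) ^ n * J V W * Jp = \sum_(w <- W) \sum_(w' <- W) coll V w w' * ((8 * n + 3) ^ n * Jp))%N.
  rewrite mulnAC mulnC /J /cross big_distrl; apply: eq_bigr => w _.
  by rewrite big_distrl.
apply: leq_sum => w _.
rewrite (eq_bigr (fun z => \sum_(w' <- W) \sum_(z' <- desc p A w') coll V z z')%N); last first.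
  by move=> z _; rewrite (sum_anc p).
rewrite exchange_big; apply: leq_sum => w' _.
case: (boolP (coll V w w')) => [ww|ww]; first by rewrite mul1n; exact: cross_max.
rewrite mul0n big_seq big1// => z; rewrite !inE => /andP[_ /eqP zw].
rewrite big_seq big1// => z'; rewrite !inE => /andP[_ /eqP zw'].
by apply/eqP; rewrite eqb0; apply: contra ww => /(coll_anc p); rewrite zw zw'.
Qed.

Definition near (p : nat) (z w : Z) : bool :=
  [forall i, (`|(anc p z i ord0 - anc p w i ord0)%R| <= 1)%N].

Definition step (e : {ffun 'I_n -> 'I_3}) : Z := \col_i ((e i : nat)%:Z - 1).

(** A cell has at most 3^n neighbours, so near collisions involve only 3^n Np pairs of families of
    descendants, and not the square of Np. *)
Lemma near_coll_le (K : set (euclid R n)) q p A (Np Jp : nat) : conf K (q + p) A ->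
  (#|` [fset anc p z | z in A]%fset| <= Np)%N ->
  (forall B, conf K p B -> (J V B <= Jp)%N) ->
  (\sum_(z <- A) \sum_(z' <- A) (near p z z' && coll V z z') <=
    3 ^ n * (8 * n + 3) ^ n * Np * Jp)%N.
Proof.
move=> cA hNp hJp; set W := [fset anc p z | z in A]%fset.
have hd w : (J V (desc p A w) <= Jp)%N.
  by rewrite -(J_translate V _ (2 ^+ p *: w)); apply: hJp; exact: conf_desc cA.
rewrite (sum_anc p) -/W.
rewrite (@leq_trans (\sum_(w <- W) (3 ^ n * ((8 * n + 3) ^ n * Jp))))//; last first.
  rewrite big_const_seq count_predT iter_addn addn0.
  by rewrite -!mulnA !leq_mul2l; do 2 (apply/orP; right); rewrite mulnC leq_mul2r hNp orbT.
apply: leq_sum => w _.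
have -> : (3 ^ n = #|{ffun 'I_n -> 'I_3}|)%N by rewrite card_ffun !card_ord.
rewrite -sum_nat_const.
rewrite (@leq_trans (\sum_(e : {ffun 'I_n -> 'I_3}) cross V (desc p A w) (desc p A (w + step e)%R)))//; last first.
  by apply: leq_sum => e _; exact: cross_max.
rewrite /cross [leqRHS]exchange_big big_seq [leqRHS]big_seq; apply: leq_sum => z.
rewrite !inE => /andP[zA /eqP zw].
rewrite (@leq_trans (\sum_(z' <- A) \sum_(e : {ffun 'I_n -> 'I_3}) (anc p z' == (w + step e)%R) * coll V z z'))//.
  apply: leq_sum => z' _; case: (boolP (near p z z')) => [/forallP hn|//].
  have h i : exists e : 'I_3, anc p z' i ord0 = w i ord0 + ((e : nat)%:Z - 1).
    have := hn i; rewrite zw => hi.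
    move: (w i ord0) (anc p z' i ord0 : int) hi => a b hi.
    have h3 : (`|(b - a + 1)%R| < 3)%N by lia.
    by exists (Ordinal h3) => /=; lia.
  have /choice[e he] := h.
  rewrite (bigD1 (finfun e))//= (_ : anc p z' == _) ?mul1n ?leq_addr//.
  by apply/eqP/colP => i; rewrite [LHS]he !mxE ffunE.
rewrite exchange_big; apply: leq_sum => e _.
rewrite /desc -big_fset_condE [leqRHS]big_mkcond/=; apply: leq_sum => z' _.
by case: eqP => //=; rewrite mul1n.
Qed.

Lemma far_dist p (z w : Z) : ~~ near p z w -> 2 ^+ p <= enorm (zvec z - zvec w : euclid R n).
Proof.
move=> /forallPn[i hi]; rewrite (le_trans _ (enorm_coord _ i))// !mxE -intrB.
move: hi; rewrite !mxE -ltnNge.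
set a := z i ord0; set b := w i ord0.
have ea := divz_eq a (2 ^+ p); have eb := divz_eq b (2 ^+ p).
have P0 := pow2z_gt0 p.
have a0 : 0 <= (a %% (2 ^+ p : int))%Z by rewrite modz_ge0// gt_eqF.
have b0 : 0 <= (b %% (2 ^+ p : int))%Z by rewrite modz_ge0// gt_eqF.
have := ltz_mod a (lt0r_neq0 P0); have := ltz_mod b (lt0r_neq0 P0); rewrite gtr0_norm// => b1 a1 h.
have -> : 2 ^+ p = (2 ^+ p : int)%:~R :> R by rewrite rmorphXn.
rewrite -intr_norm ler_int.
move: ea eb a0 b0 a1 b1 P0 h.
set da := (a %/ _)%Z; set db := (b %/ _)%Z; set ma := (a %% _)%Z; set mb := (b %% _)%Z.
move: (2 ^+ p : int) => P -> -> *.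
have : (2 <= da - db)%R \/ (da - db <= -2)%R by lia.
move=> [hd|hd]; [rewrite ger0_norm; nia|rewrite ler0_norm; nia].
Qed.

End Submult.

(** * Sets with compact zooms *)

Section Lipschitz.
Context {R : realType}.

Lemma lipschitz_continuous (X Y : metricType R) (f : X -> Y) (L : R) : 0 < L ->
  (forall x y, mdist (f x) (f y) <= L * mdist x y) -> continuous f.
Proof.
move=> L0 fL x A /=; rewrite -!filter_from_ballE => -[e /= e0 eA].
exists (e / L) => /=; first by rewrite divr_gt0.
move=> y; rewrite ballEmdist/= ltr_pdivlMr// => xy; apply: eA.
by rewrite ballEmdist/= (le_lt_trans (fL _ _))// mulrC.
Qed.

Lemma lipschitz_compact (X Y : metricType R) (f : X -> Y) (L : R) (A : set X) : 0 < L ->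
  (forall x y, mdist (f x) (f y) <= L * mdist x y) -> compact A -> compact (f @` A).
Proof.
move=> L0 fL; apply: continuous_compact; apply: continuous_subspaceT.
exact: lipschitz_continuous fL.
Qed.

End Lipschitz.

Section Homothety.
Context {R : realType} {n : nat}.
Implicit Types (K : set (euclid R n)) (V : {vspace euclid R n}).

Lemma mdist_homothety (r : R) (b x y : euclid R n) :
  mdist (r *: x + b) (r *: y + b) = `|r| * mdist x y.
Proof. by rewrite !edistE opprD addrACA subrr addr0 -scalerBr enormZ. Qed.

Lemma mdist_orthproj V (x y : euclid R n) :
  mdist (orthproj V x) (orthproj V y) <= 1 * mdist x y.
Proof. by rewrite mul1r !edistE -orthprojB enorm_orthproj. Qed.

Lemma compact_orthproj V K : compact K -> compact (orthproj V @` K).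
Proof. by apply: lipschitz_compact => //; exact: mdist_orthproj. Qed.

Lemma compact_homothety K (r : R) (b : euclid R n) : compact K ->
  compact [set r *: x + b | x in K].
Proof.
apply: (@lipschitz_compact _ _ _ _ (`|r| + 1)) => [|x y]; first by rewrite ltr_wpDl.
by rewrite mdist_homothety ler_wpM2r ?mdist_ge0// lerDl.
Qed.

Lemma hausdorff_dim_proj_homothety V K (r : R) (b : euclid R n) :
  (hausdorff_dim (orthproj V @` [set (r *: x + b)%R | x in K]) <=
   hausdorff_dim (orthproj V @` K))%E.
Proof.
have -> : orthproj V @` [set r *: x + b | x in K] =
    (fun y : euclid R n => r *: y + orthproj V b : euclid R n) @` (orthproj V @` K).
  apply/seteqP; split=> [_ [_ [x Kx <-] <-]|_ [_ [x Kx <-] <-]].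
    by exists (orthproj V x); [exists x|rewrite orthprojD orthprojZ].
  by exists (r *: x + b); [exists x|rewrite orthprojD orthprojZ].
apply: (@hausdorff_dim_lipschitz _ _ _ _ _ (`|r| + 1)); first by rewrite ltr_wpDl.
by move=> x y _ _; rewrite mdist_homothety ler_wpM2r ?mdist_ge0// lerDl.
Qed.

(* The only property of homogeneous sets that the argument uses; the
   self-homothetic sets of the graph-directed case have it, too. *)
Definition zoom_compact K : Prop :=
  forall A : nat -> set (euclid R n),
  (forall m, [/\ A m !=set0, closed (A m), A m `<=` unit_cube &
     exists (r : R) (b : euclid R n), 1 <= `|r| /\ A m `<=` [set r *: x + b | x in K]]) ->
  exists (r : R) (b : euclid R n), r != 0 /\
    forall (eps : R) (M : nat), 0 < eps -> exists m : nat, (M <= m)%N /\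
      forall x, A m x -> exists2 y, K y & enorm (x - (r *: y + b)) <= eps.

End Homothety.

Section HomogeneousMain.
Context {R : realType} {n : nat}.
Local Notation Z := 'cV[int]_n.
Variable K : set (euclid R n).
Hypotheses (n0 : (0 < n)%N) (K0 : K !=set0) (cK : compact K) (Kc : K `<=` unit_cube).

Lemma conf_growth (G : {fset Z} -> nat) :
  (forall A, (G A <= #|` A| ^ 2)%N) -> (forall z, (1 <= G [fset z]%fset)%N) ->
  exists (g : nat -> nat) (alpha : R),
  [/\ 0 <= alpha,
      forall q, exists2 A, conf K q A & G A = g q,
      forall q A, conf K q A -> (G A <= g q)%N,
      forall e, 0 < e -> exists2 C, 0 < C & forall q, (g q)%:R <= C * exp2 ((alpha + e) * q%:R) &
      forall e M, 0 < e -> exists m, (M <= m)%N /\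
        forall q, (q <= m)%N -> exp2 ((alpha - e) * q%:R) * (g (m - q)%N)%:R <= (g m)%:R].
Proof.
move=> G2 G1.
have hB q A : conf K q A -> (G A <= ((2 ^ q).+1 ^ n) ^ 2)%N.
  by move=> cA; rewrite (leq_trans (G2 A))// leq_sqr (conf_card cA).
have [g hg] := exists_conf_max hB.
have gB q : (g q <= ((2 ^ q).+1 ^ n) ^ 2)%N by have [[A cA <-] _] := hg q; exact: hB.
have g1 q : 1 <= (g q)%:R :> R.
  rewrite ler1n; have [_ h] := hg q; have [x Kx] := K0.
  rewrite (leq_trans (G1 (cell q x)))//; apply: h.
  exists 1, 0; split; first by rewrite normr1.
  move=> z; rewrite inE => /eqP ->; exists x; rewrite scale1r addr0; split=> //; exact: Kc.
have [|alpha [a0 h1 h2]] := @growth_exponent R (fun q => (g q)%:R) (exp2 (n * 2)%:R) (n * 2)%:R g1.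
  move=> q; rewrite -exp2D (@le_trans _ _ ((2 ^ q.+1) ^ (n * 2))%:R)//.
    rewrite ler_nat (leq_trans (gB q))// -expnM leq_exp2r ?muln_gt0 ?n0//.
    by rewrite expnS mul2n -addnn -[ltnLHS]addn0 -addnS leq_add2l expn_gt0.
  rewrite -expnM natrX -exp2_nat mulnC natrM -[X in _ <= exp2 (X + _)]mulr1 -mulrDr.
  by rewrite nat1r mulrC -natrM mulnC natrM.
exists g, alpha; split=> //.
- by move=> q; have [] := hg q.
- by move=> q A cA; have [_] := hg q; apply.
Qed.

Lemma cells_fset q : exists X : {fset Z}, [/\ conf K q X,
  forall x, K x -> cell q x \in X & forall z, z \in X -> exists2 x, K x & cell q x = z].
Proof.
pose F (e : {ffun 'I_n -> 'I_(2 ^ q).+1}) : Z := \col_i (e i : nat)%:Z.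
pose X := [fset z in [fset F e | e in {: {ffun 'I_n -> 'I_(2 ^ q).+1}}]%fset |
   `[< exists2 x, K x & cell q x = z >]]%fset.
have XK z : z \in X -> exists2 x, K x & cell q x = z.
  by rewrite !inE => /andP[_ /asboolP].
exists X; split=> //.
  exists 1, 0; split; first by rewrite normr1.
  move=> z /XK[x Kx xz]; exists x; rewrite scale1r addr0; split=> //; exact: Kc.
move=> x Kx; rewrite !inE; apply/andP; split; last by apply/asboolP; exists x.
have h i : (`|cell q x i ord0|%N < (2 ^ q).+1)%N /\ (0 <= cell q x i ord0)%R.
  rewrite mxE; have /andP[c0 c1] := Kc Kx i.
  set y := _ * _.
  have y0 : 0 <= y by rewrite mulr_ge0// exprn_ge0.
  have y1 : y <= 2 ^+ q by rewrite ler_piMr// exprn_ge0.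
  rewrite floor_ge0 y0; split=> //; rewrite ltnS.
  rewrite -lez_nat gez0_abs ?floor_ge0// -(ler_int R) (le_trans (floor_le _))//.
  by rewrite (le_trans y1)// -pmulrn natrX.
apply/imfsetP; exists [ffun i => Ordinal (h i).1] => //=.
by apply/colP => i; rewrite !mxE ffunE /= gez0_abs ?(h i).2// mxE.
Qed.

(** Each colliding pair of ancestors has at most Np^2 pairs of descendants. *)
Lemma pair_anc_le (V : {vspace euclid R n}) (P : Z -> Z -> bool) q p A (Np : nat) :
  conf K (q + p) A -> (forall B, conf K p B -> (#|` B| <= Np)%N) ->
  (forall z z', z \in A -> z' \in A -> P z z' -> coll V (anc p z) (anc p z')) ->
  (\sum_(z <- A) \sum_(z' <- A) P z z' <= J V [fset anc p z | z in A]%fset * (Np ^ 2))%N.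
Proof.
move=> cA hN hP; set W := [fset anc p z | z in A]%fset.
have hd w : (#|` desc p A w| <= Np)%N.
  have inj : injective (fun z : Z => z - 2 ^+ p *: w) by move=> x y /addIr.
  have <- : #|` [fset z - 2 ^+ p *: w | z in desc p A w]%fset| = #|` desc p A w|.
    exact: card_imfset.
  by apply: hN; exact: conf_desc cA.
rewrite (sum_anc p) -/W /J /cross big_distrl; apply: leq_sum => w _.
rewrite (eq_bigr (fun z => \sum_(w' <- W) \sum_(z' <- desc p A w') P z z')%N); last first.
  by move=> z _; rewrite (sum_anc p).
rewrite exchange_big big_distrl; apply: leq_sum => w' _.
case: (boolP (coll V w w')) => [ww|ww].
  rewrite /= mul1n (@leq_trans (\sum_(z <- desc p A w) \sum_(z' <- desc p A w') 1))//.
    by apply: leq_sum => z _; apply: leq_sum => z' _; case: (P _ _).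
  under eq_bigr do rewrite sum1_size.
  by rewrite big_const_seq count_predT iter_addn addn0 -mulnn leq_mul.
rewrite /= mul0n big_seq big1// => z; rewrite !inE => /andP[zA /eqP zw].
rewrite big_seq big1// => z'; rewrite !inE => /andP[zA' /eqP zw'].
by apply/eqP; rewrite eqb0; apply: contra ww => /(hP _ _ zA zA'); rewrite zw zw'.
Qed.

(** The configurations come from changing zooms. Applying [zoom_compact] to finite sets of
    representatives puts infinitely many of them, with any accuracy, near one fixed homothetic copy
    of K. *)
Lemma zoom_conf (m : nat -> nat) (A : nat -> {fset Z}) : zoom_compact K ->
  (forall j, conf K (m j) (A j)) -> (forall j, A j != fset0) ->
  exists (r : R) (b : euclid R n), r != 0 /\
    forall (eps : R) (M : nat), 0 < eps -> exists j : nat, (M <= j)%N /\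
      exists pt : Z -> euclid R n, forall z, z \in A j ->
        cell (m j) (pt z) = z /\ exists2 y, K y & enorm (pt z - (r *: y + b)) <= eps.
Proof.
move=> hZ cA A0.
have /choice[pt hpt] : forall j, exists pt : Z -> euclid R n, exists (r : R) (b : euclid R n),
    1 <= `|r| /\ forall z, z \in A j -> [/\ cell (m j) (pt z) = z, unit_cube (pt z) &
      exists2 x, K x & r *: x + b = pt z].
  move=> j; have [r [b [r1 h]]] := cA j.
  have /choice[f hf] : forall z, exists x, z \in A j ->
      [/\ K x, unit_cube (r *: x + b) & cell (m j) (r *: x + b) = z].
    move=> z; case: (boolP (z \in A j)) => [/h[x hx]|_]; first by exists x.
    by exists 0.
  exists (fun z => r *: f z + b), r, b; split=> // z /hf[h1 h2 h3]; split=> //.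
  by exists (f z).
have [|r [b [r0 hr]]] := hZ (fun j => pt j @` [set` A j]).
  move=> j; have [r [b [r1 h]]] := hpt j; split.
  - by have /fset0Pn[z zA] := A0 j; exists (pt j z), z.
  - apply: compact_closed; first exact: metric_hausdorff.
    by apply: finite_compact; apply: finite_image; exact: finite_fset.
  - by move=> _ [z zA <-]; have [] := h _ zA.
  - exists r, b; split=> // _ [z zA <-]; have [_ _ [x Kx <-]] := h _ zA.
    by exists x.
exists r, b; split=> // eps M e0; have [j [Mj hj]] := hr eps M e0.
exists j; split=> //; exists (pt j) => z zA; have [r' [b' [_ h]]] := hpt j.
have [h1 _ _] := h _ zA; split=> //; apply: hj.
by exists z.
Qed.

Lemma dim_le_growth (Nm : nat -> nat) (d : R) : 0 <= d ->
  (forall q A, conf K q A -> (#|` A| <= Nm q)%N) ->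
  (forall e, 0 < e -> exists2 C, 0 < C & forall q, (Nm q)%:R <= C * exp2 ((d + e) * q%:R)) ->
  (hausdorff_dim K <= d%:E)%E.
Proof.
move=> d0 hN hd; apply/lee_addgt0Pr => e e0; rewrite -EFinD.
have [C C0 hC] := hd e e0.
have nR : 0 < n%:R :> R by rewrite ltr0n.
apply: (@hausdorff_dim_le_cover _ _ _ _ (C * n%:R `^ (d + e))).
- by rewrite addr_ge0// ltW.
- by rewrite mulr_ge0 ?powR_ge0// ltW.
move=> eps eps0; have [q hq] := @exp2_small R 1 (eps / n%:R) ltr01 (divr_gt0 eps0 nR).
have {}hq := hq q (leqnn q); rewrite mul1r in hq.
exists (n%:R * exp2 (- q%:R)); split.
- by rewrite mulr_gt0// exp2_gt0.
- by rewrite mulrC -ler_pdivlMr.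
have [X [cX KX _]] := cells_fset q.
exists [seq exp2 (- q%:R) *: (zvec z : euclid R n) | z <- enum_fset X]; split.
  rewrite size_map powRM ?exp2_ge0// -exp2M.
  rewrite (@le_trans _ _ (C * exp2 ((d + e) * q%:R) * (n%:R `^ (d + e) * exp2 (- q%:R * (d + e)))))//.
    rewrite ler_wpM2r ?mulr_ge0 ?powR_ge0 ?exp2_ge0// (le_trans _ (hC q))// ler_nat; exact: hN.
  have -> : - q%:R * (d + e) = - ((d + e) * q%:R) by ring.
  by rewrite exp2N le_eqVlt; apply/orP; left; apply/eqP; field; rewrite exp2_neq0.
move=> x Kx; exists (exp2 (- q%:R) *: (zvec (cell q x) : euclid R n)).
  by apply: map_f; exact: KX.
have E : exp2 (- q%:R) *: zvec (cell q x) - x = exp2 (- q%:R) *: (zvec (cell q x) - 2 ^+ q *: x) :> euclid R n.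
  by rewrite scalerBr scalerA -exp2_nat -exp2D addNr exp20 scale1r.
rewrite edistE E enormZ ger0_norm ?exp2_ge0// mulrC ler_wpM2r ?exp2_ge0// enormB.
exact: cell_approx.
Qed.

Lemma card_pair_fset (A : {fset Z}) (P : Z -> Z -> bool) :
  #|[pred p : A * A | P (val p.1) (val p.2)]| = (\sum_(z <- A) \sum_(z' <- A) P z z')%N.
Proof.
rewrite big_seq_fsetE/=.
under [RHS]eq_bigr do rewrite big_seq_fsetE/=.
rewrite pair_big/= -sum1_card big_mkcond/=.
by apply: eq_bigr => p _; rewrite inE; case: P.
Qed.

Lemma coll_cell (V : {vspace euclid R n}) q (x y : euclid R n) :
  enorm (orthproj V (x - y)) <= exp2 (- q%:R) -> coll V (cell q x) (cell q y).
Proof.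
move=> h; rewrite /coll.
have -> : zvec (cell q x) - zvec (cell q y) = 2 ^+ q *: (x - y)
   - (2 ^+ q *: x - zvec (cell q x)) + (2 ^+ q *: y - zvec (cell q y)) :> euclid R n.
  rewrite scalerBr; set a := zvec _; set b := zvec _; set c := _ *: x; set f := _ *: y.
  by apply/matrixP => i j; rewrite !mxE; ring.
rewrite orthprojD orthprojB orthprojZ.
rewrite (le_trans (enormD _ _))// (le_trans (lerD (enormD _ _) (lexx _)))// enormN.
have hx := le_trans (enorm_orthproj V _) (cell_approx q x).
have hy := le_trans (enorm_orthproj V _) (cell_approx q y).
have h1 : enorm (2 ^+ q *: orthproj V (x - y)) <= 1.
  rewrite enormZ ger0_norm ?exprn_ge0// -exp2_nat.
  by rewrite (le_trans (ler_wpM2l (exp2_ge0 _) h))// -exp2D subrr exp20.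
rewrite (le_trans (lerD (lerD h1 hx) hy))// natrM.
have : 1 <= n%:R :> R by rewrite ler1n.
by clear h hx hy h1 => ?; lra.
Qed.

(* At record scales the extremal configurations are Frostman with exponent d, so
   if collisions grew more slowly, the energy method would give dim pi_V K > s. *)
Lemma J_growth_ge (V : {vspace euclid R n}) (Nm Jm : nat -> nat) (d gamma s : R) :
  zoom_compact K ->
  (forall q, exists2 A, conf K q A & #|` A| = Nm q) ->
  (forall q A, conf K q A -> (#|` A| <= Nm q)%N) ->
  (forall q A, conf K q A -> (J V A <= Jm q)%N) ->
  (forall e M, 0 < e -> exists m, (M <= m)%N /\
    forall q, (q <= m)%N -> exp2 ((d - e) * q%:R) * (Nm (m - q)%N)%:R <= (Nm m)%:R) ->
  (forall e, 0 < e -> exists2 C, 0 < C & forall q, (Jm q)%:R <= C * exp2 ((gamma + e) * q%:R)) ->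
  0 <= s -> (hausdorff_dim (orthproj V @` K) <= s%:E)%E -> 2 * d - gamma <= s.
Proof.
move=> hZ exN hN hJ recN grJ s0 dimK; rewrite leNgt; apply/negP => hs.
pose e := (2 * d - gamma - s) / 6.
have e0 : 0 < e by rewrite /e; lra.
(* At a record scale m, the pairs that are close at scale q number at most J(q) N(m-q)^2, that is,
   2^((gamma+e)q) 2^(-2(d-e)q) N(m)^2 up to a constant. This is the energy condition with exponent
   [lam]. *)
pose lam := 2 * d - gamma - 3 * e.
have lams : s < lam by rewrite /lam /e; lra.
have [C C0 hC] := grJ e e0.
have /choice[m hm] : forall j : nat, exists m : nat, (j <= m)%N /\
    forall q, (q <= m)%N -> exp2 ((d - e) * q%:R) * (Nm (m - q)%N)%:R <= (Nm m)%:R.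
  by move=> j; exact: recN.
have /choice[A hA] : forall j : nat, exists A : {fset Z}, conf K (m j) A /\ #|` A| = Nm (m j).
  by move=> j; have [A cA NA] := exN (m j); exists A.
have Nm0 q : (0 < Nm q)%N.
  have [x Kx] := K0; rewrite -(cardfs1 (cell q x)); apply: hN.
  exists 1, 0; split; first by rewrite normr1.
  move=> z; rewrite inE => /eqP ->; exists x; rewrite scale1r addr0; split=> //; exact: Kc.
have A0 j : A j != fset0.
  by have [_ Nj] := hA j; rewrite -cardfs_gt0 Nj.
have [r [b [r0 hr]]] := zoom_conf hZ (fun j => (hA j).1) A0.
suff : (lam%:E <= s%:E)%E by rewrite lee_fin leNgt lams.
apply: le_trans dimK; apply: le_trans (hausdorff_dim_proj_homothety V K r b).
apply: (@content_dim _ _ _ C).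
- by apply: compact_orthproj; exact: compact_homothety.
- by rewrite (le_trans s0)// ltW.
- exact: ltW.
move=> eps M eps0; have [j [Mj [pt hpt]]] := hr eps M eps0.
have [mj rec] := hm j; have [cA NA] := hA j.
exists (m j); split; first exact: leq_trans mj.
exists (A j), (fun z => orthproj V (pt (val z))); split.
- by rewrite -cardfE NA.
- move=> z; have [_ [y Ky hy]] := hpt _ (valP z).
  exists (orthproj V (r *: y + b)); first by exists (r *: y + b) => //; exists y.
  by rewrite -orthprojB (le_trans (enorm_orthproj _ _)).
move=> q qm.
rewrite (card_pair_fset _ (fun z z' => enorm (orthproj V (pt z) - orthproj V (pt z')) <= exp2 (- q%:R))).
have cA' : conf K (q + (m j - q)) (A j) by rewrite subnKC.
have hP z z' : z \in A j -> z' \in A j ->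
   enorm (orthproj V (pt z) - orthproj V (pt z')) <= exp2 (- q%:R) ->
   coll V (anc (m j - q) z) (anc (m j - q) z').
  move=> zA zA' hz; have [<- _] := hpt _ zA; have [<- _] := hpt _ zA'.
  have Ec (u : euclid R n) : anc (m j - q) (cell (m j) u) = cell q u.
    by rewrite -[in cell _ u](subnKC qm) anc_cell.
  by rewrite !Ec; apply: coll_cell => //; rewrite orthprojB.
have := pair_anc_le cA' (hN (m j - q)%N) hP.
rewrite -(ler_nat R) => /le_trans; apply.
have hJ1 := hJ _ _ (conf_anc cA').
rewrite natrM natrX.
have h1 : (J V [fset anc (m j - q) z | z in A j]%fset)%:R <= C * exp2 ((gamma + e) * q%:R).
  by rewrite (le_trans _ (hC q))// ler_nat.
have h2 : (Nm (m j - q)%N)%:R <= exp2 (- ((d - e) * q%:R)) * (Nm (m j))%:R :> R.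
  by rewrite exp2N ler_pdivlMl ?exp2_gt0// rec.
rewrite (le_trans (ler_pM _ _ h1 (lerXn2r 2 _ _ h2)))//.
- by rewrite nnegrE.
- by rewrite nnegrE mulr_ge0// exp2_ge0.
- rewrite -cardfE NA exprMn -[exp2 (- _) ^+ 2]powR_mulrn ?exp2_ge0// -exp2M mulrA.
  rewrite ler_wpM2r ?sqr_ge0// -mulrA ler_wpM2l ?(ltW C0)// -exp2D exp2_le//.
  by rewrite le_eqVlt /lam; apply/orP; left; apply/eqP; ring.
Qed.

End HomogeneousMain.

Lemma sum_fiber_le (T : eqType) (W X : seq T) (tau : T -> T) (g : T -> nat) (B : nat) :
  uniq X -> (forall w, w \in W -> tau w \in X) ->
  (forall x, (\sum_(w <- W) (tau w == x) <= B)%N) ->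
  (\sum_(w <- W) g (tau w) <= B * \sum_(x <- X) g x)%N.
Proof.
move=> uX WX hB.
rewrite big_seq (eq_bigr (fun w => \sum_(x <- X) (tau w == x) * g x)%N); last first.
  by move=> w /WX wX; rewrite sum_eq_seq.
rewrite -big_seq exchange_big big_distrr; apply: leq_sum => x _ /=.
by rewrite -big_distrl leq_mul2r hB orbT.
Qed.

Lemma sum_fiber2_le (T : eqType) (W X : seq T) (tau : T -> T) (P P' : T -> T -> bool) (B : nat) :
  uniq X -> (forall w, w \in W -> tau w \in X) ->
  (forall x, (\sum_(w <- W) (tau w == x) <= B)%N) ->
  (forall w w', w \in W -> w' \in W -> P w w' -> P' (tau w) (tau w')) ->
  (\sum_(w <- W) \sum_(w' <- W) P w w' <= B ^ 2 * \sum_(x <- X) \sum_(x' <- X) P' x x')%N.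
Proof.
move=> uX WX hB hP.
apply: (@leq_trans (\sum_(w <- W) B * \sum_(x' <- X) P' (tau w) x')%N).
  rewrite big_seq [leqRHS]big_seq; apply: leq_sum => w wW.
  apply: leq_trans (@sum_fiber_le _ _ _ tau (fun x' => P' (tau w) x' : nat) B uX WX hB).
  rewrite big_seq [leqRHS]big_seq; apply: leq_sum => w' w'W.
  by have := hP _ _ wW w'W; case: (P w w') => // ->.
rewrite -big_distrr/= -mulnn -mulnA leq_mul2l.
by rewrite (@sum_fiber_le _ _ _ tau (fun x => \sum_(x' <- X) P' x x')%N B uX WX hB) orbT.
Qed.

Lemma card_zvec_close (R : realType) (n : nat) (A : {fset 'cV[int]_n}) (D : nat) :
  (forall z w, z \in A -> w \in A -> enorm (zvec z - zvec w : euclid R n) <= D%:R) ->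
  (#|` A| <= (2 * D).+1 ^ n)%N.
Proof.
move=> hA; have [->|/fset0Pn[z0 z0A]] := eqVneq A fset0; first by rewrite cardfs0.
pose f (z : 'cV[int]_n) := [ffun i => inord `|(z i ord0 - z0 i ord0 + D%:Z)%R| : 'I_(2 * D).+1].
have b z i : z \in A -> (`|z i ord0 - z0 i ord0| <= D%:Z :> int)%R.
  move=> zA; have := le_trans (enorm_coord _ i) (hA _ _ zA z0A).
  by rewrite !mxE -intrB -intr_norm [D%:R](_ : _ = (D : int)%:~R)// ler_int.
have hlt (x y : int) : (`|x - y| <= D%:Z)%R -> (`|(x - y + D%:Z)%R| < (2 * D).+1)%N by lia.
have hinj (x y c : int) : (`|x - c| <= D%:Z)%R -> (`|y - c| <= D%:Z)%R ->
   `|(x - c + D%:Z)%R|%N = `|(y - c + D%:Z)%R|%N -> x = y by lia.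
have finj : {in A &, injective f}.
  move=> z w zA wA /ffunP E; apply/colP => i; have := E i; rewrite 2!ffunE => /(congr1 (@nat_of_ord _)).
  have bz := b z i zA; have bw := b w i wA.
  rewrite !inordK; last 2 first.
  - by exact: hlt.
  - by exact: hlt.
  exact: hinj.
have <- : #|{: {ffun 'I_n -> 'I_(2 * D).+1}}| = ((2 * D).+1 ^ n)%N by rewrite card_ffun !card_ord.
rewrite cardfE -(card_in_imset (f := fun z : A => f (val z))) ?max_card//.
by move=> z w _ _ /= /(finj _ _ (valP z) (valP w))/val_inj.
Qed.

(** * Collisions between distant cells *)

Section FarCollisions.
Context {R : realType} {n : nat}.
Local Notation Z := 'cV[int]_n.
Variable K : set (euclid R n).
Hypotheses (n0 : (0 < n)%N).

(** One integer [j] stands for all constants that depend on V, so that the exceptional V split into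
    countably many classes. *)
Definition far_coll (V : {vspace euclid R n}) (j : nat) (theta : R) (q : nat) (a b : Z) : bool :=
  (enorm (orthproj V (zvec a - zvec b)) <= j%:R) &&
  (exp2 ((1 - theta) * q%:R) <= j%:R * enorm (zvec a - zvec b : euclid R n)).

(* There are at most about N(q - p) J(p) collisions between cells at distance
   below 2^p, which is negligible because gamma > d. *)
Lemma far_in_conf (V : {vspace euclid R n}) (Nm Jm : nat -> nat) (d gamma theta e : R) :
  (forall q A, conf K q A -> (#|` A| <= Nm q)%N) ->
  (forall q A, conf K q A -> (J V A <= Jm q)%N) ->
  (forall q, (0 < Jm q)%N) ->
  (forall e, 0 < e -> exists2 C, 0 < C & forall q, (Nm q)%:R <= C * exp2 ((d + e) * q%:R)) ->
  (forall e, 0 < e -> exists2 C, 0 < C & forall q, (Jm q)%:R <= C * exp2 ((gamma + e) * q%:R)) ->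
  d < gamma -> 0 < theta -> theta <= 1 -> 0 < e -> 2 * e < (gamma - d) * theta ->
  exists2 C, 0 < C & exists q0, forall q m A (W : {fset Z}), (q0 <= q)%N -> (q <= m)%N ->
    conf K m A -> J V A = Jm m ->
    exp2 ((gamma - e) * q%:R) * (Jm (m - q)%N)%:R <= (Jm m)%:R ->
    W = [fset anc (m - q) z | z in A]%fset ->
    exp2 ((gamma - e) * q%:R) <=
      C * (\sum_(w <- W) \sum_(w' <- W)
        (coll V w w' && (exp2 ((1 - theta) * q%:R) <= 2 * enorm (zvec w - zvec w' : euclid R n))%R))%N%:R.
Proof.
move=> hN hJ J0 grN grJ dg t0 t1 e0 e2.
pose c := ((8 * n + 3) ^ n)%N; pose c' := (3 ^ n * c)%N.
have c0 : (0 < c)%N by rewrite expn_gt0 addn3.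
have c'0 : (0 < c')%N by rewrite muln_gt0 expn_gt0.
have [C1 C10 hC1] := grN e e0; have [C2 C20 hC2] := grJ e e0.
have cR : 0 < c%:R :> R by rewrite ltr0n.
have c'R : 0 < c'%:R :> R by rewrite ltr0n.
(* For p about (1 - theta) q, the bound N(q-p) J(p) for near collisions is at most 2^((gamma-e)q)
   2^(-aq) up to a constant, as q - p >= theta q. For large q it is absorbed in half of the
   total. *)
pose a := (gamma - d) * theta - 2 * e.
have a0 : 0 < a by rewrite subr_gt0.
have [|q0 hq0] := @exp2_small R a (2 * c%:R * (c'%:R * (C1 * C2)))^-1 a0.
  by rewrite invr_gt0 !mulr_gt0.
exists (2 * c%:R); first by rewrite mulr_gt0.
exists q0 => q m A W qq qm cA JA rec WE.
have cA' : conf K (q + (m - q)) A by rewrite subnKC.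
have cW := conf_anc cA'; rewrite -WE in cW.
have h1 : exp2 ((gamma - e) * q%:R) <= c%:R * (J V W)%:R.
  have := J_submult cA' (hJ (m - q)%N); rewrite JA -WE -/c => h.
  rewrite -(@ler_pM2r _ (Jm (m - q)%N)%:R) ?ltr0n// (le_trans rec)//.
  by rewrite -!natrM ler_nat.
pose p := Num.truncn ((1 - theta) * q%:R).
have tq0 : 0 <= (1 - theta) * q%:R by rewrite mulr_ge0// subr_ge0.
have /andP[p1 p2] := truncn_itv tq0; rewrite -/p in p1 p2.
have pq : (p <= q)%N.
  by rewrite -(ler_nat R) (le_trans p1)// ler_piMl// lerBlDr lerDl ltW.
have cW' : conf K ((q - p) + p) W by rewrite subnK.
have hnear := near_coll_le cW' (hN _ _ (conf_anc cW')) (hJ p).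
rewrite -/c -/c' in hnear; clearbody c'.
set S := (\sum_(w <- W) _)%N.
have hS : (J V W <= \sum_(z <- W) \sum_(z' <- W) (near p z z' && coll V z z') + S)%N.
  rewrite /J /cross /S -big_split; apply: leq_sum => w _ /=.
  rewrite -big_split; apply: leq_sum => w' _ /=.
  case: (coll V w w') => //=; case: (boolP (near p w w')) => //= /far_dist h.
  rewrite (_ : (_ <= _)%R)//.
  rewrite (le_trans (exp2_le (ltW p2)))// exp2S ler_wpM2l// exp2_nat; exact: h.
have h2 : (\sum_(z <- W) \sum_(z' <- W) (near p z z' && coll V z z'))%N%:R
   <= c'%:R * (C1 * C2) * (exp2 ((gamma - e) * q%:R) * exp2 (- (a * q%:R))).
  have := hnear; rewrite -(ler_nat R) => /le_trans; apply.
  rewrite !natrM -!mulrA ler_wpM2l//.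
  rewrite (le_trans (ler_pM _ _ (hC1 _) (hC2 _)))// mulrACA -!mulrA.
  rewrite !ler_wpM2l ?(ltW C10) ?(ltW C20)// -!exp2D exp2_le//.
  rewrite natrB// /a.
  have : (gamma - d) * (theta * q%:R) <= (gamma - d) * (q%:R - p%:R).
    rewrite ler_wpM2l ?subr_ge0 ?(ltW dg)//.
    by rewrite mulrBl mul1r in p1; move: p1; clear; move: (p%:R) (q%:R) => x y; move: (theta * y) => z ?; lra.
  move=> h; rewrite -subr_ge0 in h; rewrite -subr_ge0 (le_trans h)// le_eqVlt; apply/orP; left; apply/eqP; ring.
have h3 : c%:R * (\sum_(z <- W) \sum_(z' <- W) (near p z z' && coll V z z'))%N%:R
   <= exp2 ((gamma - e) * q%:R) / 2.
  rewrite (le_trans (ler_wpM2l (ltW cR) h2))//.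
  have k0 : 0 < 2 * c%:R * (c'%:R * (C1 * C2)) by rewrite !mulr_gt0.
  have := ler_wpM2l (ltW k0) (hq0 _ qq); rewrite divff ?gt_eqF// => h.
  have := ler_wpM2l (exp2_ge0 ((gamma - e) * q%:R)) h; rewrite mulr1.
  set X := exp2 _; set Y := exp2 _; set k1 := C1 * C2 => {}h.
  rewrite ler_pdivlMr// (le_trans _ h)// le_eqVlt; apply/orP; left; apply/eqP; ring.
have := hS; rewrite -(ler_nat R) natrD -(ler_pM2l cR) mulrDr => h4.
have := le_trans h1 (le_trans h4 (lerD h3 (lexx _))).
by rewrite -mulrA; move: (c%:R * S%:R) (exp2 _) => x y ?; lra.
Qed.

End FarCollisions.

Section Transfer.
Context {R : realType} {n : nat}.
Local Notation Z := 'cV[int]_n.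
Variable K : set (euclid R n).
Hypotheses (n0 : (0 < n)%N) (K0 : K !=set0) (cK : compact K) (Kc : K `<=` unit_cube).

(** Points of K behind the cells of W define a map [tau] into the cells of K with w - w' = r (tau w
    - tau w') up to an error [D]. Hence [tau] has bounded fibres and preserves distant collisions,
    with constants that depend on r. *)
Lemma far_coll_transfer (V : {vspace euclid R n}) (theta r : R) (b : euclid R n)
    (q j B : nat) (W X : {fset Z}) : r != 0 ->
  let D : R := 2 * (n%:R + 1 + `|r| * n%:R) in
  4 * D <= exp2 ((1 - theta) * q%:R) -> 4 * `|r| <= j%:R -> (4 * n)%:R + D <= j%:R * `|r| ->
  D <= B%:R ->
  (forall w, w \in W -> exists x : euclid R n, cell q x = w /\
     exists2 y, K y & enorm (x - (r *: y + b)) <= exp2 (- q%:R)) ->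
  (forall x, K x -> cell q x \in X) ->
  (\sum_(w <- W) \sum_(w' <- W) (coll V w w' &&
      (exp2 ((1 - theta) * q%:R) <= 2 * enorm (zvec w - zvec w' : euclid R n))%R) <=
   ((2 * B).+1 ^ n) ^ 2 * \sum_(a <- X) \sum_(a' <- X) far_coll V j theta q a a')%N.
Proof.
move=> r0 D hD hj1 hj2 hB hW hX.
have /choice[y hy] : forall w : Z, exists y : euclid R n, w \in W -> K y /\
    enorm (2 ^+ q *: (r *: y + b) - zvec w) <= n%:R + 1.
  move=> w; case: (boolP (w \in W)) => [/hW[x [xw [y Ky hy]]]|_]; last by exists 0.
  exists y => _; split=> //.
  have -> : 2 ^+ q *: (r *: y + b) - zvec w =
     (2 ^+ q *: x - zvec w) - 2 ^+ q *: (x - (r *: y + b)) :> euclid R n.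
    by move: (zvec w) => a; apply/matrixP => i k; rewrite !mxE; ring.
  rewrite (le_trans (enormD _ _))// enormN enormZ ger0_norm ?exprn_ge0// lerD//.
    by rewrite -xw cell_approx.
  by rewrite -exp2_nat (le_trans (ler_wpM2l (exp2_ge0 _) hy))// -exp2D subrr exp20.
pose tau w := cell q (y w).
have hd w w' : w \in W -> w' \in W ->
    enorm ((zvec w - zvec w') - r *: (zvec (tau w) - zvec (tau w')) : euclid R n) <= D.
  move=> wW w'W; have [_ h1] := hy _ wW; have [_ h1'] := hy _ w'W.
  have h2 := cell_approx q (y w); have h2' := cell_approx q (y w').
  rewrite -/(tau w) in h2; rewrite -/(tau w') in h2'.
  have -> : (zvec w - zvec w') - r *: (zvec (tau w) - zvec (tau w')) =
    - (2 ^+ q *: (r *: y w + b) - zvec w) + (2 ^+ q *: (r *: y w' + b) - zvec w')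
    + (r *: (2 ^+ q *: y w - zvec (tau w)) - r *: (2 ^+ q *: y w' - zvec (tau w'))) :> euclid R n.
    move: (zvec w) (zvec w') (zvec (tau w)) (zvec (tau w')) (y w) (y w') => a1 a2 a3 a4 a5 a6.
    by apply/matrixP => i k; rewrite !mxE; ring.
  rewrite (le_trans (enormD _ _))//.
  rewrite (le_trans (lerD (enormD _ _) (enormD _ _)))// !enormN !enormZ.
  rewrite (le_trans (lerD (lerD h1 h1') (lerD (ler_wpM2l (normr_ge0 r) h2) (ler_wpM2l (normr_ge0 r) h2'))))//.
  by rewrite /D le_eqVlt; apply/orP; left; apply/eqP; ring.
have rp : 0 < `|r| by rewrite normr_gt0.
apply: (@sum_fiber2_le _ _ _ tau).
- exact: fset_uniq.
- by move=> w /hy[Ky _]; exact: hX.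
- move=> x; rewrite (_ : (\sum_(w <- W) _)%N = #|` [fset w in W | tau w == x]%fset|).
    apply: (@card_zvec_close R) => z w; rewrite !inE => /andP[zW /eqP zx] /andP[wW /eqP wx].
    by have := hd _ _ zW wW; rewrite zx wx subrr scaler0 subr0 => /le_trans; apply.
  by rewrite -sum1_size big_fset [RHS]big_mkcond; apply: eq_bigr => w _; case: eqP.
move=> w w' wW w'W /andP[h1 h2]; have h := hd _ _ wW w'W.
rewrite /far_coll; apply/andP; split.
  rewrite -(ler_pM2r rp) (le_trans _ hj2)// mulrC -enormZ -orthprojZ.
  set u : euclid R n := _ *: _ in h *.
  have -> : u = (zvec w - zvec w') - ((zvec w - zvec w') - u) by rewrite opprB addrC subrK.
  rewrite orthprojB (le_trans (enormD _ _))// enormN lerD//.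
  exact: le_trans (enorm_orthproj _ _) h.
move: h h2; move: (zvec w - zvec w' : euclid R n) (zvec (tau w) - zvec (tau w') : euclid R n) => u v h h2.
have : enorm u <= D + `|r| * enorm v.
  rewrite -enormZ; have -> : u = (u - r *: v) + r *: v by rewrite subrK.
  by rewrite (le_trans (enormD _ _))// lerD2r.
have : 4 * `|r| * enorm v <= j%:R * enorm v by rewrite ler_wpM2r ?enorm_ge0.
clear -hD h2; clearbody D; rewrite -mulrA; move: (`|r| * enorm v) (j%:R * enorm v) (enorm u) (exp2 _) h2 hD => *; lra.
Qed.

Lemma exists_far_coll (X : nat -> {fset Z}) (V : {vspace euclid R n}) (Nm : nat -> nat)
    (d s theta e : R) :
  (forall q x, K x -> cell q x \in X q) -> zoom_compact K ->
  (forall q, exists2 A, conf K q A & #|` A| = Nm q) ->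
  (forall q A, conf K q A -> (#|` A| <= Nm q)%N) ->
  (forall e, 0 < e -> exists2 C, 0 < C & forall q, (Nm q)%:R <= C * exp2 ((d + e) * q%:R)) ->
  (forall e M, 0 < e -> exists m, (M <= m)%N /\
    forall q, (q <= m)%N -> exp2 ((d - e) * q%:R) * (Nm (m - q)%N)%:R <= (Nm m)%:R) ->
  0 <= s -> s < d -> 0 < theta -> theta < 1 -> 0 < e ->
  (hausdorff_dim (orthproj V @` K) <= s%:E)%E ->
  exists j : nat, forall q, (j <= q)%N -> exp2 ((2 * d - s - e) * q%:R) <=
    j%:R * (\sum_(a <- X q) \sum_(a' <- X q) far_coll V j theta q a a')%N%:R.
Proof.
move=> hX hZ exN hN grN recN s0 sd t0 t1 e0 dimK.
have [||Jm [gamma [g0 exJ hJ grJ recJ]]] := conf_growth n0 K0 Kc (G := J V).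
- by move=> A; exact: J_le.
- by move=> z; rewrite (leq_trans _ (J_ge _ _))// cardfs1.
have hg := J_growth_ge n0 K0 cK Kc hZ exN hN hJ recN grJ s0 dimK.
(* Since gamma - d >= d - s, this makes 2 e' < (gamma - d) theta, as [far_in_conf] requires, and
   gamma - e' >= 2d - s - e. *)
pose e' := Num.min e ((d - s) * theta / 4).
have e'0 : 0 < e'.
  by rewrite lt_min e0 divr_gt0// mulr_gt0// subr_gt0.
have e'1 : 2 * e' < (gamma - d) * theta.
  have : e' <= (d - s) * theta / 4 by rewrite ge_min lexx orbT.
  have : (d - s) * theta <= (gamma - d) * theta by rewrite ler_wpM2r ?(ltW t0)//; lra.
  have : 0 < (d - s) * theta by rewrite mulr_gt0// subr_gt0.
  by move: ((d - s) * _) ((gamma - d) * _) => *; lra.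
have Jm0 q : (0 < Jm q)%N.
  have [x Kx] := K0; rewrite (leq_trans _ (hJ q [fset cell q x]%fset _))//.
    by rewrite (leq_trans _ (J_ge _ _))// cardfs1.
  exists 1, 0; split; first by rewrite normr1.
  move=> z; rewrite inE => /eqP ->; exists x; rewrite scale1r addr0; split=> //; exact: Kc.
have dg : d < gamma by lra.
have [C C0 [q0 hC]] := far_in_conf hN hJ Jm0 grN grJ dg t0 (ltW t1) e'0 e'1.
have /choice[m hm] : forall j : nat, exists m : nat, (j <= m)%N /\
    forall q, (q <= m)%N -> exp2 ((gamma - e') * q%:R) * (Jm (m - q)%N)%:R <= (Jm m)%:R.
  by move=> j; exact: recJ.
have /choice[A hA] : forall j : nat, exists A : {fset Z}, conf K (m j) A /\ J V A = Jm (m j).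
  by move=> j; have [A cA NA] := exJ (m j); exists A.
have A0 j : A j != fset0.
  by have [_ Jj] := hA j; rewrite -cardfs_gt0 lt0n; apply/eqP => A0;
    have := J_le V (A j); rewrite Jj A0 leqn0 => /eqP J0; have := Jm0 (m j); rewrite J0.
have [r [b [r0 hr]]] := zoom_conf hZ (fun j => (hA j).1) A0.
pose D : R := 2 * (n%:R + 1 + `|r| * n%:R).
have [q1 hq1] := @exp2_unbounded R (1 - theta) (4 * D) ltac:(by rewrite subr_gt0).
pose B := (Num.truncn D).+1.
pose c := C * (((2 * B).+1 ^ n) ^ 2)%N%:R.
(* [j] exceeds the starting scales, the two thresholds of [far_coll_transfer] and the final constant
   [c]. *)
pose j := maxn (maxn q0 q1) (maxn (Num.truncn (4 * `|r|)).+1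
  (maxn (Num.truncn (((4 * n)%:R + D) / `|r|)).+1 (Num.truncn c).+1)).
have jT (x : R) : (Num.truncn x < j)%N -> x <= j%:R.
  by move=> h; rewrite (le_trans (ltW (truncnS_gt x)))// ler_nat.
exists j => q jq.
have [j' [qj' [pt hpt]]] := hr (exp2 (- q%:R)) q (exp2_gt0 _).
have [mj rec] := hm j'; have [cA JA] := hA j'.
have qm : (q <= m j')%N := leq_trans qj' mj.
pose W := [fset anc (m j' - q) z | z in A j']%fset.
have qq0 : (q0 <= q)%N by rewrite (leq_trans _ jq)// !leq_max leqnn.
have hW := hC q (m j') (A j') W qq0 qm cA JA (rec q qm) erefl.
apply: (@le_trans _ _ (exp2 ((gamma - e') * q%:R))).
  rewrite exp2_le// ler_wpM2r//.
  have : e' <= e by rewrite ge_min lexx.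
  by move: e' {e'0 e'1 hC rec hm hW grJ recJ} => e' ?; lra.
apply: le_trans hW _.
have rp : 0 < `|r| by rewrite normr_gt0.
have hT := @far_coll_transfer V theta r b q j B W (X q) r0.
rewrite (@le_trans _ _ (c * (\sum_(a <- X q) \sum_(a' <- X q) far_coll V j theta q a a')%N%:R))//.
  rewrite /c -mulrA ler_wpM2l ?(ltW C0)// -natrM ler_nat; apply: hT.
  - by apply: hq1; rewrite (leq_trans _ jq)// !leq_max leqnn orbT.
  - by apply: jT; rewrite /j !leq_max leqnn !orbT.
  - by rewrite -ler_pdivrMr//; apply: jT; rewrite /j !leq_max leqnn !orbT.
  - exact: ltW (truncnS_gt _).
  - move=> w /imfsetP[z /= zA ->]; have [zc [y Ky hy]] := hpt _ zA.
    exists (pt z); split; last by exists y.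
    by rewrite -[in RHS]zc -[in cell (m j') _](subnKC qm) anc_cell.
  - by move=> x Kx; exact: hX.
by rewrite ler_wpM2r//; apply: jT; rewrite /j !leq_max leqnn !orbT.
Qed.

End Transfer.

Section ZoomCompact.
Context {R : realType} {n k : nat}.
Local Notation Z := 'cV[int]_n.
Variable K : set (euclid R n).
Hypotheses (kn : (k < n)%N) (K0 : K !=set0) (cK : compact K) (Kc : K `<=` unit_cube).

Lemma separated_far_coll_le (X : {fset Z}) (C theta : R) (j q : nat)
    (E : seq (grassmannian R n k)) (L : R) :
  0 <= C -> 0 <= theta -> (0 < j)%N ->
  (forall (delta rho : R) (u : euclid R n) (E : seq (grassmannian R n k)),
    0 < delta -> delta <= 1 -> delta <= rho -> u != 0 -> separated delta E ->
    (forall V, V \in E -> enorm (orthproj (val V) u) <= rho * enorm u) ->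
    (size E)%:R <= C * rho ^+ k * delta^-1 ^+ (k * (n - k))) ->
  separated (exp2 (- q%:R)) E ->
  (forall V, V \in E -> L <= (\sum_(a <- X) \sum_(a' <- X) far_coll (val V) j theta q a a')%N%:R) ->
  (size E)%:R * L <= (C * (j ^ 2)%N%:R ^+ k *
     exp2 (((k * (n - k))%:R - k%:R + k%:R * theta) * q%:R)) * (#|` X|)%:R ^+ 2.
Proof.
move=> C0 t0 j0 hC sE hL.
rewrite (@le_trans _ _ (\sum_(V <- E) (\sum_(a <- X) \sum_(a' <- X) far_coll (val V) j theta q a a')%N%:R))//.
  have -> : (size E)%:R * L = \sum_(V <- E) L by rewrite big_const_seq count_predT iter_addr addr0 mulr_natl.
  by rewrite big_seq [leRHS]big_seq; apply: ler_sum.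
rewrite -natr_sum exchange_big natr_sum /=.
set M := C * _ * _.
have M0 : 0 <= M by rewrite !mulr_ge0 ?exprn_ge0 ?exp2_ge0.
rewrite (@le_trans _ _ (\sum_(a <- X) \sum_(a' <- X) M))//; last first.
  by rewrite !big_const_seq !count_predT !iter_addr !addr0 -mulrnA mulnn -natrX mulr_natr.
apply: ler_sum => a _; rewrite exchange_big natr_sum /=; apply: ler_sum => a' _.
pose E' := [seq V <- E | far_coll (val V) j theta q a a'].
rewrite (_ : (\sum_(V <- E) _)%N = size E'); last first.
  by rewrite size_filter -sum1_count [RHS]big_mkcond; apply: eq_bigr => V _; case: far_coll.
have [E0|] := eqVneq E' [::]; first by rewrite E0.
move=> En; have [V0] : exists V, V \in E'.
  by case: (E') En => // V l _; exists V; rewrite mem_head.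
rewrite mem_filter => /andP[/andP[_ h0] _].
set u : euclid R n := zvec a - zvec a' in h0.
have jR : 0 < j%:R :> R by rewrite ltr0n.
have u0 : u != 0.
  apply/negP => /eqP u0; move: h0; rewrite u0 enorm0 mulr0 leNgt exp2_gt0//.
(* From |pi_V u| <= j and |u| >= 2^((1-theta)q) / j. *)
pose rho : R := (j ^ 2)%N%:R * exp2 (- ((1 - theta) * q%:R)).
have hrho : exp2 (- q%:R) <= rho.
  rewrite -[leLHS]mul1r ler_pM ?exp2_ge0// ?ler1n ?expn_gt0 ?j0// exp2_le// lerN2.
  by rewrite ler_piMl// lerBlDr lerDl.
rewrite (le_trans (hC (exp2 (- q%:R)) rho u E' (exp2_gt0 _) _ hrho u0 _ _))//.
- by rewrite exp2_le1// oppr_le0.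
- split; first by rewrite filter_uniq//; case: sE.
  move=> V W; rewrite !mem_filter => /andP[_ VE] /andP[_ WE] VW.
  by have [_] := sE; apply.
- move=> V; rewrite mem_filter => /andP[/andP[h1 h2] _].
  rewrite (le_trans h1)// /rho -mulrA exp2N natrX expr2 -!mulrA ler_pMr//.
  by rewrite mulrCA ler_pdivlMl ?exp2_gt0// mulr1.
rewrite /M /rho exprMn -!mulrA !ler_wpM2l ?exprn_ge0//.
rewrite -exp2N opprK -!powR_mulrn ?exp2_ge0// -!exp2M -exp2D exp2_le//.
by rewrite le_eqVlt; apply/orP; left; apply/eqP; ring.
Qed.

Theorem packing_dim_zoom_compact (s : R) (F : set (grassmannian R n k)) :
  zoom_compact K -> 0 <= s -> (s%:E < hausdorff_dim K)%E ->
  (forall V, F V -> (hausdorff_dim (orthproj (val V) @` K) <= s%:E)%E) ->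
  (packing_dim F <= ((k * (n - k))%:R - (k%:R - s))%:E)%E.
Proof.
move=> hZ s0 sK FV; have n0 : (0 < n)%N by exact: leq_ltn_trans kn.
have [||Nm [d [d0 exN hN grN recN]]] := conf_growth n0 K0 Kc (G := fun A => #|` A|).
- by move=> A; case: #|` A| => // m; rewrite -mulnn leq_pmulr.
- by move=> z; rewrite cardfs1.
have sd : s < d by rewrite -lte_fin (lt_le_trans sK)//; exact: dim_le_growth grN.
have /choice[X hX] := cells_fset Kc.
apply/lee_addgt0Pr => eps eps0; rewrite -EFinD.
(* The losses add up to (k + 3) e: k e from theta = e, 2 e from the square of N(q), and e from the
   number of collisions. The rate d cancels. *)
pose e := Num.min (eps / (4 + k%:R)) 2^-1.
have e0 : 0 < e by rewrite lt_min divr_gt0//= ?invr_gt0// ltr_wpDr.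
have eh : e <= 2^-1 by rewrite ge_min lexx orbT.
have e1 : e < 1 by rewrite (le_lt_trans eh)// invf_lt1// ltr1n.
have he : (4 + k%:R) * e <= eps.
  by rewrite mulrC -ler_pdivlMr ?ltr_wpDr// ge_min lexx.
have [C C0 hC] := @Gr_count R n k n0.
have knk : (k%:R <= (k * (n - k))%:R :> R) by rewrite ler_nat leq_pmulr// subn_gt0.
(* The piece of index j consists of the V for which [exists_far_coll] holds with the constant j. *)
apply: (@packing_dim_le _ _ _ (fun j => [set V : grassmannian R n k |
   forall q, (j <= q)%N -> exp2 ((2 * d - s - e) * q%:R) <=
    j%:R * (\sum_(a <- X q) \sum_(a' <- X q) far_coll (val V) j e q a a')%N%:R])).
- by exists 2 => V W _ _; exact: mdist_Gr_le2.
- by rewrite addr_ge0 ?(ltW eps0)// opprB addrCA addr_ge0// subr_ge0.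
- move=> V /FV hV; have [|j hj] := exists_far_coll n0 K0 cK Kc _ hZ exN hN grN recN s0 sd e0 e1 e0 hV (X := X).
    by move=> q; have [] := hX q.
  by exists j.
move=> j; have [C1 C10 hC1] := grN e e0.
pose c := C * (j ^ 2)%N%:R ^+ k * (C1 ^+ 2) * j%:R.
exists c; split; first by rewrite !mulr_ge0 ?exprn_ge0 ?(ltW C0) ?(ltW C10).
exists j => q E jq sE hE.
have [E0|En] := eqVneq E [::]; first by rewrite E0 /= mulr_ge0 ?exp2_ge0// !mulr_ge0 ?exprn_ge0 ?(ltW C0) ?(ltW C10).
have [V0 V0E] : exists V, V \in E by case: (E) En => // V l _; exists V; rewrite mem_head.
have j0 : (0 < j)%N.
  case: (j) (hE _ V0E q jq) => // ; rewrite mul0r leNgt exp2_gt0//.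
have jR : 0 < j%:R :> R by rewrite ltr0n.
have hL V : V \in E -> exp2 ((2 * d - s - e) * q%:R) / j%:R <=
    (\sum_(a <- X q) \sum_(a' <- X q) far_coll (val V) j e q a a')%N%:R.
  by move=> VE; have h := hE V VE q jq; rewrite ler_pdivrMr// [leRHS]mulrC; exact: h.
have := separated_far_coll_le (ltW C0) (ltW e0) j0 hC sE hL.
have [cX _ _] := hX q.
have hN2 : (#|` X q|)%:R <= C1 * exp2 ((d + e) * q%:R) by rewrite (le_trans _ (hC1 q))// ler_nat hN.
have hN3 : (#|` X q|)%:R ^+ 2 <= (C1 * exp2 ((d + e) * q%:R)) ^+ 2.
  by rewrite lerXn2r// nnegrE// mulr_ge0 ?exp2_ge0// ltW.
have M0 : 0 <= C * (j ^ 2)%N%:R ^+ k * exp2 (((k * (n - k))%:R - k%:R + k%:R * e) * q%:R).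
  by rewrite !mulr_ge0 ?exprn_ge0 ?exp2_ge0 ?(ltW C0).
move=> h; have {}h := le_trans h (ler_wpM2l M0 hN3).
rewrite mulrA ler_pdivrMr// -ler_pdivlMr ?exp2_gt0// in h.
rewrite (le_trans h)// ler_pdivrMr ?exp2_gt0// /c.
rewrite exprMn -[exp2 _ ^+ 2]powR_mulrn ?exp2_ge0// -exp2M.
set c1 := _ ^+ k; set a1 := exp2 _; set a2 := exp2 _; set a3 := exp2 _; set a4 := exp2 _.
have -> : C * c1 * a1 * (C1 ^+ 2 * a2) * j%:R = C * c1 * C1 ^+ 2 * j%:R * (a1 * a2) by ring.
rewrite -[leRHS]mulrA ler_wpM2l//; first by rewrite !mulr_ge0 ?exprn_ge0 ?(ltW C0) ?(ltW C10).
rewrite /a1 /a2 /a3 /a4 -!exp2D exp2_le//.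
have : ((4 + k%:R) * e) * q%:R <= eps * q%:R by rewrite ler_wpM2r.
have q0 : 0 <= e * q%:R by rewrite mulr_ge0// ltW.
rewrite -subr_ge0 => hq; rewrite -subr_ge0.
rewrite (le_trans (addr_ge0 hq q0))// le_eqVlt; apply/orP; left; apply/eqP; ring.
Qed.

End ZoomCompact.

(** * Homogeneous sets *)

Section Blaschke.
Context {R : realType} {n : nat}.
Implicit Types (A B K : set (euclid R n)).

Lemma ultra_compact (T : Type) (U : set_system T) (X : topologicalType) (A : set X) (f : T -> X) :
  UltraFilter U -> compact A -> U (f @^-1` A) -> exists2 a, A a & f @ U --> a.
Proof.
move=> uU cA UA; have [a [Aa ca]] := cA (f @ U) _ UA.
exists a => // B Ba.
have [//|UB] := in_ultra_setVsetC (f @^-1` B) uU.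
by have [y []] := ca (~` B) B UB Ba.
Qed.

Lemma ultra_bounded (T : Type) (U : set_system T) (f : T -> euclid R n) (L : R) :
  UltraFilter U -> U [set t | enorm (f t) <= L] ->
  exists a, forall e : R, 0 < e -> U [set t | enorm (f t - a) <= e].
Proof.
move=> uU Uc.
have /choice[a ha] : forall i : 'I_n, exists a : R, (fun t => f t i ord0) @ U --> a.
  move=> i; have [||a _ ca] := @ultra_compact _ U R `[- L, L]%classic (fun t => f t i ord0) uU.
  - exact: segment_compact.
  - apply: filterS Uc => t /= h; rewrite in_itv /= -ler_norml.
    exact: le_trans (enorm_coord _ _) h.
  by exists a.
exists (\col_i a i : euclid R n) => e e0.
have [n0|n0] := posnP n.
  by apply: filterS filterT => t _ /=; rewrite (le_trans (enorm_le_sum _))// big1 ?(ltW e0)// => i _; have := ltn_ord i; rewrite [X in (_ < X)%N]n0.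
have nR : 0 < n%:R :> R by rewrite ltr0n.
have h i : \forall t \near U, `|f t i ord0 - a i| <= e / n%:R.
  have /cvgr_distC_le := ha i; apply; exact: divr_gt0.
have := @filter_forall _ _ (fun i => [set t | `|f t i ord0 - a i| <= e / n%:R]) U (@ultra_proper _ _ uU) h.
apply: filterS => t ht /=.
rewrite (le_trans (enorm_le_coord (c := e / n%:R) _))//; last by rewrite mulrC divfK// gt_eqF.
by move=> i; have := ht i; rewrite !mxE.
Qed.

Lemma unit_cube_enorm (x : euclid R n) : unit_cube x -> enorm x <= n%:R.
Proof.
move=> cx; rewrite -[leRHS]mulr1; apply: enorm_le_coord => i.
by have /andP[x0 x1] := cx i; rewrite ger0_norm.
Qed.

Lemma closed_enorm A : (forall x, (forall e : R, 0 < e -> exists2 y, A y & enorm (x - y) <= e) -> A x) ->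
  closed A.
Proof.
move=> hA x cx; apply: hA => e e0.
have [|y [Ay]] := cx (ball x e); first exact: nbhsx_ballx.
by rewrite ballEmdist/= edistE => /ltW xy; exists y.
Qed.

Lemma hausdorff_excess_le A B (e : R) :
  (forall a, A a -> exists2 b, B b & enorm (a - b) <= e) -> (hausdorff_excess A B <= e%:E)%E.
Proof.
move=> h; apply: ge_ereal_sup => _ [a Aa <-]; have [b Bb ab] := h _ Aa.
apply: (@le_trans _ _ (mdist a b)%:E); last by rewrite lee_fin edistE.
by apply: ereal_inf_lbound; exists b.
Qed.

Lemma hausdorff_excess_ge0 A B : A !=set0 -> (0 <= hausdorff_excess A B)%E.
Proof.
move=> [a Aa]; apply: (@le_trans _ _ (ereal_inf [set (mdist a b)%:E | b in B])).
  by apply: le_ereal_inf_tmp => _ [b _ <-]; rewrite lee_fin mdist_ge0.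
by apply: ereal_sup_ubound; exists a.
Qed.

(* The limit set is taken along an ultrafilter, which avoids extracting diagonal
   subsequences. *)
Lemma blaschke (A : nat -> set (euclid R n)) :
  (forall m, A m !=set0 /\ A m `<=` unit_cube) ->
  exists (B : set (euclid R n)) (m : nat -> nat), [/\ B !=set0, closed B, B `<=` unit_cube,
    forall i, (i <= m i)%N & forall i,
      (forall x, A (m i) x -> exists2 b, B b & enorm (x - b) <= i.+1%:R^-1) /\
      (forall b, B b -> exists2 x, A (m i) x & enorm (b - x) <= i.+1%:R^-1)].
Proof.
move=> hA; have [U [uU UN]] := @ultraFilterLemma nat \oo _.
pose B := [set x | forall e : R, 0 < e -> \forall m \near U, exists2 y, A m y & enorm (x - y) <= e].
have BU (f : nat -> euclid R n) : (\forall m \near U, A m (f m)) ->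
    exists2 a, B a & forall e : R, 0 < e -> \forall m \near U, enorm (f m - a) <= e.
  move=> Af; have [|a ha] := @ultra_bounded _ U f n%:R uU.
    by apply: filterS Af => m Af; apply: unit_cube_enorm; exact: (hA m).2.
  exists a => // e e0; near=> m; exists (f m); first by near: m.
  by rewrite enormB; near: m; exact: ha.
have B0 : B !=set0.
  have /choice[f hf] : forall m, exists x, A m x by move=> m; have [] := hA m.
  by have [|a Ba _] := BU f; [exact: nearW|exists a].
have cB : closed B.
  apply: closed_enorm => x hx e e0; have e20 : 0 < e / 2 by rewrite divr_gt0.
  have [y By xy] := hx _ e20.
  apply: filterS (By _ e20) => m [z Az yz]; exists z => //.
  by rewrite -(subrKA y) (le_trans (enormD _ _))// [leRHS]splitr lerD.
have Bc : B `<=` unit_cube.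
  move=> x Bx i.
  have near1 (e : R) : 0 < e -> - e <= x i ord0 <= 1 + e.
    move=> e0; have [m [y Ay xy]] := @filter_ex _ U _ _ (Bx e e0).
    have /andP[y0 y1] := (hA m).2 _ Ay i.
    have := le_trans (enorm_coord _ i) xy; rewrite !mxE ler_norml => /andP[h1 h2].
    by apply/andP; split; lra.
  apply/andP; split; apply/ler_addgt0Pr => e e0; have /andP[] := near1 _ e0; lra.
have h1 (e : R) : 0 < e -> \forall m \near U, forall x, A m x -> exists2 b, B b & enorm (x - b) <= e.
  (* Otherwise the complement belongs to the ultrafilter, and points of [A m] chosen there far from
     B would have a limit in B. *)
  move=> e0; have [//|Uc] := in_ultra_setVsetC
    [set m | forall x, A m x -> exists2 b, B b & enorm (x - b) <= e] uU.
  have /choice[f hf] : forall m, exists x,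
      (~` [set m | forall x, A m x -> exists2 b, B b & enorm (x - b) <= e]) m ->
      A m x /\ ~ exists2 b, B b & enorm (x - b) <= e.
    move=> m; have [[x [Ax nx]]|nex] := pselect (exists x, A m x /\ ~ exists2 b, B b & enorm (x - b) <= e).
      by exists x.
    exists 0 => h; exfalso; apply: h => x Ax; apply: contrapT => nx; apply: nex; by exists x.
  have [|a Ba ha] := BU f; first by apply: filterS Uc => m /hf[].
  have [m [/hf[_ nb] fm]] := @filter_ex _ U _ _ (filterI Uc (ha e e0)).
  by exfalso; apply: nb; exists a.
have h2 (e : R) : 0 < e -> \forall m \near U, forall b, B b -> exists2 x, A m x & enorm (b - x) <= e.
  move=> e0; have e20 : 0 < e / 2 by rewrite divr_gt0.
  have [//|Uc] := in_ultra_setVsetC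
    [set m | forall b, B b -> exists2 x, A m x & enorm (b - x) <= e] uU.
  have /choice[f hf] : forall m, exists x,
      (~` [set m | forall b, B b -> exists2 x, A m x & enorm (b - x) <= e]) m ->
      B x /\ ~ exists2 b, A m b & enorm (x - b) <= e.
    move=> m; have [[x [Ax nx]]|nex] := pselect (exists x, B x /\ ~ exists2 b, A m b & enorm (x - b) <= e).
      by exists x.
    exists 0 => h; exfalso; apply: h => x Ax; apply: contrapT => nx; apply: nex; by exists x.
  (* Here the bad points lie in B, so their limit [a] does too, as B is closed; then [A m] comes
     close to [a] and hence to the bad points. *)
  have [|a ha] := @ultra_bounded _ U f n%:R uU.
    by apply: filterS Uc => m /hf[Bf _]; apply: unit_cube_enorm; exact: Bc.
  have Ba : B a.
    apply: cB => N /nbhs_ballP[r /= r0 rN].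
    have [m [/hf[Bf _] fm]] := @filter_ex _ U _ _ (filterI Uc (ha (r / 2) (divr_gt0 r0 (ltr0Sn _ 1)))).
    exists (f m); split=> //; apply: rN; rewrite ballEmdist /= edistE enormB (le_lt_trans fm)//.
    by rewrite ltr_pdivrMr// mulr_natr mulr2n ltrDl.
  have [m [[/hf[_ nb] fm] [x Ax ax]]] := @filter_ex _ U _ _ (filterI (filterI Uc (ha _ e20)) (Ba _ e20)).
  exfalso; apply: nb; exists x => //.
  by rewrite -(subrKA a) (le_trans (enormD _ _))// [leRHS]splitr lerD.
have /choice[m hm] : forall i : nat, exists m : nat, (i <= m)%N /\
      (forall x, A m x -> exists2 b, B b & enorm (x - b) <= i.+1%:R^-1) /\
      (forall b, B b -> exists2 x, A m x & enorm (b - x) <= i.+1%:R^-1).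
  move=> i; have i0 : 0 < i.+1%:R^-1 :> R by rewrite invr_gt0.
  have Ui : \forall m \near U, (i <= m)%N by apply: UN; exact: nbhs_infty_ge.
  have [m [im [hm1 hm2]]] := @filter_ex _ U _ _ (filterI Ui (filterI (h1 _ i0) (h2 _ i0))).
  by exists m.
by exists B, m; split=> // i; have [] := hm i.
Unshelve. all: by end_near. Qed.

Lemma homogeneous_zoom_compact K : homogeneous_in_cube K -> zoom_compact K.
Proof.
move=> [K0 cK Kc hK] A hA.
have [|B [m [B0 cB Bc im hm]]] := @blaschke A; first by move=> i; have [] := hA i.
have /hK[_ _ _ [r [b [r1 hr]]]] : microset K B.
  split=> //; exists (A \o m); split; first by move=> i; have [? ? ? ?] := hA (m i); split.
  apply: (@squeeze_cvge _ _ _ _ (cst 0%E) _ (fun i => (i.+1%:R^-1)%:E)).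
  - apply: nearW => i; rewrite /hausdorff_dist; have [h1 h2] := hm i.
    rewrite le_max hausdorff_excess_ge0//=; last by have [] := hA (m i).
    by rewrite ge_max !hausdorff_excess_le.
  - exact: cvg_cst.
  - by apply: cvg_EFin; [exact: nearW|exact: cvg_harmonic].
exists r, b; split; first by apply: contraTneq r1 => ->; rewrite normr0 ler10.
move=> eps M eps0; have [i0 hi0] : exists i0 : nat, forall i, (i0 <= i)%N -> i.+1%:R^-1 <= eps.
  exists (Num.truncn eps^-1) => i hi; rewrite -[leRHS]invrK lef_pV2 ?posrE ?invr_gt0//.
  by rewrite (le_trans (ltW (truncnS_gt _)))// ler_nat.
exists (m (maxn i0 M)); split; first by rewrite (leq_trans _ (im _))// leq_maxr.
move=> x Ax; have [b' Bb xb] := (hm (maxn i0 M)).1 _ Ax.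
have [y Ky yb] := hr _ Bb; exists y => //; rewrite yb (le_trans xb)// hi0// leq_maxl//.
Qed.

End Blaschke.

Section PackingHomothety.
Context {R : realType} {n k : nat}.
Implicit Types (K : set (euclid R n)).

Lemma homothetyK (a : R) (b : euclid R n) K : a != 0 ->
  [set a^-1 *: y + - (a^-1 *: b) | y in [set a *: x + b | x in K]] = K.
Proof.
move=> a0; apply/seteqP; split=> [_ [_ [x Kx <-] <-]|x Kx].
  by rewrite scalerDr scalerA mulVf// scale1r addrK.
by exists (a *: x + b); [exists x|rewrite scalerDr scalerA mulVf// scale1r addrK].
Qed.

Lemma hausdorff_dim_homothety (a : R) (b : euclid R n) K :
  (hausdorff_dim [set (a *: x + b)%R | x in K] <= hausdorff_dim K)%E.
Proof.
apply: (@hausdorff_dim_lipschitz _ _ _ _ (fun x : euclid R n => a *: x + b : euclid R n) (`|a| + 1)).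
  by rewrite ltr_wpDl.
by move=> x y _ _; rewrite mdist_homothety ler_wpM2r ?mdist_ge0// lerDl.
Qed.

Theorem packing_dim_homothety (a : R) (b : euclid R n) K (s : R) (F : set (grassmannian R n k)) :
  (k < n)%N -> a != 0 ->
  let K' := [set a *: x + b | x in K] : set (euclid R n) in
  K' !=set0 -> compact K' -> K' `<=` unit_cube -> zoom_compact K' ->
  0 <= s -> (s%:E < hausdorff_dim K)%E ->
  (forall V, F V -> (hausdorff_dim (orthproj (val V) @` K) <= s%:E)%E) ->
  (packing_dim F <= ((k * (n - k))%:R - (k%:R - s))%:E)%E.
Proof.
move=> kn a0 K' K'0 cK' K'c hZ s0 sK FV.
apply: (packing_dim_zoom_compact kn K'0 cK' K'c hZ s0).
  apply: lt_le_trans sK _; rewrite -[in leLHS](homothetyK b K a0).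
  exact: hausdorff_dim_homothety.
move=> V /FV; apply: le_trans; exact: hausdorff_dim_proj_homothety.
Qed.

Theorem packing_dim_homogeneous K (s : R) (F : set (grassmannian R n k)) :
  (k < n)%N -> homogeneous K ->
  0 <= s -> (s%:E < hausdorff_dim K)%E ->
  (forall V, F V -> (hausdorff_dim (orthproj (val V) @` K) <= s%:E)%E) ->
  (packing_dim F <= ((k * (n - k))%:R - (k%:R - s))%:E)%E.
Proof.
move=> kn [hK|[K0 cK _ [a [b [a0 hK]]]]] s0 sK FV.
  have [K0 cK Kc _] := hK.
  exact: (packing_dim_zoom_compact kn K0 cK Kc (homogeneous_zoom_compact hK) s0 sK FV).
have [K'0 cK' K'c _] := hK.
exact: (packing_dim_homothety kn (lt0r_neq0 a0) K'0 cK' K'c (homogeneous_zoom_compact hK) s0 sK FV).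
Qed.

End PackingHomothety.

(** * Similarities and Cantor sets *)

Section Similarities.
Context {R : realType} {n : nat}.
Implicit Types (T : 'M[R]_n) (K : set (euclid R n)) (V : {vspace euclid R n}) (x y : euclid R n).

Definition sim : Type := (R * 'M[R]_n * euclid R n)%type.
Implicit Types (f g : sim).

Definition srat f : R := f.1.1.
Definition sorth f : 'M[R]_n := f.1.2.
Definition sapp f x : euclid R n := srat f *: (sorth f *m x : euclid R n) + f.2.
Definition scomp f g : sim :=
  (srat f * srat g, sorth f *m sorth g, srat f *: (sorth f *m g.2 : euclid R n) + f.2).

Lemma sapp_comp f g x : sapp (scomp f g) x = sapp f (sapp g x).
Proof.
rewrite /sapp /scomp /srat /sorth /= mulmxDr scalerDr addrA -mulmxA.
by rewrite -scalemxAr scalerA.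
Qed.

Lemma dotv_mulmx x y : dotv x y = (x^T *m y) ord0 ord0.
Proof. by rewrite /dotv mxE; apply: eq_bigr => i _; rewrite mxE. Qed.

Lemma dotv_orth T x y : orthogonal_group T -> dotv (T *m x : euclid R n) (T *m y : euclid R n) = dotv x y.
Proof.
move=> oT; rewrite !dotv_mulmx trmx_mul -mulmxA [T^T *m _]mulmxA.
by rewrite (oT : T^T *m T = 1%:M) mul1mx.
Qed.

Lemma enorm_orth T x : orthogonal_group T -> enorm (T *m x : euclid R n) = enorm x.
Proof. by move=> oT; rewrite /enorm dotv_orth. Qed.

Lemma orthogonal_tr T : orthogonal_group T -> orthogonal_group T^T.
Proof. by rewrite /orthogonal_group /= trmxK => /mulmx1C. Qed.

Lemma orthogonal_mul (S T : 'M[R]_n) :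
  orthogonal_group S -> orthogonal_group T -> orthogonal_group (S *m T).
Proof.
rewrite /orthogonal_group /= => oS oT.
by rewrite trmx_mul -mulmxA [S^T *m _]mulmxA oS mul1mx.
Qed.

Lemma mem_image_subspace T V x :
  reflect (exists2 v, v \in V & x = T *m v) (x \in image_subspace T V).
Proof.
apply: (iffP memv_imgP) => -[v vV ->]; exists v => //.
  by rewrite lfunE.
by rewrite lfunE.
Qed.

(* The subspace T^-1 V: it satisfies |pi_V (T x)| = |pi_(rot V T) x|. *)
Definition rot V T : {vspace euclid R n} := image_subspace T^T V.

Lemma orthproj_rot V T x : orthogonal_group T ->
  orthproj (rot V T) x = T^T *m orthproj V (T *m x : euclid R n).
Proof.
move=> oT; apply: orthproj_uniq; split.
  by apply/mem_image_subspace; exists (orthproj V (T *m x : euclid R n)) => //; exact: memv_orthproj.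
move=> _ /mem_image_subspace[v vV ->].
rewrite -(dotv_orth _ _ oT) mulmxBr !mulmxA (mulmx1C (oT : T^T *m T = 1%:M)) !mul1mx.
by have [_] := orthprojP V (T *m x : euclid R n); apply.
Qed.

Lemma enorm_orthproj_rot V T x : orthogonal_group T ->
  enorm (orthproj (rot V T) x) = enorm (orthproj V (T *m x : euclid R n)).
Proof. by move=> oT; rewrite orthproj_rot// enorm_orth//; exact: orthogonal_tr. Qed.

Definition simset K : set sim :=
  [set f | [/\ 0 < srat f, srat f < 1, orthogonal_group (sorth f) & forall x, K x -> K (sapp f x)]].

Lemma simset_comp K f g : simset K f -> simset K g -> simset K (scomp f g).
Proof.
move=> [f0 f1 oF fK] [g0 g1 oG gK]; split.
- exact: mulr_gt0.
- by rewrite /srat /= mulr_ilt1 ?(ltW f0) ?(ltW g0).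
- exact: orthogonal_mul.
- by move=> x Kx; rewrite sapp_comp; apply/fK/gK.
Qed.

Lemma sappB f x y : sapp f x - sapp f y = srat f *: (sorth f *m (x - y) : euclid R n).
Proof. by rewrite /sapp opprD addrACA subrr addr0 -scalerBr mulmxBr. Qed.

Lemma enorm_sappB f x y : orthogonal_group (sorth f) ->
  enorm (sapp f x - sapp f y) = `|srat f| * enorm (x - y).
Proof. by move=> oF; rewrite sappB enormZ enorm_orth. Qed.

Lemma enorm_proj_sappB V f x y : orthogonal_group (sorth f) ->
  enorm (orthproj V (sapp f x - sapp f y)) =
  `|srat f| * enorm (orthproj (rot V (sorth f)) (x - y)).
Proof. by move=> oF; rewrite sappB orthprojZ enormZ enorm_orthproj_rot. Qed.

End Similarities.
Arguments sim : clear implicits.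

Section Cantor.
Context {R : realType} {n : nat}.
Implicit Types (V : {vspace euclid R n}).

(** Words as nested pairs: recursion on the length peels off the outermost map first. *)
Fixpoint wtype (B l : nat) : finType :=
  if l is l'.+1 then ('I_B * wtype B l')%type else unit.

Lemma card_wtype B l : #|{: wtype B l}| = (B ^ l)%N.
Proof. by elim: l => [|l IH] /=; rewrite ?card_unit// card_prod IH card_ord expnS. Qed.

Variables (K : set (euclid R n)) (P : set {vspace euclid R n}) (B : nat) (r kappa lam : R).
Hypotheses (K0 : K !=set0) (cK : compact K).
Hypotheses (r0 : 0 < r) (r1 : r < 1) (kappa0 : 0 < kappa) (lam0 : 0 <= lam).
Hypothesis Br : 1 <= B%:R * r `^ lam.
Hypothesis hP : forall V, P V -> exists W : 'I_B -> sim R n,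
  [/\ forall w, simset K (W w), forall w, r <= srat (W w), forall w, P (rot V (sorth (W w))) &
    forall w w' x y, w != w' -> K x -> K y ->
      kappa <= enorm (orthproj V (sapp (W w) x - sapp (W w') y))].

Let C := (kappa `^ lam)^-1.

(** The maps may depend on V; only [B], [r] and [kappa] are uniform, and the next letter is chosen
    for the pulled-back subspace. The constant [C] makes the bound trivial for rho >= kappa. Below
    kappa only pairs with the same first letter count, and rescaling loses r^-lam <= B while the
    number of pairs gains B^2 over B subfamilies. *)
Lemma cantor_points l V : P V -> exists x : wtype B l -> euclid R n,
  (forall a, K (x a)) /\ forall rho, kappa * r ^+ l <= rho ->
    (\sum_a \sum_b (enorm (orthproj V (x a - x b)) <= rho)%R)%N%:R <=
      C * rho `^ lam * ((B ^ l) ^ 2)%N%:R.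
Proof.
have large (m : nat) rho (F : wtype B m -> wtype B m -> bool) : kappa <= rho ->
    (\sum_a \sum_b F a b)%N%:R <= C * rho `^ lam * ((B ^ m) ^ 2)%N%:R.
  move=> hr; apply: (@le_trans _ _ ((B ^ m) ^ 2)%N%:R).
    rewrite ler_nat (@leq_trans (\sum_(a : wtype B m) \sum_(b : wtype B m) 1)%N)//.
      by apply: leq_sum => a _; apply: leq_sum => b _; case: (F a b).
    by under eq_bigr do rewrite sum1_card card_wtype; rewrite sum_nat_const card_wtype mulnn.
  rewrite -[leLHS]mul1r ler_wpM2r// /C ler_pdivlMl ?powR_gt0// mulr1.
  by rewrite ge0_ler_powR// nnegrE ltW// (lt_le_trans kappa0).
elim: l V => [|l IH] V PV.
  have [x Kx] := K0; exists (fun=> x); split=> // rho; rewrite expr0 mulr1.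
  exact: large.
have [W [WK Wr WP Wk]] := hP PV.
have /choice[y hy] := fun w => IH _ (WP w).
exists (fun a => sapp (W a.1) (y a.1 a.2)); split.
  by move=> a; have [_ _ _] := WK a.1; apply; exact: (hy a.1).1.
move=> rho; have [hr _|hr hrho] := leP kappa rho; first exact: large.
have step w : (\sum_a \sum_b (enorm (orthproj V (sapp (W w) (y w a) - sapp (W w) (y w b))) <= rho)%R)%N%:R
    <= C * (rho / r) `^ lam * ((B ^ l) ^ 2)%N%:R.
  have hrr : kappa * r ^+ l <= rho / r by rewrite ler_pdivlMr// -mulrA -exprSr.
  apply: le_trans ((hy w).2 _ hrr).
  rewrite ler_nat; apply: leq_sum => a _; apply: leq_sum => b _.
  have [w0 _ wo _] := WK w.
  rewrite enorm_proj_sappB// gtr0_norm//.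
  set E := enorm _; case: (boolP (_ <= rho)) => // h; rewrite (_ : E <= rho / r)//.
  by rewrite ler_pdivlMr// (le_trans _ h)// mulrC ler_wpM2r ?enorm_ge0.
have -> : (\sum_a \sum_b (enorm (orthproj V (sapp (W a.1) (y a.1 a.2) - sapp (W b.1) (y b.1 b.2))) <= rho)%R =
   \sum_(w : 'I_B) \sum_(a : wtype B l) \sum_(b : wtype B l) (enorm (orthproj V (sapp (W w) (y w a) - sapp (W w) (y w b))) <= rho)%R)%N.
  rewrite [RHS]pair_big /=; apply: eq_bigr => -[w a] _ /=.
  rewrite -(pair_big xpredT xpredT (fun w' b => (enorm (orthproj V (sapp (W w) (y w a) - sapp (W w') (y w' b))) <= rho)%R : nat))/=.
  rewrite (bigD1 w)//= [X in (_ + X)%N]big1 ?addn0// => w' ww'; rewrite big1// => b _.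
  apply/eqP; rewrite eqb0 -ltNge (lt_le_trans hr)// Wk//; first by rewrite eq_sym.
    exact: (hy w).1.
  exact: (hy w').1.
rewrite natr_sum (@le_trans _ _ (\sum_(w : 'I_B) (C * (rho / r) `^ lam * ((B ^ l) ^ 2)%N%:R)))//.
  exact: ler_sum.
have rho0 : 0 <= rho by rewrite (le_trans _ hrho)// mulr_ge0 ?(ltW kappa0)// exprn_ge0// ltW.
have C0 : 0 <= C by rewrite /C invr_ge0 powR_ge0.
rewrite sumr_const card_ord -[_ *+ B]mulr_natl powRM// ?invr_ge0 ?(ltW r0)//.
have -> : ((B ^ l.+1) ^ 2)%N%:R = B%:R * B%:R * ((B ^ l) ^ 2)%N%:R :> R.
  by rewrite -!natrM mulnn -expnMn -expnS.
have -> : r^-1 `^ lam = (r `^ lam)^-1 by rewrite -powRN -powR_inv1 ?(ltW r0)// -powRrM mulN1r.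
have := Br; set X := B%:R; set Y := r `^ lam => XY; set Z := (_ ^ 2)%N%:R; set S := rho `^ lam.
have -> : X * (C * (S * Y^-1) * Z) = (C * S * Z * X) * Y^-1 by ring.
have -> : C * S * (X * X * Z) = (C * S * Z * X) * X by ring.
rewrite ler_wpM2l ?mulr_ge0 ?powR_ge0//.
by rewrite -[leLHS]mul1r ler_pdivrMr ?powR_gt0.
Qed.

Lemma cantor_dim V : P V -> (lam%:E <= hausdorff_dim (orthproj V @` K))%E.
Proof.
move=> PV; apply: (@content_dim _ _ _ C) => //.
- exact: compact_orthproj.
- by rewrite /C invr_ge0 powR_ge0.
move=> eps M eps0; exists M; split=> //.
have [l hl] : exists l : nat, kappa * r ^+ l <= exp2 (- M%:R).
  have hk : 0 < exp2 (- M%:R) / kappa by rewrite divr_gt0// exp2_gt0.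
  have /cvgr0Pnorm_lt/(_ _ hk)[l _ hl] := cvg_expr (z := r) ltac:(by rewrite gtr0_norm).
  exists l; have := hl l (leqnn l); rewrite /= ger0_norm ?exprn_ge0 ?(ltW r0)// => h.
  by rewrite mulrC -ler_pdivlMr// ltW.
have [x [Kx hx]] := cantor_points l PV.
have B0 : (0 < B)%N by move: Br; case: (B) => //; rewrite mul0r ler10.
exists (wtype B l), (fun a => orthproj V (x a)); split.
- by rewrite card_wtype expn_gt0 B0.
- by move=> a; exists (orthproj V (x a)); [exists (x a)|rewrite subrr enorm0 ltW].
move=> q qM; have hq : kappa * r ^+ l <= exp2 (- q%:R).
  by rewrite (le_trans hl)// exp2_le// lerN2 ler_nat.
have := hx _ hq; rewrite card_wtype natrX -mulNr [- lam * _]mulrC mulrN -mulNr exp2M natrX.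
apply: le_trans; rewrite ler_nat -sum1_card big_mkcond pair_big /=.
by apply: leq_sum => p _; rewrite inE -orthprojB; case: (_ <= _).
Qed.

End Cantor.

Lemma hausdorff_dim_mono (R : realType) (X : metricType R) (A B : set X) :
  A `<=` B -> (hausdorff_dim A <= hausdorff_dim B)%E.
Proof.
move=> AB; apply: le_ereal_inf => _ [t [t0 ht] <-]; exists t => //; split=> //.
apply: hausdorff_measure_eq0 => delta eta d0 e0.
have [U [h1 h2 h3]] := hausdorff_measure0 ht d0 e0.
by exists U; split=> //; exact: subset_trans h1.
Qed.

Lemma compact_enorm (R : realType) (n : nat) (K : set (euclid R n)) : compact K ->
  exists2 D : R, 0 < D & forall x, K x -> enorm x <= D.
Proof.
move=> cK.
have [|x Kx|D _ hD] := @compact_finite_subcover R n K (fun i => ball (0 : euclid R n) i.+1%:R) cK.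
- by move=> i; exact: metric_ball_open.
- exists (Num.truncn (enorm x)) => //; rewrite /= ballEmdist /= edistE sub0r enormN.
  exact: truncnS_gt.
exists (\sum_(i : D) (val i).+1%:R + 1).
  by rewrite ltr_wpDl// sumr_ge0.
move=> x /hD[i /= iD]; rewrite ballEmdist /= edistE sub0r enormN => /ltW h.
rewrite (le_trans h)// ler_wpDr// (bigD1 [` iD]%fset)//= lerDl sumr_ge0//.
Qed.

(** * Self-homothetic subsets *)

Section SelfHomothetic.
Context {R : realType} {n : nat}.
Variables (K : set (euclid R n)) (B : nat) (W : 'I_B -> sim R n) (kappa rmin rmax : R).
Hypotheses (K0 : K !=set0) (cK : compact K) (B0 : (0 < B)%N).
Hypotheses (kappa0 : 0 < kappa) (rmin0 : 0 < rmin) (rmax1 : rmax < 1).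
Hypotheses (WK : forall w, simset K (W w)) (W1 : forall w, sorth (W w) = 1%:M).
Hypotheses (Wr : forall w, rmin <= srat (W w) <= rmax).
Hypothesis Wk : forall w w' x y, w != w' -> K x -> K y ->
  kappa <= enorm (sapp (W w) x - sapp (W w') y).

(* The largest subset of [K] contained in the union of its images: it is
   self-similar without any appeal to a fixed point of the Hutchinson operator. *)
Definition invariant_core : set (euclid R n) :=
  [set x | exists A, [/\ A `<=` K, A x & forall y, A y -> exists w z, A z /\ y = sapp (W w) z]].
Local Notation K' := invariant_core.

Lemma core_sub : K' `<=` K.
Proof. by move=> x [A [AK Ax _]]; exact: AK. Qed.

Lemma core_back x : K' x -> exists w z, K' z /\ x = sapp (W w) z.
Proof.
move=> [A [AK Ax hA]]; have [w [z [Az xz]]] := hA _ Ax.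
by exists w, z; split=> //; exists A.
Qed.

Lemma core_fwd w x : K' x -> K' (sapp (W w) x).
Proof.
move=> K'x; exists (K' `|` [set sapp (W w) y | y in K']); split.
- move=> y [/core_sub//|[z /core_sub Kz <-]]; have [_ _ _] := WK w; exact.
- by right; exists x.
- move=> y [/core_back[w' [z [K'z ->]]]|[z K'z <-]]; last by exists w, z; split=> //; left.
  by exists w', z; split=> //; left.
Qed.

Lemma closed_euclid (A : set (euclid R n)) : compact A -> closed A.
Proof. by apply: compact_closed; exact: metric_hausdorff. Qed.

Lemma compact_sapp (f : sim R n) (A : set (euclid R n)) : orthogonal_group (sorth f) ->
  compact A -> compact (sapp f @` A).
Proof.
move=> oF; apply: (@lipschitz_compact _ _ _ _ (`|srat f| + 1)) => [|x y]; first by rewrite ltr_wpDl.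
by rewrite !edistE enorm_sappB// ler_wpM2r ?enorm_ge0// lerDl.
Qed.

Lemma core_compact : compact K'.
Proof.
have cl : compact (closure K').
  apply: (subclosed_compact _ cK); first exact: closed_closure.
  by rewrite (closure_id K).1; [exact/closure_subset/core_sub|exact: closed_euclid].
have -> : K' = closure K'.
  apply/seteqP; split; first exact: subset_closure.
  (* The closure of the core is an admissible set itself: the finite union of its images is closed
     and contains the core. *)
  move=> x cx; exists (closure K'); split=> //.
    by rewrite (closure_id K).1; [exact/closure_subset/core_sub|exact: closed_euclid].
  pose D := \bigcup_(w in [set: 'I_B]) (sapp (W w) @` closure K').
  have cD : closed D.
    apply: closed_bigcup => [|w _]; first exact: finite_finset.
    apply: closed_euclid; apply: compact_sapp => //.
    by have [] := WK w.
  have : closure K' `<=` D.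
    rewrite (closure_id D).1//; apply: closure_subset => y /core_back[w [z [K'z ->]]].
    by exists w => //; exists z => //; exact: subset_closure.
  by move=> h y /h[w _ [z K'z <-]]; exists w, z.
exact: cl.
Qed.

Lemma core_neq0 : K' !=set0.
Proof.
pose w := Ordinal B0; set f := W w; have [f0 f1 _ fK] := WK w; rewrite -/f in f0 f1 fK.
have r1 : 1 - srat f != 0 by rewrite subr_eq0 gt_eqF.
(* The fixed point of a single homothety is a limit of iterates in K, and [[set p]] is an admissible
   set. *)
pose p : euclid R n := (1 - srat f)^-1 *: f.2.
have fp : sapp f p = p.
  have hb : f.2 = (1 - srat f) *: p by rewrite scalerA mulfV// scale1r.
  by rewrite /sapp W1 mul1mx hb scalerBl scale1r addrC subrK.
have [x0 Kx0] := K0.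
have it l : K (iter l (sapp f) x0) /\ enorm (iter l (sapp f) x0 - p) = srat f ^+ l * enorm (x0 - p).
  elim: l => [|l [IH1 IH2]]; first by rewrite expr0 mul1r.
  split; first exact: fK.
  rewrite iterS -[in LHS]fp enorm_sappB; last by have [] := WK w.
  by rewrite IH2 gtr0_norm// exprS mulrA.
have Kp : K p.
  apply: (closed_euclid cK) => N /nbhs_ballP[e /= e0 eN].
  have E0 : 0 < enorm (x0 - p) + 1 by rewrite ltr_wpDl// enorm_ge0.
  have /cvgr0Pnorm_lt/(_ _ (divr_gt0 e0 E0))[l _ hl] := cvg_expr (z := srat f) ltac:(by rewrite gtr0_norm).
  exists (iter l (sapp f) x0); split; first exact: (it l).1.
  apply: eN; rewrite ballEmdist /= edistE enormB (it l).2.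
  have := hl l (leqnn l); rewrite /= ger0_norm ?exprn_ge0 ?(ltW f0)// ltr_pdivlMr//.
  by apply: le_lt_trans; rewrite ler_wpM2l ?exprn_ge0 ?(ltW f0)// lerDl.
exists p, [set p]; split=> //; first by move=> _ ->.
by move=> _ ->; exists w, p.
Qed.

(** In a copy of scale above [M], points of different pieces are more than n + 1 apart, while points
    of the unit cube are at distance at most n. *)
Let M := (n%:R + 1) / kappa.

(* As long as a copy of the core has scale above [M], the separation of its pieces
   forces a subset of the unit cube into a single one of them. *)
Lemma core_walk (a0 : R) (A : set (euclid R n)) (t : nat) (rho : R) (c : euclid R n) :
  0 < a0 -> A !=set0 -> A `<=` unit_cube ->
  Num.min a0 (rmin * M) <= `|rho| -> `|rho| * rmax ^+ t <= M ->
  A `<=` [set rho *: x + c | x in K'] ->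
  exists (rho' : R) (c' : euclid R n), [/\ Num.min a0 (rmin * M) <= `|rho'|, `|rho'| <= M &
    A `<=` [set rho' *: x + c' | x in K']].
Proof.
move=> a00 A0 Ac; have rmax0 : 0 <= rmax.
  by have /andP[h1 h2] := Wr (Ordinal B0); rewrite (le_trans (ltW rmin0))// (le_trans h1).
elim: t rho c => [|t IH] rho c hm hM hA.
  by exists rho, c; split=> //; rewrite expr0 mulr1 in hM.
have [hr|hr] := leP `|rho| M; first by exists rho, c.
have rho0 : 0 < `|rho| by rewrite (lt_trans _ hr)// divr_gt0// ltr_wpDl.
have [x0 Ax0] := A0; have [y0 K'y0 xy0] := hA _ Ax0.
have [w [z0 [K'z0 yz0]]] := core_back K'y0.
have /andP[wr1 wr2] := Wr w.
have w0 : 0 < srat (W w) by rewrite (lt_le_trans rmin0).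
apply: (IH (rho * srat (W w)) (rho *: (W w).2 + c)).
- rewrite normrM (gtr0_norm w0) ge_min; apply/orP; right.
  by rewrite mulrC ler_pM ?(ltW rmin0)// ?(ltW hr)// divr_ge0 ?(ltW kappa0).
- rewrite normrM (gtr0_norm w0) -mulrA (le_trans _ hM)// ler_wpM2l// exprS ler_wpM2r// exprn_ge0//.
move=> x Ax; have [y K'y xy] := hA _ Ax; have [w' [z [K'z yz]]] := core_back K'y.
have [ww|ww] := eqVneq w' w.
  exists z => //; rewrite -xy yz ww /sapp W1 mul1mx scalerDr scalerA addrA//.
exfalso; have := Wk ww (core_sub K'z) (core_sub K'z0); rewrite -yz -yz0 => h.
have : `|rho| * enorm (y - y0) <= n%:R.
  rewrite -enormZ -[leRHS]mulr1; apply: enorm_le_coord => i.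
  have -> : rho *: (y - y0) = x - x0 by rewrite -xy -xy0 opprD addrACA subrr addr0 scalerBr.
  have /andP[h1 h2] := Ac _ Ax i; have /andP[h3 h4] := Ac _ Ax0 i.
  by rewrite !mxE ler_norml; apply/andP; split; lra.
apply/negP; rewrite -ltNge (@lt_le_trans _ _ (`|rho| * kappa))//; last by rewrite ler_wpM2l.
rewrite -ltr_pdivrMr// (le_lt_trans _ hr)// /M ler_wpM2r ?invr_ge0 ?(ltW kappa0)// lerDl//.
Qed.

(** After [core_walk] all scales lie between a positive bound and [M]. The translations are bounded
    because each copy meets the unit cube. So both converge along an ultrafilter, and the limit
    scale is not 0. *)
Lemma core_zoom_compact (a : R) (b : euclid R n) : a != 0 ->
  zoom_compact [set a *: x + b | x in K'].
Proof.
move=> a0 A hA; have aR : 0 < `|a| by rewrite normr_gt0.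
have M0 : 0 < M by rewrite divr_gt0// ltr_wpDl.
have m0 : 0 < Num.min `|a| (rmin * M) by rewrite lt_min aR mulr_gt0.
have rmax0 : 0 <= rmax.
  by have /andP[h1 h2] := Wr (Ordinal B0); rewrite (le_trans (ltW rmin0))// (le_trans h1).
have /choice[rc hrc] : forall m, exists rc : R * euclid R n,
   [/\ Num.min `|a| (rmin * M) <= `|rc.1|, `|rc.1| <= M &
    A m `<=` [set rc.1 *: x + rc.2 | x in K']].
  move=> m; have [Am0 _ Ac [r [b' [r1 Ar]]]] := hA m.
  have rp : 0 < `|r * a| by rewrite normrM mulr_gt0// (lt_le_trans ltr01).
  have /cvgr0Pnorm_lt/(_ _ (divr_gt0 M0 rp))[t _ ht] := cvg_expr (z := rmax) ltac:(by rewrite ger0_norm).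
  have [|||rho' [c' hc]] := @core_walk `|a| (A m) t (r * a) (r *: b + b') aR Am0 Ac.
  - by rewrite ge_min normrM ler_peMl ?(ltW aR).
  - have := ht t (leqnn t); rewrite /= ger0_norm ?exprn_ge0// ltr_pdivlMr// mulrC => h.
    exact: ltW.
  - move=> x /Ar[_ [z K'z <-] <-]; exists z => //; by rewrite scalerDr scalerA addrA.
  by exists (rho', c').
have [D D0 hD] := compact_enorm cK.
have [U [uU UN]] := @ultraFilterLemma nat \oo _.
have [||r _ hr] := @ultra_compact _ U R `[- M, M]%classic (fun m => (rc m).1) uU.
- exact: segment_compact.
- by apply: filterE => m /=; rewrite in_itv /= -ler_norml; have [] := hrc m.
have [|c hc] := @ultra_bounded _ _ _ U (fun m => (rc m).2) (n%:R + M * D) uU.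
  apply: filterE => m /=; have [h1 h2 h3] := hrc m; have [[x Ax] _ Ac _] := hA m.
  have [y K'y xy] := h3 _ Ax.
  have -> : (rc m).2 = x - (rc m).1 *: y by rewrite -xy addrC addKr.
  rewrite (le_trans (enormD _ _))// enormN enormZ lerD//; first exact/unit_cube_enorm/Ac.
  by rewrite ler_pM// ?enorm_ge0//; exact/hD/core_sub.
have hr' (e : R) : 0 < e -> \forall m \near U, `|(rc m).1 - r| <= e.
  by move=> e0; have /cvgr_distC_le := hr; apply.
have r0 : r != 0.
  apply/negP => /eqP r0; have [m] := @filter_ex _ U _ _ (hr' _ (divr_gt0 m0 (ltr0Sn R 1))).
  rewrite r0 subr0 /=; have [h1 _ _] := hrc m; move: h1 m0; set q := Num.min _ _ => *; lra.
exists (r / a), (c - (r / a) *: b); split; first by rewrite mulf_neq0// invr_eq0.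
move=> eps N eps0.
have e1 : 0 < eps / (2 * D) by rewrite divr_gt0// mulr_gt0.
have e2 : 0 < eps / 2 by rewrite divr_gt0.
have UN' : \forall m \near U, (N <= m)%N by apply: UN; exact: nbhs_infty_ge.
have [m [Nm [hm1 hm2]]] := @filter_ex _ U _ _ (filterI UN' (filterI (hr' _ e1) (hc _ e2))).
exists m; split=> // x Ax; have [_ _ h3] := hrc m; have [y K'y <-] := h3 _ Ax.
exists (a *: y + b); first by exists y.
have -> : (rc m).1 *: y + (rc m).2 - (r / a *: (a *: y + b) + (c - r / a *: b)) =
    ((rc m).1 - r) *: y + ((rc m).2 - c) :> euclid R n.
  have E : r / a * a = r by rewrite mulfVK.
  rewrite (scalerDr (r / a)) scalerA E; move: (r / a *: b) => u.
  by apply/matrixP => i j; rewrite !mxE; ring.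
rewrite (le_trans (enormD _ _))// [leRHS]splitr lerD// enormZ.
rewrite (@le_trans _ _ (eps / (2 * D) * D))//.
  by rewrite ler_pM ?enorm_ge0//; exact/hD/core_sub.
by rewrite le_eqVlt; apply/orP; left; apply/eqP; field; rewrite gt_eqF.
Qed.

Lemma rot_id (V : {vspace euclid R n}) : rot V 1%:M = V.
Proof.
apply/vspaceP => x; apply/mem_image_subspace/idP => [[v vV ->]|xV].
  by rewrite trmx1 mul1mx.
by exists x => //; rewrite trmx1 mul1mx.
Qed.

(** The projection onto the whole space is the identity, so [cantor_dim] applies to the core
    itself. *)
Lemma core_dim (lam : R) : 0 <= lam -> 1 <= B%:R * rmin `^ lam ->
  (lam%:E <= hausdorff_dim K')%E.
Proof.
move=> lam0 hB.
have idp x : orthproj fullv x = x :> euclid R n by rewrite orthproj_id// memvf.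
have -> : K' = orthproj fullv @` K'.
  apply/seteqP; split=> [x K'x|_ [x K'x <-]]; last by rewrite idp.
  by exists x => //; rewrite idp.
have r1 : rmin < 1.
  by have /andP[h1 h2] := Wr (Ordinal B0); rewrite (le_lt_trans h1)// (le_lt_trans h2).
apply: (@cantor_dim R n K' [set fullv] B rmin kappa lam core_neq0 core_compact) => // _ ->.
exists W; split=> //.
- by move=> w; have [h1 h2 h3 _] := WK w; split=> // x; exact: core_fwd.
- by move=> w; have /andP[] := Wr w.
- by move=> w; rewrite W1 rot_id.
- by move=> w w' x y ww K'x K'y; rewrite idp Wk//; exact: core_sub.
Qed.

Theorem packing_dim_homothetic_ifs (k : nat) (lam s : R) (F : set (grassmannian R n k)) :
  (k < n)%N -> 1 <= B%:R * rmin `^ lam -> 0 <= s -> s < lam ->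
  (forall V, F V -> (hausdorff_dim (orthproj (val V) @` K) <= s%:E)%E) ->
  (packing_dim F <= ((k * (n - k))%:R - (k%:R - s))%:E)%E.
Proof.
move=> kn hB s0 slam FV; have [D D0 hD] := compact_enorm cK.
pose a := (2 * D)^-1; have a0 : 0 < a by rewrite invr_gt0 mulr_gt0.
pose b : euclid R n := \col_i 2^-1.
apply: (@packing_dim_homothety R n k a b K' s F kn (lt0r_neq0 a0)) => //.
- by have [x K'x] := core_neq0; exists (a *: x + b), x.
- exact/compact_homothety/core_compact.
- move=> _ [x K'x <-] i; rewrite !mxE.
  have := le_trans (enorm_coord x i) (hD _ (core_sub K'x)); rewrite ler_norml => /andP[h1 h2].
  have aD : a * D = 2^-1 by rewrite /a; field; rewrite gt_eqF.
  have := ler_wpM2l (ltW a0) h1; have := ler_wpM2l (ltW a0) h2; rewrite mulrN aD.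
  by move: (a * _) => u *; apply/andP; split; lra.
- exact/core_zoom_compact/lt0r_neq0.
- by rewrite (lt_le_trans _ (core_dim (ltW (le_lt_trans s0 slam)) hB))// lte_fin.
- move=> V /FV; apply: le_trans; apply: hausdorff_dim_mono.
  by move=> _ [x K'x <-]; exists x => //; exact: core_sub.
Qed.

End SelfHomothetic.

(** * Finite rotation groups *)

Lemma pigeonhole (T : eqType) (X : seq T) (h : nat -> T) : (forall i, h i \in X) ->
  exists i j, (i < j)%N /\ h i = h j.
Proof.
move=> hX; apply: contrapT => no.
have inj : injective h.
  move=> i j hij; case: (ltngtP i j) => // ij; exfalso; apply: no.
    by exists i, j.
  by exists j, i.
have : (size (map h (iota 0 (size X).+1)) <= size X)%N.
  apply: uniq_leq_size; first by rewrite map_inj_uniq// iota_uniq.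
  by move=> _ /mapP[i _ ->].
by rewrite size_map size_iota ltnn.
Qed.

Lemma exists_pos_lb (R : realDomainType) (T : eqType) (X : seq T) (f : T -> R) :
  (forall t, t \in X -> 0 < f t) -> exists2 c : R, 0 < c & forall t, t \in X -> c <= f t.
Proof.
elim: X => [|t X IH] h; first by exists 1.
have [|c c0 hc] := IH; first by move=> u uX; apply: h; rewrite inE uX orbT.
exists (Num.min c (f t)); first by rewrite lt_min c0 h// mem_head.
move=> u; rewrite inE ge_min => /predU1P[->|/hc ->//]; by rewrite lexx orbT.
Qed.

Lemma popular_fiber (T : finType) (U : finType) (g : T -> U) : (0 < #|T|)%N ->
  exists y, (#|T| <= #|U| * #|[set x | g x == y]%SET|)%N.
Proof.
move=> T0; have [x0 _] := card_gt0P T0.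
have U0 : (0 < #|U|)%N by apply/card_gt0P; exists (g x0).
have [y hy] := @bigop.eq_bigmax _ (fun y : U => #|[set x | g x == y]%SET|) U0.
exists y; rewrite -hy -!cardsT; apply: (@card_le_fibers _ _ _ [set: U]%SET g) => // z _.
rewrite (_ : [set x in [set: T] | g x == z]%SET = [set x | g x == z]%SET); last first.
  by apply/setP => x; rewrite !inE.
exact: (bigop.leq_bigmax z).
Qed.

Section SeparatedPieces.
Context {R : realType} {n : nat}.
Variables (K : set (euclid R n)) (LL : set (sim R n)).

(** [c] is fixed before [delta]: for any exponent below a, the count delta^-a then beats every
    constant, powers of [c] included, as delta tends to 0. *)
Definition separated_pieces : Prop :=
  forall a : R, 0 <= a -> (a%:E < hausdorff_dim K)%E ->
  exists c delta0 : R, [/\ 0 < c, c <= 1, 0 < delta0 &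
    forall delta : R, 0 < delta -> delta <= delta0 ->
    exists (N : nat) (W : 'I_N -> sim R n), [/\ delta `^ (- a) <= N%:R,
      forall w, LL (W w), forall w, c * delta <= srat (W w) <= delta &
      forall w w' x y, w != w' -> K x -> K y ->
        delta <= enorm (sapp (W w) x - sapp (W w') y)]].

Hypotheses (K0 : K !=set0) (cK : compact K).
Hypotheses (LK : LL `<=` simset K) (LC : forall f g, LL f -> LL g -> LL (scomp f g)).
Hypothesis sepK : separated_pieces.

(** The power m + 1 of [f]: the loops form a semigroup, with no identity to start from. *)
Definition spow (f : sim R n) (m : nat) : sim R n := iter m (scomp f) f.

Lemma LL_spow f m : LL f -> LL (spow f m).
Proof. by move=> Lf; elim: m => // m IH; rewrite /spow iterS; exact: LC. Qed.

Definition mxpow (T : 'M[R]_n) (m : nat) : 'M[R]_n := iter m (mulmx T) 1%:M.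

Lemma mxpowS T m : mxpow T m.+1 = T *m mxpow T m. Proof. by []. Qed.

Lemma mxpowD T m l : mxpow T (m + l) = mxpow T m *m mxpow T l.
Proof.
elim: m => [|m IH]; first by rewrite mul1mx.
by rewrite addSn !mxpowS IH mulmxA.
Qed.

Lemma sorth_spow f m : sorth (spow f m) = mxpow (sorth f) m.+1.
Proof.
elim: m => [|m IH]; first by rewrite mxpowS mulmx1.
by rewrite /spow iterS /sorth /= -/(sorth f) -/(spow f m) -/(sorth (spow f m)) IH.
Qed.

Lemma orth_mulKV (T S : 'M[R]_n) : orthogonal_group T -> T^T *m (T *m S) = S.
Proof. by move=> oT; rewrite mulmxA (oT : T^T *m T = 1%:M) mul1mx. Qed.

Lemma mxpow_orth T m : orthogonal_group T -> orthogonal_group (mxpow T m).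
Proof.
move=> oT; elim: m => [|m IH]; first by rewrite /orthogonal_group /= trmx1 mulmx1.
exact: orthogonal_mul.
Qed.

(* Restrict to loops with the same rotation and append a fixed loop undoing it. *)
Theorem packing_dim_finite_rotations (k : nat) (G : set 'M[R]_n) (s : R)
    (F : set (grassmannian R n k)) :
  (k < n)%N -> finite_set G -> (forall f, LL f -> G (sorth f)) ->
  0 <= s -> (s%:E < hausdorff_dim K)%E ->
  (forall V, F V -> (hausdorff_dim (orthproj (val V) @` K) <= s%:E)%E) ->
  (packing_dim F <= ((k * (n - k))%:R - (k%:R - s))%:E)%E.
Proof.
move=> kn /finite_fsetP[X GX] LG s0 sK FV.
have [a [sa aK]] : exists a : R, s < a /\ (a%:E < hausdorff_dim K)%E.
  move: sK; case: (hausdorff_dim K) => [d| |]; rewrite ?lte_fin// => sd.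
    by exists ((s + d) / 2); rewrite lte_fin; split; lra.
  by exists (s + 1); rewrite ltrDl ltry.
pose a' := (s + a) / 2.
have [sa' aa'] : s < a' /\ a' < a by rewrite /a'; split; lra.
have GXm T : G T -> T \in X by rewrite GX.
have hg (T : 'M[R]_n) : exists g, (exists2 f, LL f & sorth f = T) -> LL g /\ T *m sorth g = 1%:M.
  have [[f Lf fT]|no] := pselect (exists2 f, LL f & sorth f = T); last by exists (0, 0, 0).
  have oT : orthogonal_group T by rewrite -fT; have [] := LK Lf.
  have [|i [j [ij hij]]] := @pigeonhole _ X (fun m => mxpow T m.+1).
    by move=> m; apply: GXm; rewrite -fT -sorth_spow; apply/LG/LL_spow.
  have h1 : mxpow T (j - i) = 1%:M.
    have oi := mxpow_orth i.+1 oT.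
    rewrite -[LHS](orth_mulKV _ oi) -mxpowD addSn subnKC ?(ltnW ij)// -hij.
    exact: oi.
  (* With p = j - i and T^p = 1, this loop has rotation T^(2p-1). The exponent p - 1 could be 0,
     which no loop power provides. *)
  exists (spow f ((j - i).-1 * 2)) => _; split; first exact: LL_spow.
  have ji : (0 < j - i)%N by rewrite subn_gt0.
  rewrite sorth_spow fT -mxpowS (_ : ((j - i).-1 * 2).+2 = (j - i) + (j - i))%N; last by lia.
  by rewrite mxpowD h1 mulmx1.
have /choice[g {}hg] := hg.
have [|c' c'0 hc'] := @exists_pos_lb R _ X
    (fun T => if pselect (exists2 f, LL f & sorth f = T) then srat (g T) else 1).
  by move=> T _; case: pselect => // h; have [/LK[]] := hg _ h.
have [c [delta0 [c0 c1 d0 hW]]] := sepK (ltW (le_lt_trans s0 sa)) aK.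
(* Choosing one rotation loses a factor |X|, and the undoing loop shrinks ratios by [c']. For delta
   <= e the surplus delta^(a-a') pays for both. *)
pose e := ((c' * c) `^ a' / (#|` X|.+1)%:R) `^ (a - a')^-1.
have e0 : 0 < e by rewrite powR_gt0// divr_gt0// powR_gt0// mulr_gt0.
pose delta := Num.min (Num.min delta0 2^-1) e.
have delta_gt0 : 0 < delta by rewrite !lt_min d0 e0 invr_gt0// ltr0n.
have de : delta <= e by rewrite ge_min lexx orbT.
have d2 : delta <= 2^-1 by rewrite !ge_min lexx orbT.
have d1 : delta < 1 by rewrite (le_lt_trans d2)// invf_lt1// ltr1n.
have dd0 : delta <= delta0 by rewrite !ge_min lexx.
have [N [W [hN LW Wr Wk]]] := hW delta delta_gt0 dd0.
have N0 : (0 < N)%N.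
  by rewrite -(ltr0n R) (lt_le_trans _ hN)// powR_gt0.
have WX w : sorth (W w) \in X by apply/GXm/LG.
have [|T hT] := @popular_fiber 'I_N X (fun w => [` WX w]%fset); first by rewrite card_ord.
set S := [set x | _ == T]%SET in hT; rewrite card_ord -cardfE in hT.
pose B := #|S|.
have B0 : (0 < B)%N.
  by rewrite lt0n; apply/eqP => B0; move: hT; rewrite -/B B0 muln0 leqNgt N0.
pose Wb (b : 'I_B) := W (enum_val b).
have WbT b : sorth (Wb b) = val T.
  by have := enum_valP b; rewrite inE => /eqP <-.
have exT : exists2 f, LL f & sorth f = val T by exists (Wb (Ordinal B0)); [exact: LW|rewrite WbT].
have [Lg gT] := hg _ exT.
have cg : c' <= srat (g (val T)).
  by have := hc' _ (valP T); case: pselect.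
have [g0 g1 _ gK] := LK Lg.
pose W' b := scomp (Wb b) (g (val T)).
have hB : 1 <= B%:R * (c' * (c * delta)) `^ a'.
  have h1 : delta `^ (- a) <= (#|` X|.+1)%:R * B%:R.
    by rewrite (le_trans hN)// -natrM ler_nat (leq_trans hT)// leq_mul.
  have h2 : delta `^ (a - a') <= (c' * c) `^ a' / (#|` X|.+1)%:R.
    have := ge0_ler_powR (ltW (ltac:(by rewrite subr_gt0) : 0 < a - a')) _ _ de.
    rewrite !nnegrE (ltW delta_gt0) (ltW e0) => /(_ isT isT)/le_trans; apply.
    rewrite /e -powRrM mulVf ?subr_eq0 ?gt_eqF// powRr1//.
    by rewrite divr_ge0// powR_ge0.
  rewrite mulrA powRM ?mulr_ge0 ?(ltW c'0) ?(ltW c0) ?(ltW delta_gt0)//.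
  move: h2; rewrite ler_pdivlMr// => h2.
  apply: le_trans (ler_wpM2l (ler0n _ _) (ler_wpM2r (powR_ge0 _ _) h2)).
  have E : delta `^ (a - a') * delta `^ a' = delta `^ a.
    by rewrite -powRD ?subrK// (lt0r_neq0 delta_gt0) implybT.
  have -> : B%:R * (delta `^ (a - a') * #|` X|.+1%:R * delta `^ a') = delta `^ a * (#|` X|.+1%:R * B%:R).
    by rewrite -E; ring.
  have := ler_wpM2l (powR_ge0 delta a) h1.
  by rewrite -powRD ?(lt0r_neq0 delta_gt0) ?implybT// subrr powRr0.
have hW' (w w' : 'I_B) : w != w' -> enum_val w != enum_val w'.
  by apply: contra => /eqP/enum_val_inj ->.
apply: (@packing_dim_homothetic_ifs R n K B W' delta (c' * (c * delta)) delta K0 cK B0 delta_gt0 _ d1 _ _ _ _ k a' s F kn hB s0 sa' FV).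
- by rewrite !mulr_gt0.
- by move=> w; apply: simset_comp; apply/LK; [exact: LW|].
- by move=> w; rewrite /W' /sorth /= -/(sorth _) WbT.
- move=> w; have /andP[h1 h2] := Wr (enum_val w); have [w0 _ _ _] := LK (LW (enum_val w)).
  rewrite /W' /srat /= -/(srat _) -/(srat (g (val T))); apply/andP; split.
    rewrite mulrC ler_pM ?mulr_ge0 ?(ltW c0) ?(ltW c'0) ?(ltW delta_gt0)//.
  by rewrite -[leRHS]mulr1 ler_pM ?(ltW w0) ?(ltW g0) ?(ltW g1).
- move=> w w' x y ww Kx Ky; rewrite !sapp_comp; apply: Wk; [exact: hW'|exact: gK..].
Qed.

End SeparatedPieces.

(** * Dense rotation groups *)

Section RotateGr.
Context {R : realType} {n k : nat}.
Implicit Types (S T : 'M[R]_n) (V W : grassmannian R n k).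

Lemma rot_rot (V : {vspace euclid R n}) S T : rot (rot V S) T = rot V (S *m T).
Proof.
apply/vspaceP => x; apply/mem_image_subspace/mem_image_subspace.
  move=> [_ /mem_image_subspace[v vV ->] ->]; exists v => //.
  by rewrite trmx_mul mulmxA.
move=> [v vV ->]; exists (S^T *m v); last by rewrite trmx_mul mulmxA.
by apply/mem_image_subspace; exists v.
Qed.

Lemma dim_rot (V : {vspace euclid R n}) T : orthogonal_group T -> \dim (rot V T) = \dim V.
Proof.
move=> oT; have le (W : {vspace euclid R n}) S : (\dim (rot W S) <= \dim W)%N.
  by rewrite /rot /image_subspace -[leqRHS](limg_ker_dim (linfun (mulmx S^T : 'cV[R]_n -> 'cV[R]_n))) leq_addl.
apply/eqP; rewrite eqn_leq le /=.
have {1}<- : rot (rot V T) T^T = V by rewrite rot_rot (mulmx1C oT) rot_id.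
exact: le.
Qed.

(* The value is [V] itself if [T] is not orthogonal. *)
Definition gr_rot V T : grassmannian R n k := insubd V (rot (val V) T).

Lemma val_gr_rot V T : orthogonal_group T -> val (gr_rot V T) = rot (val V) T.
Proof. by move=> oT; rewrite /gr_rot val_insubd dim_rot// (valP V). Qed.

Lemma gr_rot_rot V S T : orthogonal_group S -> orthogonal_group T ->
  gr_rot (gr_rot V S) T = gr_rot V (S *m T).
Proof.
move=> oS oT; apply/val_inj; rewrite !val_gr_rot//; last exact: orthogonal_mul.
exact: rot_rot.
Qed.

Lemma mdist_gr_rot V W T : orthogonal_group T ->
  mdist (gr_rot V T) (gr_rot W T) <= mdist V W.
Proof.
move=> oT; apply: mdist_Gr_le => [x|]; last exact: mdist_ge0.
rewrite !val_gr_rot// !orthproj_rot// -mulmxBr enorm_orth; last exact: orthogonal_tr.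
by rewrite (le_trans (mdist_Gr_ub _ _ _))// enorm_orth.
Qed.

Definition opclose S T (e : R) : Prop :=
  forall x : euclid R n, enorm (S *m x - T *m x : euclid R n) <= e * enorm x.

Lemma opclose_tr S T e : 0 <= e -> opclose S T e -> opclose S^T T^T e.
Proof.
move=> e0 h x; rewrite -mulmxBl; set A := _ - _; set y : euclid R n := A *m x.
have [->|y0] := eqVneq y 0; first by rewrite enorm0 mulr_ge0// enorm_ge0.
have yp : 0 < enorm y by rewrite lt_def enorm_ge0 andbT; apply: contra y0 => /eqP/enorm_eq0/eqP.
rewrite -(ler_pM2r yp) -expr2 sqr_enorm.
have -> : dotv y y = dotv x (A^T *m y : euclid R n).
  by rewrite !dotv_mulmx {1}/y trmx_mul -mulmxA.
rewrite (le_trans (dotv_le _ _))// [leRHS]mulrAC mulrC ler_wpM2r ?enorm_ge0//.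
have := h y; rewrite -mulmxBl; congr (enorm (_ *m y : euclid R n) <= _).
by rewrite /A linearB /= !trmxK.
Qed.

Lemma mdist_gr_rot_close V S T e : orthogonal_group S -> orthogonal_group T -> 0 <= e ->
  opclose S T e -> mdist (gr_rot V S) (gr_rot V T) <= 2 * e.
Proof.
move=> oS oT e0 h; apply: mdist_Gr_le => [x|]; last by rewrite mulr_ge0.
rewrite !val_gr_rot// !orthproj_rot//.
set u : euclid R n := S *m x; set v : euclid R n := T *m x.
have -> : S^T *m orthproj (val V) u - T^T *m orthproj (val V) v =
    S^T *m orthproj (val V) (u - v) + (S^T *m orthproj (val V) v - T^T *m orthproj (val V) v) :> euclid R n.
  by rewrite orthprojB mulmxBr addrA subrK.
rewrite (le_trans (enormD _ _))// mulrDl mul1r mulrDl lerD//.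
  rewrite enorm_orth; last exact: orthogonal_tr.
  by rewrite (le_trans (enorm_orthproj _ _))//; exact: h.
rewrite (le_trans (opclose_tr e0 h _))// ler_wpM2l// (le_trans (enorm_orthproj _ _))//.
by rewrite enorm_orth.
Qed.

Lemma Gr_net (eta : R) : (0 < n)%N -> 0 < eta ->
  exists E : seq (grassmannian R n k), forall V, exists2 W, W \in E & mdist W V <= eta.
Proof.
move=> n0 eta0; have [C C0 hC] := @Gr_count R n k n0.
pose e := Num.min eta 1; have e0 : 0 < e by rewrite lt_min eta0 ltr01.
have e1 : e <= 1 by rewrite ge_min lexx orbT.
pose u : euclid R n := delta_mx (Ordinal n0) ord0.
have u0 : u != 0.
  by apply/negP => /eqP/matrixP/(_ (Ordinal n0) ord0)/eqP; rewrite !mxE !eqxx /= oner_eq0.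
have [|E [_ _ hE]] := @maximal_separated R _ [set: grassmannian R n k] e
    (C * 1 ^+ k * e^-1 ^+ (k * (n - k))) (ltW e0).
  move=> E sE _; apply: (hC e 1 u) => // V _.
  by rewrite mul1r enorm_orthproj.
by exists E => V; have [W WE h] := hE V I; exists W => //; rewrite (le_trans h)// ge_min lexx.
Qed.

End RotateGr.

Section Recurrence.
Context {R : realType} {n : nat}.
Implicit Types (S T : 'M[R]_n).

Lemma orthogonal_entry T i j : orthogonal_group T -> `|T i j| <= 1.
Proof.
move=> oT; pose u : euclid R n := delta_mx j ord0.
have u1 : enorm u = 1.
  rewrite /enorm (_ : dotv u u = 1) ?sqrtr1// /dotv (bigD1 j)//= big1 ?addr0.
    by rewrite !mxE !eqxx mulr1.
  by move=> l lj; rewrite !mxE (negbTE lj) mul0r.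
have := enorm_coord (T *m u : euclid R n) i; rewrite enorm_orth// u1.
rewrite mxE (bigD1 j)//= big1 ?addr0; first by rewrite !mxE !eqxx mulr1.
by move=> l lj; rewrite !mxE (negbTE lj) mulr0.
Qed.

Lemma opclose_entry S T (h : R) : 0 <= h -> (forall i j, `|S i j - T i j| <= h) ->
  opclose S T (n%:R * (n%:R * h)).
Proof.
move=> h0 ST x; rewrite -mulmxBl -mulrA; apply: enorm_le_coord => i.
rewrite mxE (le_trans (ler_norm_sum _ _ _))//.
rewrite (@le_trans _ _ (\sum_(j < n) h * enorm x))//.
  apply: ler_sum => j _; rewrite normrM ler_pM//; first by rewrite !mxE.
  exact: enorm_coord.
by rewrite sumr_const card_ord -[_ *+ n]mulr_natl mulrA.
Qed.

(** Two powers T^i and T^j share their quantized entries by pigeonhole; T^i is an isometry, so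
    T^(j-i) is close to the identity. *)
Lemma orthogonal_recurrence T (e : R) : orthogonal_group T -> 0 < e ->
  exists p, opclose (mxpow T p.+1) 1%:M e.
Proof.
move=> oT e0; pose m := (Num.truncn (n%:R * (n%:R * 4) / e)).+1.
have mR : 0 < m%:R :> R by rewrite ltr0n.
pose h i := [ffun ab : 'I_n * 'I_n => code m (mxpow T i ab.1 ab.2)].
have [|i [j [ij hij]]] := @pigeonhole _ (enum {: {ffun 'I_n * 'I_n -> 'I_m.+1}}) h.
  by move=> i; rewrite mem_enum.
exists (j - i).-1; rewrite prednK ?subn_gt0// => x.
have oi := mxpow_orth i oT; have oj := mxpow_orth j oT.
have cl : opclose (mxpow T j) (mxpow T i) (n%:R * (n%:R * (4 / m%:R))).
  apply: opclose_entry => [|a b]; first by rewrite divr_ge0.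
  have /(congr1 (fun f : {ffun _ -> _} => f (a, b))) := hij; rewrite !ffunE /= => hab.
  have h1 := codeP (isT : (0 < m)%N) (orthogonal_entry a b oi).
  have h2 := codeP (isT : (0 < m)%N) (orthogonal_entry a b oj).
  rewrite -hab in h2; move: h1 h2; set c := _ - 1.
  have -> : 4 / m%:R = 2 / m%:R + 2 / m%:R :> R by rewrite -mulrDl -natrD.
  move=> h1 h2; rewrite -(subrKA c) (le_trans (ler_normD _ _))// lerD// distrC//.
have := cl x; rewrite -(subnKC (ltnW ij)) mxpowD -mulmxA -mulmxBr enorm_orth// mul1mx.
rewrite subnKC ?(ltnW ij)// => /le_trans; apply; rewrite ler_wpM2r ?enorm_ge0//.
have -> : n%:R * (n%:R * (4 / m%:R)) = n%:R * (n%:R * 4) / m%:R :> R by rewrite !mulrA.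
rewrite ler_pdivrMr// -ler_pdivrMl// mulrC.
exact/ltW/truncnS_gt.
Qed.

Lemma invmx_orth T : orthogonal_group T -> invmx T = T^T.
Proof.
move=> oT; have [uT _] := mulmx1_unit (oT : T^T *m T = 1%:M).
have uT' : T \in unitmx by have [] := mulmx1_unit (oT : T^T *m T = 1%:M).
by rewrite -[RHS]mulmx1 -(mulmxV uT') mulmxA oT mul1mx.
Qed.

Variables (K : set (euclid R n)) (LL : set (sim R n)).
Hypotheses (LK : LL `<=` simset K) (LC : forall f g, LL f -> LL g -> LL (scomp f g)).
Hypothesis L0 : LL !=set0.

(** The inverse of a loop is not a loop, so elements of the generated group are reached only as
    limits of rotations of single loops. *)
Let A : set 'M[R]_n := [set T | orthogonal_group T /\
  forall e : R, 0 < e -> exists2 f, LL f & opclose (sorth f) T e].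

Lemma approx_orth f : LL f -> orthogonal_group (sorth f).
Proof. by move=> /LK[]. Qed.

Lemma approx_gen f : LL f -> A (sorth f).
Proof.
move=> Lf; split=> [|e e0]; first exact: approx_orth.
by exists f => // x; rewrite subrr enorm0 mulr_ge0 ?enorm_ge0// ltW.
Qed.

Lemma approx_mul S T : A S -> A T -> A (S *m T).
Proof.
move=> [oS hS] [oT hT]; split=> [|e e0]; first exact: orthogonal_mul.
have [f Lf fS] := hS _ (divr_gt0 e0 (ltr0Sn _ 1)).
have [g Lg gT] := hT _ (divr_gt0 e0 (ltr0Sn _ 1)).
exists (scomp f g) => [|x]; first exact: LC.
rewrite /sorth /= -/(sorth f) -/(sorth g) -!mulmxA.
have -> : sorth f *m (sorth g *m x) - S *m (T *m x) =
   sorth f *m (sorth g *m x - T *m x) + (sorth f *m (T *m x) - S *m (T *m x)) :> euclid R n.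
  by rewrite mulmxBr addrA subrK.
rewrite (le_trans (enormD _ _))// enorm_orth; last exact: approx_orth.
rewrite [e]splitr mulrDl lerD//.
by rewrite (le_trans (fS _))// enorm_orth.
Qed.

Lemma approx_closed T : orthogonal_group T ->
  (forall e : R, 0 < e -> exists2 S, A S & opclose S T e) -> A T.
Proof.
move=> oT hT; split=> // e e0.
have [S [_ hS] ST] := hT _ (divr_gt0 e0 (ltr0Sn _ 1)).
have [f Lf fS] := hS _ (divr_gt0 e0 (ltr0Sn _ 1)).
exists f => // x; rewrite -(subrKA (S *m x)) (le_trans (enormD _ _))//.
by rewrite [e]splitr mulrDl lerD.
Qed.

Lemma approx_pow T m : A T -> A (mxpow T m.+1).
Proof.
move=> AT; elim: m => [|m IH]; first by rewrite mxpowS mulmx1.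
by rewrite mxpowS; exact: approx_mul.
Qed.

(* Powers of an orthogonal matrix return close to the identity, so the closure of
   the semigroup of rotations is a group. *)
Lemma approx_subgroup : is_orthogonal_subgroup A.
Proof.
split=> [T []//| |S T|T AT]; first 1 last.
- exact: approx_mul.
- have [oT _] := AT; rewrite invmx_orth//; apply: approx_closed; first exact: orthogonal_tr.
  move=> e e0; have [p hp] := orthogonal_recurrence oT (divr_gt0 e0 (ltr0Sn _ 1)).
  (* T^(2p+2) is close to the identity, so T^(2p+1) is close to T^-1. Doubling keeps the exponent
     positive when p = 0. *)
  exists (mxpow T (p + p).+1); first exact: approx_pow.
  have op := mxpow_orth p.+1 oT.
  move=> x; rewrite -(enorm_orth _ oT) mulmxBr.
  have -> : T *m (T^T *m x) = 1%:M *m x by rewrite mulmxA (mulmx1C (oT : T^T *m T = 1%:M)).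
  have -> : T *m (mxpow T (p + p).+1 *m x) = mxpow T p.+1 *m (mxpow T p.+1 *m x).
    have E : T *m mxpow T (p + p).+1 = mxpow T p.+1 *m mxpow T p.+1.
      by rewrite -mxpowD addSn addnS.
    by rewrite [LHS]mulmxA E -[LHS]mulmxA.
  have -> : mxpow T p.+1 *m (mxpow T p.+1 *m x) - 1%:M *m x =
     mxpow T p.+1 *m (mxpow T p.+1 *m x - 1%:M *m x) + (mxpow T p.+1 *m x - 1%:M *m x) :> euclid R n.
    by rewrite mulmxBr mul1mx addrA subrK.
  rewrite (le_trans (enormD _ _))// enorm_orth//.
  by rewrite [e]splitr mulrDl lerD.
- have [f Lf] := L0; apply: approx_closed; first by rewrite /orthogonal_group /= trmx1 mulmx1.
  move=> e e0; have [p hp] := orthogonal_recurrence (approx_orth Lf) e0.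
  by exists (mxpow (sorth f) p.+1) => //; apply/approx_pow/approx_gen.
Qed.

Variable k : nat.
Let G : set 'M[R]_n := smallest is_orthogonal_subgroup [set sorth f | f in LL].

Lemma group_approx T : G T -> A T.
Proof.
move=> GT; apply: GT; split; first exact: approx_subgroup.
by move=> _ [f Lf <-]; exact: approx_gen.
Qed.

Lemma group_subgroup : is_orthogonal_subgroup G.
Proof.
split.
- by move=> T /group_approx[].
- by move=> H [[_ H1 _ _] _].
- move=> S T GS GT H HH; have [[_ _ HM _] _] := HH; apply: HM; [exact: GS|exact: GT].
- move=> T GT H HH; have [[_ _ _ HV] _] := HH; apply: HV; exact: GT.
Qed.

(** V and V0 are close to points of the dense orbit, which a group element T1 T2^T carries into each
    other, and a loop approximates it. Rotations act isometrically, so loops for the pairs of a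
    finite net serve all V and V0. *)
Lemma steering (eta : R) : (0 < n)%N -> has_dense_orbit k G -> 0 < eta ->
  exists U : seq (sim R n), (forall u, u \in U -> LL u) /\
    forall V V0 : grassmannian R n k, exists2 u, u \in U & mdist (gr_rot V (sorth u)) V0 <= eta.
Proof.
move=> n0 [Vs dV] eta0; have [Go G1 GM GV] := group_subgroup.
have near (V : grassmannian R n k) (e : R) : 0 < e -> exists2 T, G T & mdist V (gr_rot Vs T^T) < e.
  move=> e0; have [||W [VW [T GT WT]]] := dV (ball V e).
  - by exists V; exact: ballxx.
  - exact: metric_ball_open.
  exists T; [exact: GT|]; have oT : orthogonal_group T^T by apply/orthogonal_tr/Go.
  have <- : W = gr_rot Vs T^T by apply/val_inj; rewrite val_gr_rot// WT /rot trmxK.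
  by move: VW; rewrite ballEmdist.
have one (V V0 : grassmannian R n k) (e : R) : 0 < e ->
    exists2 u, LL u & mdist (gr_rot V (sorth u)) V0 <= e.
  move=> e0; have e3 : 0 < e / 4 by rewrite divr_gt0.
  have key (a b c d f g : R) : g < e / 4 -> f < e / 4 -> b <= 2 * (e / 4) -> c <= f ->
    d <= c + g -> a <= b + d -> a <= e by lra.
  have [T1 GT1 h1] := near V _ e3; have [T2 GT2 h2] := near V0 _ e3.
  have o1 := Go _ GT1; have o2 := Go _ GT2; have o1' := orthogonal_tr o1; have o2' := orthogonal_tr o2.
  have GT : G (T1 *m T2^T) by apply: GM => //; rewrite -invmx_orth//; exact: GV.
  have oT := Go _ GT.
  have [_ /(_ _ e3)[u Lu uT]] := group_approx GT.
  exists u => //; have ou := approx_orth Lu.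
  have c1 := mdist_gr_rot_close V ou oT (ltW e3) uT.
  have c2 := mdist_gr_rot V (gr_rot Vs T1^T) oT.
  rewrite gr_rot_rot// mulmxA (o1 : T1^T *m T1 = 1%:M) mul1mx in c2.
  rewrite metric_sym in h2.
  exact: key h2 h1 c1 c2 (metric_triangle _ _ _) (metric_triangle _ _ _).
have e3 : 0 < eta / 3 by rewrite divr_gt0.
have key (a b c d f g : R) : g <= eta / 3 -> f <= eta / 3 -> b <= f -> c <= eta / 3 ->
    d <= c + g -> a <= b + d -> a <= eta by lra.
have [E hE] := @Gr_net R n k _ n0 e3.
have /choice[f hf] : forall p : grassmannian R n k * grassmannian R n k, exists u,
    LL u /\ mdist (gr_rot p.1 (sorth u)) p.2 <= eta / 3.
  by move=> p; have [u Lu hu] := one p.1 p.2 _ e3; exists u.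
exists [seq f (V, W) | V <- E, W <- E]; split.
  by move=> _ /allpairsP[[V W] /= [_ _ ->]]; have [] := hf (V, W).
move=> V V0; have [W WE WV] := hE V; have [W0 W0E WV0] := hE V0.
exists (f (W, W0)); first by apply: allpairs_f.
have [Lu hu] := hf (W, W0); have ou := approx_orth Lu; rewrite /= in hu.
rewrite metric_sym in WV; have c := mdist_gr_rot V W ou.
exact: key WV0 WV c hu (metric_triangle _ _ _) (metric_triangle _ _ _).
Qed.

End Recurrence.

Section GridFamily.
Context {R : realType} {n k : nat}.
Hypotheses (n0 : (0 < n)%N) (kn : (k <= n)%N).

Let f : {ffun 'I_k -> 'I_n} := [ffun i => widen_ord kn i].

Lemma widen_inj : injective f.
Proof. by move=> i j; rewrite !ffunE => /(congr1 (@nat_of_ord _)) /= /val_inj. Qed.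

Variable m : nat.
Hypothesis m0 : (0 < m)%N.

Let S : {set {ffun 'I_n -> 'I_m.+1}} :=
  [set c : {ffun 'I_n -> 'I_m.+1} | [forall i, ~~ (i \notin codom f) ==> (c i == ord0)]]%SET.

(** Codes of chart matrices with the identity in the first k rows and grid values elsewhere. Entries
    in identity rows are set to [ord0] so that each matrix has one code. *)
Definition grid : finType := {A : {ffun 'I_k -> {ffun 'I_n -> 'I_m.+1}} | A \in family (fun=> mem S)}.

Lemma card_grid : #|{: grid}| = ((m.+1 ^ (n - k)) ^ k)%N.
Proof.
rewrite card_sig -[LHS]/(#|family (fun=> mem S)|) card_family_prod prod_nat_const card_ord.
by rewrite card_zero_off (card_offcodom widen_inj).
Qed.

Definition grid_mx (A : grid) : 'M[R]_(n, k) :=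
  \matrix_(i, l) (if i \in codom f then (i == f l)%:R else (val A l i : nat)%:R * 2 / m%:R - 1).

Definition grid_space (A : grid) : {vspace euclid R n} :=
  limg (linfun (mulmx (grid_mx A) : 'cV[R]_k -> 'cV[R]_n)).

Lemma dim_grid_space A : \dim (grid_space A) == k.
Proof.
apply/eqP; rewrite /grid_space limg_dim_eq; first by rewrite dimvf /dim /= muln1.
apply/eqP; rewrite -subv0; apply/subvP => c; rewrite memv_cap memvf /= memv_ker lfunE /= => /eqP h.
rewrite memv0; apply/eqP/colP => j.
have /colP/(_ (f j)) := h; rewrite !mxE => <-.
rewrite (bigD1 j)//= big1 ?addr0 => [|i ij]; rewrite !mxE codom_f.
  by rewrite eqxx mul1r.
by rewrite (inj_eq widen_inj) eq_sym (negbTE ij) mul0r.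
Qed.

Definition grid_gr (A : grid) : grassmannian R n k := exist _ (grid_space A) (dim_grid_space A).

Lemma grid_entry A i l : `|grid_mx A i l| <= 1.
Proof.
rewrite mxE; case: ifP => _; first by case: (_ == _); rewrite ?normr1 ?normr0.
have mR : 0 < m%:R :> R by rewrite ltr0n.
have h : (val A l i : nat)%:R <= m%:R :> R by rewrite ler_nat -ltnS.
have h2 : (val A l i : nat)%:R * 2 / m%:R <= 2 :> R.
  by rewrite ler_pdivrMr// mulrC ler_wpM2l.
have h3 : 0 <= (val A l i : nat)%:R * 2 / m%:R :> R by rewrite divr_ge0// mulr_ge0.
by rewrite ler_norml; apply/andP; split; move: (_ / m%:R) h2 h3 => *; lra.
Qed.

Lemma grid_colcode A (u : euclid R n) (rho : R) l : 0 <= rho ->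
  enorm (orthproj (grid_space A) u) <= rho * enorm u ->
  val A l \in colcode f m u (n%:R * rho) l.
Proof.
move=> rho0 h; rewrite inE; apply/andP; split.
  have /familyP/(_ l) := valP A; rewrite inE => /forallP hA.
  by apply/forallP => i; have := hA i; rewrite negbK.
apply/asboolP; exists (col l (grid_mx A)); split.
- move=> i hi; rewrite !mxE (negbTE hi) subrr normr0 divr_ge0//.
- by move=> i hi; rewrite !mxE hi.
set v : euclid R n := col l _.
have vV : v \in grid_space A.
  apply/memv_imgP; exists (delta_mx l ord0); first exact: memvf.
  by rewrite lfunE /= -colE.
rewrite -(dotv_orthproj u vV) (le_trans (dotv_norm _ _))//.
have nv : enorm v <= n%:R.
  rewrite -[leRHS]mulr1; apply: enorm_le_coord => i; rewrite mxE; exact: grid_entry.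
rewrite (le_trans (ler_pM (enorm_ge0 _) (enorm_ge0 _) h nv))// le_eqVlt; apply/orP; left; apply/eqP; ring.
Qed.

End GridFamily.

(** Only an estimate against every vector u is required of the family, with a constant independent
    of the mesh. The grid points of a single chart satisfy it by [code_count]. *)
Lemma grid_family (R : realType) (n k : nat) : (0 < n)%N -> (k <= n)%N ->
  exists2 C : R, 0 < C & forall m, (0 < m)%N ->
    exists (I : finType) (V : I -> grassmannian R n k), (0 < #|I|)%N /\
    forall (u : euclid R n) (rho : R), u != 0 -> m%:R^-1 <= rho ->
      #|[set i | (enorm (orthproj (val (V i)) u) <= rho * enorm u)%R]%SET|%:R <= C * rho ^+ k * #|I|%:R.
Proof.
move=> n0 kn; have [C C0 hC] := @code_count R n k n0.
exists ((C * n%:R) ^+ k); first by rewrite exprn_gt0// mulr_gt0// ltr0n.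
move=> m m0; exists (grid kn m), (@grid_gr R n k kn m).
rewrite card_grid; split; first by rewrite !expn_gt0.
move=> u rho u0 hrho; have rho0 : 0 <= rho by rewrite (le_trans _ hrho)// invr_ge0.
have hrho' : m%:R^-1 <= n%:R * rho by rewrite (le_trans hrho)// ler_peMl// ler1n.
have := hC _ m u _ (@widen_inj n k kn) m0 u0 hrho'.
rewrite mulrA exprMn; apply: le_trans; rewrite ler_nat -card_family_prod.
rewrite -(card_imset _ val_inj); apply: subset_leq_card; apply/fintype.subsetP => _ /imsetP[A + ->].
rewrite inE => hA; apply/familyP => l; exact: grid_colcode.
Qed.

Section WeightedTuran.
Context {R : realFieldType} {T : finType}.
Variables (e : rel T) (t : T -> R).
Hypotheses (er : reflexive e) (es : symmetric e) (t0 : forall w, 0 <= t w).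

Let deg (D : {set T}) w := #|[set w' in D | e w w']%SET|.

(* Pick a vertex maximizing t / deg and delete its closed neighbourhood. *)
Lemma weighted_turan_in (D : {set T}) : exists S : {set T},
  [/\ S \subset D, forall w w', w \in S -> w' \in S -> w != w' -> ~~ e w w' &
    \sum_(w in D) t w / (deg D w)%:R <= \sum_(w in S) t w].
Proof.
have [m] := ubnP #|D|; elim: m D => // m IH D; rewrite ltnS => Dm.
have [->|[w1 w1D]] := set_0Vmem D.
  exists finset.set0; split=> [|w w'|]; rewrite ?sub0set ?inE//.
  by rewrite !big_set0.
pose w0 := [arg max_(w > w1 in D) (t w / (deg D w)%:R)]%O.
have [w0D hw0] : w0 \in D /\ forall w, w \in D -> t w / (deg D w)%:R <= t w0 / (deg D w0)%:R.
  by rewrite /w0; case: arg_maxP => // w wD h; split.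
pose D' := [set w in D | ~~ e w0 w]%SET.
have D'D : D' \subset D by apply/fintype.subsetP => w; rewrite inE => /andP[].
have D'm : (#|D'| < m)%N.
  apply: leq_trans Dm; apply: proper_card; apply/properP; split=> //.
  by exists w0 => //; rewrite inE w0D er.
have [S' [S'D S'i S't]] := IH _ D'm.
have w0S' : w0 \notin S'.
  by apply/negP => /(fintype.subsetP S'D); rewrite inE er andbF.
have nS' w : w \in S' -> ~~ e w0 w by move=> /(fintype.subsetP S'D); rewrite inE => /andP[].
exists (w0 |: S')%SET; split.
- by rewrite finset.subUset finset.sub1set w0D (fintype.subset_trans S'D).
- move=> w w'; rewrite !inE => /predU1P[->|wS] /predU1P[->|wS'] ww'; rewrite ?eqxx// in ww' *.
  + exact: nS'.
  + by rewrite es; exact: nS'.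
  + exact: S'i.
rewrite big_setU1//= (bigID (e w0))/= lerD//.
  rewrite (@le_trans _ _ (\sum_(w in D | e w0 w) t w0 / (deg D w0)%:R))//.
    by apply: ler_sum => w /andP[wD _]; exact: hw0.
  have d0 : (0 < deg D w0)%N by apply/card_gt0P; exists w0; rewrite inE w0D er.
  rewrite sumr_const -[_ *+ _]mulr_natl (_ : #|_| = deg D w0); last first.
    by apply: eq_card => w; rewrite !inE.
  by rewrite mulrC divfK// pnatr_eq0 -lt0n.
apply: le_trans S't; rewrite (eq_bigl (mem D')); last by move=> w; rewrite !inE.
apply: ler_sum => w wD''; have wD' : w \in D' := wD''; rewrite ler_wpM2l//.
have d0 : (0 < deg D' w)%N by apply/card_gt0P; exists w; rewrite inE wD' er.
have dd : (deg D' w <= deg D w)%N.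
  apply: subset_leq_card; apply/fintype.subsetP => w'; rewrite !inE => /andP[/andP[-> _] ->//].
by rewrite lef_pV2 ?posrE ?ltr0n// ?ler_nat// (leq_trans d0).
Qed.

Lemma weighted_turan : exists S : {set T},
  (forall w w', w \in S -> w' \in S -> w != w' -> ~~ e w w') /\
  \sum_w t w / #|[set w' | e w w']%SET|%:R <= \sum_(w in S) t w.
Proof.
have [S [_ h1 h2]] := weighted_turan_in [set: T]%SET.
exists S; split=> //; apply: le_trans h2; rewrite le_eqVlt; apply/orP; left; apply/eqP.
rewrite [RHS](eq_bigl xpredT); last by move=> w; rewrite inE.
apply: eq_bigr => w _; congr (_ / _%:R).
by apply: eq_card => w'; rewrite !inE.
Qed.

End WeightedTuran.

Section Jensen.
Context {R : realType}.

Lemma expR_mean (N : nat) (a : 'I_N -> R) : (0 < N)%N ->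
  expR (N%:R^-1 * \sum_w a w) <= N%:R^-1 * \sum_w expR (a w).
Proof.
move=> N0; have NR : 0 < N%:R :> R by rewrite ltr0n.
set m := N%:R^-1 * _; rewrite ler_pdivlMl//.
rewrite (@le_trans _ _ (\sum_w expR m * (1 + (a w - m))))//; last first.
  apply: ler_sum => w _; rewrite -[in leRHS](subrK m (a w)) expRD mulrC.
  by rewrite ler_wpM2r ?expR_ge0// expR_ge1Dx.
rewrite -mulr_sumr big_split /= sumr_const card_ord sumrB sumr_const card_ord.
have -> : \sum_i a i = N%:R * m by rewrite /m mulrA mulfV ?mul1r// gt_eqF.
by rewrite -[m *+ N]mulr_natl subrr addr0 mulrC.
Qed.

Lemma ln_mean (I : finType) (y : I -> R) (Q : R) : (0 < #|I|)%N -> 0 < Q ->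
  (forall i, 0 < y i) -> \sum_i y i <= #|I|%:R * Q -> \sum_i ln (y i) <= #|I|%:R * ln Q.
Proof.
move=> I0 Q0 y0 yQ.
rewrite (@le_trans _ _ (\sum_i (ln Q + (y i / Q - 1))))//.
  apply: ler_sum => i _; rewrite -lerBlDl -ln_div ?posrE//.
  have := @le_ln1Dx R (y i / Q - 1); rewrite addrCA subrr addr0; apply.
  by rewrite ltrBDl subrr divr_gt0.
rewrite big_split /= sumr_const sumrB sumr_const -mulr_suml -[ln Q *+ _]mulr_natl gerDl subr_le0.
by rewrite ler_pdivrMr.
Qed.

End Jensen.

Section Words.
Context {R : realType} {n : nat}.
Variables (K : set (euclid R n)) (N : nat) (L : 'I_N -> sim R n) (rmin rmax : R).
Hypotheses (LK : forall w, simset K (L w)) (Lr : forall w, rmin <= srat (L w) <= rmax) (rmin0 : 0 < rmin).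

Definition sim1 : sim R n := (1, 1%:M, 0).

Fixpoint wsim l : wtype N l -> sim R n :=
  if l is l'.+1 then fun p => scomp (L p.1) (wsim p.2) else fun=> sim1.

Lemma sapp1 x : sapp sim1 x = x.
Proof. by rewrite /sapp /srat /sorth /= mul1mx scale1r addr0. Qed.

Lemma wsimP l (c : wtype N l) : [/\ orthogonal_group (sorth (wsim c)),
  rmin ^+ l <= srat (wsim c), srat (wsim c) <= rmax ^+ l & forall x, K x -> K (sapp (wsim c) x)].
Proof.
elim: l c => [c|l IH [w c]] /=.
  split; rewrite /srat /sorth /=; rewrite ?expr0//; last by move=> x; rewrite sapp1.
  by rewrite /orthogonal_group /= trmx1 mulmx1.
have [h1 h2 h3 h4] := IH c; have [w0 w1 wo wK] := LK w; have /andP[r1 r2] := Lr w.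
have c0 : 0 <= srat (wsim c) by rewrite (le_trans _ h2)// exprn_ge0// ltW.
split.
- exact: orthogonal_mul.
- by rewrite exprS [leRHS]/(srat (L w) * srat (wsim c)) ler_pM// ?exprn_ge0// ltW.
- by rewrite exprS [leLHS]/(srat (L w) * srat (wsim c)) ler_pM// ltW.
- by move=> x Kx; rewrite sapp_comp; apply/wK/h4.
Qed.

End Words.

(** * Entropy of projected pieces *)

Section Entropy.
Context {R : realType} {n k : nat}.
Variables (K : set (euclid R n)) (N : nat) (L : 'I_N -> sim R n) (rmin rmax Delta : R).
Hypotheses (N0 : (0 < N)%N) (rmin0 : 0 < rmin) (Delta0 : 0 < Delta).
Hypotheses (LK : forall w, simset K (L w)) (Lr : forall w, rmin <= srat (L w) <= rmax).
Variable x : 'I_N -> euclid R n.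
Hypothesis Lx : forall w y, K y -> enorm (sapp (L w) y - x w) <= Delta / 2.
Implicit Types (V W : grassmannian R n k) (T : 'M[R]_n).

Definition nb (thr : R) V w : nat :=
  #|[set w' | (enorm (orthproj (val V) (x w - x w')) <= thr)%R]%SET|.

(** An entropy at resolution [thr] of the projection to V of the uniform distribution on the points
    [x w]. *)
Definition ent thr V : R := N%:R^-1 * \sum_w ln (N%:R / (nb thr V w)%:R).

(** The expected total entropy along a random word of length l, where every letter pulls the
    subspace back. *)
Fixpoint went thr l V : R :=
  if l is l'.+1 then ent thr V + N%:R^-1 * \sum_w went thr l' (gr_rot V (sorth (L w))) else 0.

Lemma nb_gt0 thr V w : 0 <= thr -> (0 < nb thr V w)%N.
Proof. by move=> t0; apply/card_gt0P; exists w; rewrite inE subrr -(scale0r 0) orthprojZ scale0r enorm0. Qed.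

Let NR : 0 < N%:R :> R. Proof. by rewrite ltr0n. Qed.

(* Rotations are isometries, so [V] and [W] stay close along every word and only
   the threshold has to be adjusted. *)
Lemma went_close thr thr' eta l V W : 0 <= thr ->
  (forall w w', eta * enorm (x w - x w') + thr <= thr') -> mdist V W <= eta ->
  went thr' l V <= went thr l W.
Proof.
move=> t0 h; have t0' : 0 <= eta -> 0 <= thr'.
  move=> eta0; apply: le_trans (h (Ordinal N0) (Ordinal N0)).
  by rewrite addr_ge0// mulr_ge0 ?enorm_ge0.
elim: l V W => //= l IH V W VW; have {}t0' := t0' (le_trans (mdist_ge0 _ _) VW).
rewrite lerD//; rewrite ler_wpM2l ?invr_ge0 ?ler0n//; apply: ler_sum => w _; last first.
  apply: IH; apply: le_trans VW; apply: mdist_gr_rot; by have [] := LK w.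
have hn : (nb thr W w <= nb thr' V w)%N.
  apply: subset_leq_card; apply/fintype.subsetP => w'; rewrite !inE => hw.
  set u := x w - x w' in hw *.
  have -> : orthproj (val V) u = (orthproj (val V) u - orthproj (val W) u) + orthproj (val W) u.
    by rewrite subrK.
  rewrite (le_trans (enormD _ _))// (le_trans _ (h w w'))// lerD//.
  by rewrite (le_trans (mdist_Gr_ub _ _ _))// ler_wpM2r// enorm_ge0.
rewrite ler_ln ?posrE ?divr_gt0 ?ltr0n ?nb_gt0// ler_wpM2l// lef_pV2 ?posrE ?ltr0n ?nb_gt0//.
by rewrite ler_nat.
Qed.

(** At each letter [weighted_turan], weighted by the numbers of continuations, keeps pieces whose
    representatives project more than 2 Delta apart. The pieces lie within Delta / 2 of these, so
    their projections stay Delta apart. Jensen's inequality turns the weighted sum into the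
    exponential of a mean. *)
Lemma went_words l V : exists C : {set wtype N l},
  expR (went (2 * Delta) l V) <= #|C|%:R /\
  forall c c' y y', c \in C -> c' \in C -> c != c' -> K y -> K y' ->
    Delta * rmin ^+ l <= enorm (orthproj (val V) (sapp (wsim L c) y - sapp (wsim L c') y')).
Proof.
have r1 : rmin < 1.
  by have [_ h _ _] := LK (Ordinal N0); have /andP[h1 _] := Lr (Ordinal N0); rewrite (le_lt_trans h1).
elim: l V => [|l IH] V.
  exists [set: unit]%SET; rewrite expR0 cardsT card_unit; split=> //.
have /choice[C hC] := fun w => IH (gr_rot V (sorth (L w))).
pose e (w w' : 'I_N) := enorm (orthproj (val V) (x w - x w')) <= 2 * Delta.
have er : reflexive e.
  by move=> w; rewrite /e subrr -(scale0r 0) orthprojZ scale0r enorm0 mulr_ge0// ltW.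
have es : symmetric e by move=> w w'; rewrite /e orthprojB enormB -orthprojB.
have [S [Si St]] := weighted_turan er es (fun w => ler0n R #|C w|).
exists [set p : wtype N l.+1 | (p.1 \in S) && (p.2 \in C p.1)]%SET; split.
  have -> : #|[set p : wtype N l.+1 | (p.1 \in S) && (p.2 \in C p.1)]%SET| = (\sum_(w in S) #|C w|)%N.
    rewrite -sum1_card (eq_bigl (fun p : 'I_N * wtype N l => (p.1 \in S) && (p.2 \in C p.1))); last first.
      by move=> p; rewrite inE.
    rewrite -(pair_big_dep (mem S) (fun w c => c \in C w) (fun _ _ => 1%N))/=.
    by apply: eq_bigr => w _; rewrite sum1_card.
  rewrite natr_sum; apply: le_trans St.
  rewrite /= /ent -mulrDr -big_split /= (le_trans (expR_mean _ N0))//.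
  rewrite mulr_sumr; apply: ler_sum => w _.
  have nb0 : 0 < (nb (2 * Delta) V w)%:R :> R by rewrite ltr0n nb_gt0// mulr_ge0// ltW.
  rewrite expRD lnK ?posrE ?divr_gt0// !mulrA mulVf ?gt_eqF// mul1r mulrC.
  by rewrite ler_wpM2r ?invr_ge0 ?(ltW nb0)//; exact: (hC w).1.
move=> [w c] [w' c'] y y'; rewrite !inE /= => /andP[wS cC] /andP[w'S c'C] cc' Ky Ky'.
have [w0 w1 wo _] := LK w; have /andP[rw _] := Lr w.
rewrite !sapp_comp; have [ww|ww] := eqVneq w w'.
  subst w'; rewrite enorm_proj_sappB// gtr0_norm// exprSr mulrA mulrC ler_pM ?(ltW rmin0)//.
    by rewrite mulr_ge0 ?(ltW Delta0)// exprn_ge0// ltW.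
  rewrite -val_gr_rot//; apply: (hC w).2 => //.
  by apply: contra cc' => /eqP ->.
have := Si _ _ wS w'S ww; rewrite /e -ltNge => h.
have [_ _ _ cK] := wsimP LK Lr rmin0 c; have [_ _ _ cK'] := wsimP LK Lr rmin0 c'.
set a := sapp (L w) _; set b := sapp (L w') _.
have ha : enorm (a - x w) <= Delta / 2 by apply/Lx/cK.
have hb : enorm (b - x w') <= Delta / 2 by apply/Lx/cK'.
have : enorm (orthproj (val V) (x w - x w')) <= enorm (orthproj (val V) (a - b)) + Delta.
  have E (p q u v : euclid R n) : p - q = (u - v) - ((u - p) - (v - q)).
    by apply/matrixP => i j; rewrite !mxE; ring.
  rewrite (E (x w) (x w') a b).
  rewrite orthprojB (le_trans (enormD _ _))// enormN lerD2l (le_trans (enorm_orthproj _ _))//.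
  rewrite (le_trans (enormD _ _))// enormN [leRHS]splitr lerD//.
have : Delta * rmin ^+ l.+1 <= Delta.
  by rewrite ler_piMr ?(ltW Delta0)// exprn_ile1 ?(ltW rmin0)// ltW.
move: h; move: (enorm (orthproj _ (a - b))) (enorm _) (Delta * _) => *; lra.
Qed.

(* The bound on collisions holds for every rotation of the finite family [V],
   which therefore plays the role of the invariant measure on the Grassmannian. *)
Lemma went_average (I : finType) (V : I -> grassmannian R n k) (Q : R) :
  (0 < #|I|)%N -> 0 < Q ->
  (forall T w, orthogonal_group T ->
     \sum_i (nb (3 * Delta) (gr_rot (V i) T) w)%:R <= #|I|%:R * Q) ->
  forall l T, orthogonal_group T ->
    #|I|%:R * (l%:R * ln (N%:R / Q)) <= \sum_i went (3 * Delta) l (gr_rot (V i) T).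
Proof.
move=> I0 Q0 hQ; elim=> [|l IH] T oT; first by rewrite mul0r mulr0 big1.
rewrite /= big_split /= -natr1 mulrDl mul1r mulrDr [leLHS]addrC lerD//.
  rewrite /ent -mulr_sumr exchange_big /= ler_pdivlMl//.
  rewrite (@le_trans _ _ (\sum_(w < N) #|I|%:R * ln (N%:R / Q)))//.
    by rewrite sumr_const card_ord -[leRHS]mulr_natl.
  apply: ler_sum => w _.
  have nb0 i : 0 < (nb (3 * Delta) (gr_rot (V i) T) w)%:R :> R.
    by rewrite ltr0n nb_gt0// mulr_ge0// ltW.
  rewrite ln_div ?posrE// mulrBr.
  under eq_bigr do rewrite ln_div ?posrE//.
  rewrite sumrB sumr_const -[ln N%:R *+ _]mulr_natl lerD2l lerN2.
  by apply: ln_mean => //; exact: hQ.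
rewrite -mulr_sumr exchange_big /= ler_pdivlMl//.
rewrite (@le_trans _ _ (\sum_(w < N) #|I|%:R * (l%:R * ln (N%:R / Q))))//.
  by rewrite sumr_const card_ord -[leRHS]mulr_natl.
apply: ler_sum => w _; have [_ _ ow _] := LK w.
under eq_bigr do rewrite gr_rot_rot//.
by apply: IH; exact: orthogonal_mul.
Qed.

End Entropy.

Lemma powR_expr (R : realType) (x a : R) (l : nat) : 0 <= x -> (x ^+ l) `^ a = (x `^ a) ^+ l.
Proof.
move=> x0; elim: l => [|l IH]; first by rewrite !expr0 powR1.
by rewrite !exprS powRM ?exprn_ge0// IH.
Qed.

Lemma expr_unbounded (R : realType) (x c : R) : 1 < x -> exists l : nat, c <= x ^+ l.
Proof.
move=> x1; have x0 : 0 < x by rewrite (lt_trans ltr01).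
have c0 : 0 < `|c| + 1 by rewrite ltr_wpDl.
have ci : 0 < (`|c| + 1)^-1 by rewrite invr_gt0.
have /cvgr0Pnorm_lt/(_ _ ci)[l _ hl] := cvg_expr (z := x^-1)
  ltac:(by rewrite gtr0_norm ?invr_gt0// invf_lt1).
exists l; have := hl l (leqnn l); rewrite /= ger0_norm ?exprn_ge0 ?invr_ge0 ?(ltW x0)//.
rewrite exprVn ltf_pV2 ?posrE ?exprn_gt0// => /ltW.
by apply: le_trans; rewrite (le_trans (ler_norm c))// lerDl.
Qed.

Lemma srat_wsim_le1 (R : realType) (n : nat) (K : set (euclid R n)) (N : nat)
    (L : 'I_N -> sim R n) : (forall w, simset K (L w)) ->
  forall l (c : wtype N l), 0 <= srat (wsim L c) <= 1.
Proof.
move=> LK; elim=> [|l IH] c; first by rewrite /srat /= ler01 lexx.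
have [w0 w1 _ _] := LK c.1; have /andP[c0 c1] := IH c.2.
by rewrite /srat /= -!/(srat _) mulr_ge0 ?(ltW w0)// mulr_ile1 ?(ltW w0) ?(ltW w1).
Qed.

Section Potential.
Context {R : realType} {n : nat}.
Variables (K : set (euclid R n)) (N : nat) (L : 'I_N -> sim R n) (rmin rmax delta sigma : R).
Variable x0 : euclid R n.
Hypotheses (LK : forall w, simset K (L w)) (Lr : forall w, rmin <= srat (L w) <= rmax).
Hypotheses (rmin0 : 0 < rmin) (delta0 : 0 < delta) (sigma0 : 0 <= sigma) (Kx0 : K x0).
Hypothesis Lsep : forall w w' x y, w != w' -> K x -> K y ->
  delta <= enorm (sapp (L w) x - sapp (L w') y).
Hypothesis Nr : 1 <= N%:R * rmin `^ sigma.

Let pt l (c : wtype N l) : euclid R n := sapp (wsim L c) x0.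

Lemma words_gt0 l (c c' : wtype N l) : c != c' -> 0 < enorm (pt c - pt c').
Proof.
elim: l c c' => [[] []//|l IH] [w c] [w' c'] cc'.
have [w0 w1 wo _] := LK w.
rewrite /pt /= !sapp_comp; have [ww|ww] := eqVneq w w'.
  subst w'; rewrite enorm_sappB// mulr_gt0 ?normr_gt0 ?gt_eqF//; apply: IH.
  by apply: contra cc' => /eqP ->.
apply: lt_le_trans delta0 _; apply: Lsep => //.
  by have [_ _ _] := wsimP LK Lr rmin0 c; apply.
by have [_ _ _] := wsimP LK Lr rmin0 c'; apply.
Qed.

(** A Riesz potential. Words with another first letter are at distance at least delta. Those with
    the same first letter form a copy scaled by at least rmin, and rmin^-sigma <= N. So each of the
    l levels contributes at most N^l delta^-sigma. *)
Lemma word_potential l (c : wtype N l) :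
  \sum_(c' | c' != c) enorm (pt c - pt c') `^ (- sigma) <=
    l%:R * (N ^ l)%N%:R * delta `^ (- sigma).
Proof.
elim: l c => [[]|l IH [w c]]; first by rewrite !mul0r big1// => -[].
have [w0 w1 wo _] := LK w; have /andP[wr _] := Lr w.
rewrite (bigID (fun p : wtype N l.+1 => p.1 == w))/= -natr1 !mulrDl mul1r lerD//.
  rewrite (reindex_onto (fun d => (w, d) : wtype N l.+1) (fun p => p.2))/=; last first.
    by move=> [w' d] /= /andP[_ /eqP ->].
  rewrite (eq_bigl (fun d => d != c)); last first.
    by move=> d; rewrite xpair_eqE !eqxx /= !andbT.
  apply: (@le_trans _ _ (\sum_(d : wtype N l | d != c) rmin `^ (- sigma) * enorm (@pt l c - @pt l d) `^ (- sigma))).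
    apply: ler_sum => d dc; rewrite /pt /= !sapp_comp enorm_sappB// gtr0_norm//.
    rewrite powRM ?enorm_ge0 ?(ltW w0)// ler_wpM2r ?powR_ge0// !powRN lef_pV2 ?posrE ?powR_gt0//.
    by rewrite ge0_ler_powR// nnegrE ltW.
  rewrite -mulr_sumr (le_trans (ler_wpM2l (powR_ge0 _ _) (IH c)))//.
  rewrite expnS natrM !mulrA ler_wpM2r ?powR_ge0// ler_wpM2r// mulrC ler_wpM2l//.
  by rewrite powRN -[leLHS]mul1r ler_pdivrMr ?powR_gt0.
rewrite (@le_trans _ _ (\sum_(p : wtype N l.+1) delta `^ (- sigma)))//; last first.
  by rewrite sumr_const (card_wtype N l.+1) -[leLHS]mulr_natl.
rewrite [leLHS]big_mkcond; apply: ler_sum => -[w' d] _ /=.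
case: ifP => [/andP[_ ww]|_]; last exact: powR_ge0.
rewrite !powRN lef_pV2 ?posrE ?powR_gt0//.
  rewrite ge0_ler_powR// ?nnegrE ?enorm_ge0 ?(ltW delta0)//.
  rewrite /pt /= !sapp_comp; apply: Lsep; first by rewrite eq_sym.
    by have [_ _ _] := wsimP LK Lr rmin0 c; apply.
  by have [_ _ _] := wsimP LK Lr rmin0 d; apply.
by apply: words_gt0; rewrite xpair_eqE negb_and eq_sym ww.
Qed.

End Potential.

Section BlockDim.
Context {R : realType} {n k : nat}.
Variables (K : set (euclid R n)) (LL : set (sim R n)).
Variables (N : nat) (L : 'I_N -> sim R n) (rmin rmax Delta : R).
Hypotheses (n0 : (0 < n)%N) (K0 : K !=set0) (cK : compact K) (LLK : LL `<=` simset K).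
Hypotheses (LC : forall f g, LL f -> LL g -> LL (scomp f g)) (L0 : LL !=set0).
Hypotheses (N0 : (0 < N)%N) (rmin0 : 0 < rmin) (Delta0 : 0 < Delta).
Hypotheses (LK : forall w, simset K (L w)) (Lr : forall w, rmin <= srat (L w) <= rmax).
Variable x : 'I_N -> euclid R n.
Hypothesis Lx : forall w y, K y -> enorm (sapp (L w) y - x w) <= Delta / 2.

(* This uses min(1, C y^k) <= (C + 1) y^sigma for sigma <= k. *)
Lemma nb_sum_le (C sigma : R) (m : nat) (I : finType) (V : I -> grassmannian R n k) T w :
  0 <= C -> 0 <= sigma -> sigma <= k%:R -> orthogonal_group T ->
  (forall w', enorm (x w - x w') <= m%:R * (3 * Delta)) ->
  (forall w', w' != w -> 0 < enorm (x w - x w')) ->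
  (forall (u : euclid R n) (rho : R), u != 0 -> m%:R^-1 <= rho ->
     #|[set i | (enorm (orthproj (val (V i)) u) <= rho * enorm u)%R]%SET|%:R <= C * rho ^+ k * #|I|%:R) ->
  \sum_i (nb x (3 * Delta) (gr_rot (V i) T) w)%:R <=
    #|I|%:R * (1 + (C + 1) * (3 * Delta) `^ sigma * \sum_(w' | w' != w) enorm (x w - x w') `^ (- sigma)).
Proof.
move=> C0 s0 sk oT hm hpos hV.
have D30 : 0 < 3 * Delta by rewrite mulr_gt0.
pose E i w' := enorm (orthproj (val (V i)) (T *m (x w - x w') : euclid R n)) <= 3 * Delta.
have -> : \sum_i (nb x (3 * Delta) (gr_rot (V i) T) w)%:R = \sum_w' #|[set i | E i w']%SET|%:R :> R.
  rewrite -!natr_sum; congr _%:R.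
  rewrite (eq_bigr (fun i => \sum_w' (E i w' : nat))%N) => [|i _]; last first.
    rewrite /nb -sum1_card big_mkcond; apply: eq_bigr => w' _.
    by rewrite inE val_gr_rot// enorm_orthproj_rot// /E; case: (_ <= _).
  rewrite exchange_big; apply: eq_bigr => w' _.
  by rewrite -sum1_card [RHS]big_mkcond; apply: eq_bigr => i _; rewrite inE; case: (E _ _).
rewrite (bigD1 w)//= mulrDr mulr1 lerD ?ler_nat ?max_card//.
rewrite -mulrA mulr_sumr !mulrA mulr_sumr; apply: ler_sum => w' ww.
set u : euclid R n := T *m (x w - x w').
have nu : enorm u = enorm (x w - x w') by rewrite /u enorm_orth.
have d0 := hpos _ ww; have dm := hm w'; set d := enorm (x w - x w') in nu d0 dm *.
have -> : #|I|%:R * (C + 1) * ((3 * Delta) `^ sigma * d `^ (- sigma)) = #|I|%:R * ((C + 1) * (3 * Delta / d) `^ sigma).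
  rewrite [in RHS]powRM ?invr_ge0 ?(ltW d0) ?(ltW D30)// -[d^-1]powR_inv1 ?(ltW d0)// -powRrM mulN1r.
  by rewrite !mulrA.
have rho0 : 0 < 3 * Delta / d by rewrite divr_gt0.
have [h|h] := leP 1 (3 * Delta / d).
  rewrite -[leLHS]mulr1 ler_pM ?ler_nat ?max_card// -[leLHS]mulr1 ler_pM//; first by rewrite lerDr.
  have p1 : (1 : R) `^ sigma = 1 by rewrite powR1.
  by rewrite -[leLHS]p1 ge0_ler_powR// nnegrE ltW.
have u0 : u != 0.
  by apply: contraTneq d0 => u0; rewrite -nu u0 enorm0 ltxx.
have m0 : 0 < m%:R :> R.
  by rewrite ltr0n lt0n; apply/eqP => m0; move: dm; rewrite m0 mul0r leNgt d0.
have hr : m%:R^-1 <= 3 * Delta / d.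
  by rewrite ler_pdivlMr// ler_pdivrMl.
have := hV u _ u0 hr; rewrite nu divfK ?gt_eqF// => {}hV.
rewrite (le_trans hV)// mulrC ler_wpM2l// ler_pM ?exprn_ge0 ?(ltW rho0)//; first by rewrite lerDl.
by rewrite -powR_mulrn ?(ltW rho0)// ger_powR// rho0 ltW.
Qed.

Let G : set 'M[R]_n := smallest is_orthogonal_subgroup [set sorth f | f in LL].

(* A single steering loop leads from any [V] to a subspace with large entropy; its
   cost does not depend on the length of the words that follow. *)
Lemma block_dim (I : finType) (Vg : I -> grassmannian R n k) (D Q lam : R) :
  (0 < #|I|)%N -> 0 < Q -> 0 < D -> 0 <= lam -> has_dense_orbit k G ->
  (forall w w', enorm (x w - x w') <= D) ->
  (forall T w, orthogonal_group T ->
     \sum_i (nb x (3 * Delta) (gr_rot (Vg i) T) w)%:R <= #|I|%:R * Q) ->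
  Q < N%:R * rmin `^ lam ->
  forall V : grassmannian R n k, (lam%:E <= hausdorff_dim (orthproj (val V) @` K))%E.
Proof.
move=> I0 Q0 D0 lam0 hG hD hQ QN V.
have NR : 0 < N%:R :> R by rewrite ltr0n.
(* Moving V by Delta / D moves the projected differences of representatives by at most Delta, which
   is the step from the threshold 3 Delta to 2 Delta. *)
have eta0 : 0 < Delta / D by rewrite divr_gt0.
have [U [UL hU]] := steering LLK LC L0 n0 hG eta0.
have [|cu cu0 hcu] := @exists_pos_lb R _ U (@srat R n).
  by move=> u /UL/LLK[].
have rmin1 : rmin < 1.
  by have [_ h _ _] := LK (Ordinal N0); have /andP[h1 _] := Lr (Ordinal N0); rewrite (le_lt_trans h1).
have cu1 : cu < 1.
  by have [u uU _] := hU V V; rewrite (le_lt_trans (hcu _ uU))//; have /UL/LLK[] := uU.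
pose q := N%:R / Q; have q0 : 0 < q by rewrite divr_gt0.
have qr : 1 < q * rmin `^ lam by rewrite /q mulrAC ltr_pdivlMr// mul1r.
have q1 : 1 <= q.
  apply: le_trans (ltW qr) _; rewrite ler_piMr ?(ltW q0)//.
  have p1 : (1 : R) `^ lam = 1 by rewrite powR1.
  by rewrite -[leRHS]p1 ge0_ler_powR// ?nnegrE ?(ltW rmin0)// ltW.
(* The word length is chosen so that the gain beats the contraction [cu] of the steering loop and a
   factor 2 for rounding q^l down. *)
have [l hl] : exists l : nat, 2 * (cu `^ lam)^-1 <= (q * rmin `^ lam) ^+ l by exact: expr_unbounded.
have ql : expR (l%:R * ln q) = q ^+ l by rewrite -powR_mulrn ?(ltW q0)// /powR gt_eqF.
pose B := Num.truncn (q ^+ l).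
have /andP[B1 B2] := truncn_itv (exprn_ge0 l (ltW q0)); rewrite -/B in B1 B2.
have B0 : (0 < B)%N.
  by rewrite /B truncn_gt0 exprn_ege1.
have Bq : q ^+ l / 2 <= B%:R.
  rewrite ler_pdivrMr// (le_trans (ltW B2))// mulr_natr mulr2n -natrD ler_nat.
  by rewrite -addn1 leq_add2l.
pose r := cu * rmin ^+ l.
have r0 : 0 < r by rewrite mulr_gt0// exprn_gt0.
have r1 : r < 1.
  by rewrite /r (le_lt_trans _ cu1)// ler_piMr ?(ltW cu0)// exprn_ile1 ?(ltW rmin0)// ltW.
have key (W : grassmannian R n k) : exists u, u \in U /\ exists f : 'I_B -> wtype N l, injective f /\
   forall c c' y y', c != c' -> K y -> K y' -> Delta * rmin ^+ l <=
     enorm (orthproj (rot (val W) (sorth u)) (sapp (wsim L (f c)) y - sapp (wsim L (f c')) y')).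
  have o1 : orthogonal_group (1%:M : 'M[R]_n) by rewrite /orthogonal_group /= trmx1 mulmx1.
  have avg := went_average N0 Delta0 LK I0 Q0 hQ l o1.
  have [i hi] : exists i, l%:R * ln q <= went L x (3 * Delta) l (gr_rot (Vg i) 1%:M).
    apply: contrapT => no; move: avg; apply/negP; rewrite -ltNge.
    have [i0 _] := card_gt0P I0.
    rewrite (@lt_le_trans _ _ (\sum_(i : I) l%:R * ln q))//; last first.
      by rewrite sumr_const -[leLHS]mulr_natl.
    apply: ltr_sum => [|i _]; first by apply/hasP; exists i0; rewrite ?mem_index_enum.
    by rewrite ltNge; apply/negP => h; apply: no; exists i.
  have [u uU hu] := hU W (gr_rot (Vg i) 1%:M).
  exists u; split=> //.
  have [_ _ ou _] := LLK (UL _ uU).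
  have cl : went L x (3 * Delta) l (gr_rot (Vg i) 1%:M) <= went L x (2 * Delta) l (gr_rot W (sorth u)).
    apply: (@went_close _ _ _ K N L N0 LK x _ _ (Delta / D)).
    - by rewrite mulr_ge0// ltW.
    - move=> w w'; have : Delta / D * enorm (x w - x w') <= Delta.
        by rewrite mulrAC ler_pdivrMr// ler_wpM2l// ltW.
      move=> h; rewrite (_ : 3 * Delta = Delta + 2 * Delta) ?lerD2r//.
      by rewrite -[X in X + _]mul1r -mulrDl; congr (_ * _); rewrite (natrD _ 1 2).
    - by rewrite metric_sym.
  have [C [C1 C2]] := went_words N0 rmin0 Delta0 LK Lr Lx l (gr_rot W (sorth u)).
  have BC : (B <= #|C|)%N.
    rewrite -(ler_nat R) (le_trans B1)// -ql (le_trans _ C1)// ler_expR.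
    exact: le_trans hi cl.
  exists (fun c => enum_val (widen_ord BC c)); split.
    by move=> c c' /enum_val_inj /(congr1 val) /= /val_inj.
  move=> c c' y y' cc' Ky Ky'; rewrite -val_gr_rot//; apply: C2 => //; try exact: enum_valP.
  by apply: contra cc' => /eqP/enum_val_inj/(congr1 val)/= /val_inj ->.
have hr1 : 1 <= B%:R * r `^ lam.
  have rl : r `^ lam = cu `^ lam * (rmin `^ lam) ^+ l.
    rewrite /r powRM ?(ltW cu0) ?exprn_ge0 ?(ltW rmin0)//; congr (_ * _).
    by rewrite powR_expr// ltW.
  rewrite rl (le_trans _ (ler_wpM2r _ Bq))//; last first.
    by rewrite mulr_ge0 ?exprn_ge0 ?powR_ge0.
  have := ler_wpM2l (powR_ge0 cu lam) hl; rewrite mulrCA divff ?gt_eqF ?powR_gt0// mulr1 => h.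
  have -> : q ^+ l / 2 * (cu `^ lam * (rmin `^ lam) ^+ l) = (cu `^ lam * (q * rmin `^ lam) ^+ l) / 2.
    rewrite [X in _ = _ * X / 2]exprMn; move: (q ^+ l) ((rmin `^ lam) ^+ l) (cu `^ lam) => a1 a2 a3; ring.
  by rewrite ler_pdivlMr// mul1r.
have kap0 : 0 < cu * (Delta * rmin ^+ l) by rewrite !mulr_gt0// exprn_gt0.
apply: (@cantor_dim R n K [set val W | W in [set: grassmannian R n k]] B r (cu * (Delta * rmin ^+ l)) lam) => //.
move=> _ [W _ <-]; have [u [uU [f [finj hf]]]] := key W.
have [u0 u1 uo uK] := LLK (UL _ uU).
exists (fun c => scomp u (wsim L (f c))).
have ws c := wsimP LK Lr rmin0 (f c).
split.
- move=> c; have [h1 h2 h3 h4] := ws c.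
  have w0 : 0 < srat (wsim L (f c)) by rewrite (lt_le_trans _ h2)// exprn_gt0.
  split.
  + by rewrite /srat /= mulr_gt0.
  + rewrite /srat /= -/(srat u) -/(srat (wsim L (f c))) (le_lt_trans _ u1)//.
    by rewrite ler_piMr ?(ltW u0)//; have /andP[] := srat_wsim_le1 LK (f c).
  + exact: orthogonal_mul.
  + by move=> y Ky; rewrite sapp_comp; apply/uK/h4.
- move=> c; have [h1 h2 h3 h4] := ws c.
  by rewrite /r [leRHS]/(srat u * srat (wsim L (f c))) ler_pM ?(ltW cu0) ?exprn_ge0 ?(ltW rmin0)//; exact: hcu.
- move=> c; have [h1 _ _ _] := ws c.
  exists (gr_rot W (sorth (scomp u (wsim L (f c))))) => //.
  by rewrite val_gr_rot//; exact: orthogonal_mul.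
- move=> c c' y y' cc' Ky Ky'; rewrite !sapp_comp enorm_proj_sappB// gtr0_norm//.
  rewrite ler_pM ?(ltW cu0) ?mulr_ge0 ?exprn_ge0 ?(ltW rmin0) ?(ltW Delta0)//.
    exact: hcu.
  exact: hf.
Qed.

End BlockDim.

Lemma powR_root_le (R : realType) (d e u : R) : 0 <= d -> 0 < u -> 0 < e ->
  d <= u `^ e^-1 -> d `^ e <= u.
Proof.
move=> d0 u0 e0 h; apply: (@le_trans _ _ ((u `^ e^-1) `^ e)).
  by rewrite ge0_ler_powR ?(ltW e0)// nnegrE powR_ge0.
by rewrite -powRrM mulVf ?gt_eqF// powRr1// ltW.
Qed.

Section DenseRotations.
Context {R : realType} {n k : nat}.
Variables (K : set (euclid R n)) (LL : set (sim R n)).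
Hypotheses (n0 : (0 < n)%N) (kn : (k <= n)%N).
Hypotheses (K0 : K !=set0) (cK : compact K) (LLK : LL `<=` simset K).
Hypotheses (LC : forall f g, LL f -> LL g -> LL (scomp f g)).
Hypothesis sepK : separated_pieces K LL.

Let G : set 'M[R]_n := smallest is_orthogonal_subgroup [set sorth f | f in LL].

(** The collision bound grows linearly in the number l of levels, whereas a suitable delta gains a
    factor 4 per level. *)
Lemma exp4_dominates (C1 : R) : exists2 l : nat, (0 < l)%N & 1 + C1 * l%:R < 4 ^+ l.
Proof.
have [l0 hl0] := @expr_unbounded R 2 (`|C1| + 2) (ltr1n R 2).
exists l0.+1 => //; set l := l0.+1.
have h1 : `|C1| + 2 <= 2 ^+ l by rewrite (le_trans hl0)// ler_eXn2l ?ltr1n.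
have h2 : l%:R + 1 <= 2 ^+ l :> R by rewrite natr1 -natrX ler_nat ltn_expl.
have -> : 4 ^+ l = 2 ^+ l * 2 ^+ l :> R by rewrite -exprMn; congr (_ ^+ _); rewrite -natrM.
have h3 : (`|C1| + 2) * (l%:R + 1) <= 2 ^+ l * 2 ^+ l.
  by rewrite ler_pM// addr_ge0.
apply: lt_le_trans h3.
have : C1 * l%:R <= `|C1| * l%:R by rewrite ler_wpM2r// ler_norm.
have : 0 <= `|C1| by [].
have : 0 <= l%:R :> R by [].
have -> : (`|C1| + 2) * (l%:R + 1) = `|C1| * l%:R + `|C1| + 2 * l%:R + 2 by ring.
move: (`|C1|) (l%:R) (`|C1| * l%:R) (C1 * l%:R) => *; lra.
Qed.

Theorem dense_rotations_dim (s : R) : has_dense_orbit k G ->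
  0 <= s -> s < k%:R -> (s%:E < hausdorff_dim K)%E ->
  forall V : grassmannian R n k, (s%:E < hausdorff_dim (orthproj (val V) @` K))%E.
Proof.
move=> hG s0 sk sK V.
have [a [sa ak aK]] : exists a : R, [/\ s < a, a < k%:R & (a%:E < hausdorff_dim K)%E].
  move: sK; case: (hausdorff_dim K) => [d| |]; rewrite ?lte_fin// => sd.
    exists ((s + Num.min d k%:R) / 2); rewrite lte_fin.
    have h1 : s < Num.min d k%:R by rewrite lt_min sd.
    have h2 : Num.min d k%:R <= d by rewrite ge_min lexx.
    have h3 : Num.min d k%:R <= k%:R by rewrite ge_min lexx orbT.
    by move: (Num.min _ _) h1 h2 h3 => m *; split; lra.
  by exists ((s + k%:R) / 2); rewrite ltry; split=> //; lra.
(* [a] governs the number of pieces, [sigma] the Riesz potential (it has to be at most k) and [lam]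
   the dimension of the projections. *)
pose lam := (2 * s + a) / 3; pose sigma := (s + 2 * a) / 3.
have [slam lamsig siga] : [/\ s < lam, lam < sigma & sigma < a].
  by rewrite /lam /sigma; split; lra.
have lam0 : 0 < lam by exact: le_lt_trans slam.
have sigma0 : 0 < sigma by exact: lt_trans lamsig.
apply: (@lt_le_trans _ _ lam%:E); first by rewrite lte_fin.
have [C C0 hC] := @grid_family R n k n0 kn.
have [D D0 hD] := compact_enorm cK.
have [x0 Kx0] := K0.
have [c [delta0 [c0 c1 d0 hW]]] := sepK (ltW (le_lt_trans s0 sa)) aK.
(* delta <= e1 gives N0 rho^sigma >= 1 with rho = c delta, as the potential estimate needs; delta <=
   e2 gives delta^sigma <= rho^lam / 4, the gain of 4 per level. *)
pose e1 := (c `^ sigma) `^ (a - sigma)^-1; pose e2 := (c `^ lam / 4) `^ (sigma - lam)^-1.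
have e10 : 0 < e1 by rewrite !powR_gt0.
have e20 : 0 < e2 by rewrite powR_gt0// divr_gt0// powR_gt0.
pose delta := Num.min (Num.min delta0 2^-1) (Num.min e1 e2).
have delta_gt0 : 0 < delta by rewrite !lt_min d0 e10 e20 invr_gt0// ltr0n.
have d2 : delta <= 2^-1 by rewrite !ge_min lexx orbT.
have d1 : delta < 1 by rewrite (le_lt_trans d2)// invf_lt1// ltr1n.
have dd0 : delta <= delta0 by rewrite !ge_min lexx.
have de1 : delta <= e1 by rewrite !ge_min lexx !orbT.
have de2 : delta <= e2 by rewrite !ge_min lexx !orbT.
clearbody delta.
have h1 : delta `^ (a - sigma) <= c `^ sigma.
  by apply: powR_root_le; rewrite ?(ltW delta_gt0) ?powR_gt0// subr_gt0.
have h2 : delta `^ (sigma - lam) <= c `^ lam / 4.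
  by apply: powR_root_le; rewrite ?(ltW delta_gt0) ?divr_gt0 ?powR_gt0// subr_gt0.
have [N0 [L0 [hN LL0 Lr Lk]]] := hW delta delta_gt0 dd0.
pose rho := c * delta; have rho0 : 0 < rho by exact: mulr_gt0.
have dneq : delta != 0 by rewrite gt_eqF.
have Nrho : 1 <= N0%:R * rho `^ sigma.
  rewrite /rho powRM ?(ltW c0) ?(ltW delta_gt0)//.
  apply: (@le_trans _ _ (delta `^ (- a) * (delta `^ (a - sigma) * delta `^ sigma))).
    by rewrite -!powRD ?dneq ?implybT// subrK addNr powRr0.
  by rewrite ler_pM ?powR_ge0 ?mulr_ge0 ?powR_ge0// ler_wpM2r// powR_ge0.
have N00 : (0 < N0)%N by rewrite -(ltr0n R) (lt_le_trans _ hN)// powR_gt0.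
have q4 : delta `^ sigma <= rho `^ lam / 4.
  rewrite /rho powRM ?(ltW c0) ?(ltW delta_gt0)//.
  rewrite (_ : delta `^ sigma = delta `^ (sigma - lam) * delta `^ lam); last first.
    by rewrite -powRD ?subrK// dneq implybT.
  by rewrite [leRHS]mulrAC ler_wpM2r// powR_ge0.
(* [C1] contains a negative power of delta, so a single level need not suffice. With delta fixed,
   words of length l overcome it. *)
pose C1 := (C + 1) * (12 * D) `^ sigma * delta `^ (- sigma).
have C10 : 0 <= C1 by rewrite !mulr_ge0 ?powR_ge0// addr_ge0// ltW.
have [l l0 hl] := exp4_dominates C1.
have L0K w : simset K (L0 w) by apply/LLK/LL0.
pose N := #|{: wtype N0 l}|.
pose L (i : 'I_N) := wsim L0 (enum_val i).
(* Every piece lies within 2 D delta^l = Delta / 2 of its representative. *)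
pose Delta := 4 * D * delta ^+ l.
pose x i := sapp (L i) x0.
have Delta0 : 0 < Delta by rewrite !mulr_gt0// exprn_gt0.
have NE : N = (N0 ^ l)%N by rewrite /N card_wtype.
have Npos : (0 < N)%N by rewrite NE expn_gt0 N00.
have wP (i : 'I_N) := wsimP L0K Lr rho0 (enum_val i : wtype N0 l).
have LL1 i : LL (L i).
  suff H : forall l' (d : wtype N0 l'.+1), LL (wsim L0 d).
    by rewrite /L; case: (l) l0 (enum_val i) => // l' _ d; exact: H.
  elim=> [|l' IH] [w d] /=; last by apply: LC; [exact: LL0|exact: IH].
  have -> : scomp (L0 w) (sim1 (R := R) (n := n)) = L0 w.
    case: (L0 w) => -[r T] b; rewrite /scomp /sim1 /srat /sorth /=.
    by rewrite mulr1 mulmx1 mulmx0 scaler0 add0r.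
  exact: LL0.
have LK i : simset K (L i) by exact/LLK/LL1.
have Lr' i : rho ^+ l <= srat (L i) <= delta ^+ l.
  by have [_ ha hb _] := wP i; rewrite ha hb.
have Lx w y : K y -> enorm (sapp (L w) y - x w) <= Delta / 2.
  move=> Ky; have [w0 _ wo _] := LK w; have /andP[_ wr] := Lr' w.
  rewrite /x enorm_sappB// gtr0_norm//.
  have -> : Delta / 2 = delta ^+ l * (2 * D) by rewrite /Delta; field.
  rewrite ler_pM ?enorm_ge0 ?(ltW w0)// (le_trans (enormD _ _))// enormN.
  by rewrite mulrDl mul1r lerD// hD.
have xK w : K (x w) by have [_ _ _] := LK w; apply.
have xD w w' : enorm (x w - x w') <= 2 * D.
  by rewrite (le_trans (enormD _ _))// enormN mulrDl mul1r lerD// hD.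
(* Representatives are at distance d <= 2 D, so every ratio 3 Delta / d that occurs is at least 1/m,
   the range of the grid estimate. *)
pose m := (Num.truncn (2 * D / (3 * Delta))).+1.
have [I [Vg [I0 hI]]] := hC m isT.
pose Q := 1 + (C + 1) * (3 * Delta) `^ sigma * (l%:R * N%:R * delta `^ (- sigma)).
have Q0 : 0 < Q.
  rewrite ltr_wpDr// !mulr_ge0 ?powR_ge0// addr_ge0// ltW//.
apply: (@block_dim R n k K LL N L (rho ^+ l) (delta ^+ l) Delta n0 K0 cK LLK LC _ Npos
  (exprn_gt0 l rho0) Delta0 LK Lr' x Lx I Vg (2 * D) Q lam I0 Q0 _ (ltW lam0) hG xD).
- by exists (L (Ordinal Npos)).
- by rewrite mulr_gt0.
- move=> T w oT.
  have := @nb_sum_le R n k N Delta Delta0 x C sigma m I Vg T w (ltW C0) (ltW sigma0) (ltW (lt_trans siga ak)) oT.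
  move=> /(_ _ _ hI) h; apply: le_trans (h _ _) _.
  + move=> w'; rewrite (le_trans (xD _ _))// -ler_pdivrMr; last by rewrite mulr_gt0.
    exact/ltW/truncnS_gt.
  + move=> w' ww; apply: (words_gt0 L0K Lr rho0 delta_gt0 Kx0 Lk).
    by apply: contra ww => /eqP/enum_val_inj ->.
  rewrite ler_wpM2l// /Q lerD2l ler_wpM2l//; first by rewrite mulr_ge0 ?powR_ge0// addr_ge0// ltW.
  have := word_potential L0K Lr rho0 delta_gt0 (ltW sigma0) Kx0 Lk Nrho (enum_val w : wtype N0 l).
  rewrite -card_wtype; apply: le_trans.
  rewrite [leRHS](reindex (fun i : 'I_N => enum_val i : wtype N0 l)) /=; last first.
    exact: onW_bij (enum_val_bij _).
  rewrite le_eqVlt; apply/orP; left; apply/eqP; apply: eq_bigl => w'.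
  by rewrite (inj_eq enum_val_inj).
have NR : 0 < N%:R :> R by rewrite ltr0n.
have h3 : (3 * Delta) `^ sigma = (12 * D) `^ sigma * (delta `^ sigma) ^+ l.
  rewrite -powR_expr ?(ltW delta_gt0)// -powRM ?mulr_ge0 ?exprn_ge0 ?(ltW D0) ?(ltW delta_gt0)//.
  by congr (_ `^ _); rewrite /Delta; ring.
have h4 : 1 <= N%:R * (delta `^ sigma) ^+ l.
  rewrite NE natrX -exprMn exprn_ege1// (le_trans Nrho)// ler_wpM2l//.
  rewrite ge0_ler_powR ?(ltW sigma0) ?nnegrE ?(ltW rho0) ?(ltW delta_gt0)//.
  by rewrite /rho ler_piMl// ltW.
rewrite powR_expr ?(ltW rho0)//.
apply: (@le_lt_trans _ _ ((1 + C1 * l%:R) * (N%:R * (delta `^ sigma) ^+ l))).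
  rewrite /Q h3 [leRHS]mulrDl mul1r lerD// /C1 le_eqVlt; apply/orP; left; apply/eqP; ring.
apply: (@lt_le_trans _ _ (4 ^+ l * (N%:R * (delta `^ sigma) ^+ l))).
  by rewrite ltr_pM2r// (lt_le_trans ltr01).
rewrite mulrCA ler_wpM2l// -exprMn lerXn2r ?nnegrE ?mulr_ge0 ?powR_ge0//.
by rewrite mulrC -ler_pdivlMr.
Qed.

End DenseRotations.

(** * Graph-directed sets *)

Section GraphPieces.
Context {R : realType} {n : nat} (S : graph_directed_ifs R n).
Variable F : 'I_(gd_size S) -> set (euclid R n).
Hypotheses (tr : gd_transitive S) (FA : gd_attractor F).
Implicit Types (e : gd_edge S) (i j : 'I_(gd_size S)) (p q : seq (gd_edge S)).

Lemma scompA (f g h : sim R n) : scomp f (scomp g h) = scomp (scomp f g) h.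
Proof.
rewrite /scomp /srat /sorth /= mulrA mulmxA; congr (_, _, _).
by rewrite mulmxDr scalerDr addrA -mulmxA -scalemxAr scalerA.
Qed.

Lemma scomp1 (f : sim R n) : scomp (sim1 (R := R) (n := n)) f = f.
Proof.
by case: f => -[r T] b; rewrite /scomp /sim1 /srat /sorth /= mul1r !mul1mx scale1r addr0.
Qed.

Definition path_sim p : sim R n :=
  foldr (fun e f => scomp (gd_ratio e, gd_orth e, gd_transl e) f) (sim1 (R := R) (n := n)) p.

Lemma path_sim_cat p q : path_sim (p ++ q) = scomp (path_sim p) (path_sim q).
Proof. by elim: p => [|e p IH] /=; rewrite ?scomp1// IH scompA. Qed.

Lemma sorth_path_sim p : sorth (path_sim p) = gd_path_orth p.
Proof.
rewrite /gd_path_orth; elim: p => [|e p IH]; first by rewrite big_nil.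
by rewrite big_cons -IH.
Qed.

Lemma sapp_path_sim_cons e p x : sapp (path_sim (e :: p)) x = gd_map e (sapp (path_sim p) x).
Proof. by rewrite /= sapp_comp. Qed.

Lemma gd_path_cons i j e p : gd_path i j (e :: p) =
  (gd_src e == i) && (if p is [::] then gd_tgt e == j else gd_path (gd_tgt e) j p).
Proof.
by case: p => [|f p] //=; rewrite -!andbA; congr (_ && _); rewrite eq_sym.
Qed.

Lemma gd_path_cat i j l p q : gd_path i j p -> gd_path j l q -> gd_path i l (p ++ q).
Proof.
elim: p i => // e p IH i; rewrite cat_cons !gd_path_cons => /andP[-> /=].
case: p IH => [_ /eqP ->|f p IH h1 h2]; first by case: q.
exact: IH h1 h2.
Qed.

Lemma path_sim_ratio p : 0 < srat (path_sim p) /\ (p != [::] -> srat (path_sim p) < 1).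
Proof.
elim: p => [|e p [IH0 IH1]]; first by rewrite /srat /=.
have /andP[r0 r1] := gd_ratioP e.
have -> : srat (path_sim (e :: p)) = gd_ratio e * srat (path_sim p) by [].
split=> [|_]; first exact: mulr_gt0.
case: p IH0 IH1 => [_ _|f p IH0 /(_ isT) IH1]; first by rewrite /srat /= mulr1.
by rewrite mulr_ilt1// ltW.
Qed.

Lemma orthogonal1 : orthogonal_group (1%:M : 'M[R]_n).
Proof. by rewrite /orthogonal_group /= trmx1 mulmx1. Qed.

Lemma path_sim_orth p : orthogonal_group (sorth (path_sim p)).
Proof.
elim: p => [|e p IH]; first exact: orthogonal1.
by apply: orthogonal_mul => //; exact: gd_orthP.
Qed.

Lemma gd_map_attractor e x : F (gd_tgt e) x -> F (gd_src e) (gd_map e x).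
Proof.
move=> Fx; have [_ ->] := FA; exists (gd_tgt e) => //; exists e => //; by exists x.
Qed.

Lemma path_sim_attractor i j p x : gd_path i j p -> F j x -> F i (sapp (path_sim p) x).
Proof.
elim: p i => // e p IH i; rewrite gd_path_cons sapp_path_sim_cons => /andP[/eqP <-].
case: p IH => [_ /eqP <- Fx|f p IH h Fx]; first by rewrite /= sapp1; exact: gd_map_attractor.
by apply: gd_map_attractor; exact: IH.
Qed.

Definition loops i : set (sim R n) := [set path_sim p | p in [set p | gd_path i i p]].

Lemma loops_simset i : loops i `<=` simset (F i).
Proof.
move=> _ [p pi <-]; have [r0 r1] := path_sim_ratio p; split=> //.
- by apply: r1; case: (p) pi.
- exact: path_sim_orth.
- by move=> x; exact: path_sim_attractor.
Qed.

Lemma loops_comp i f g : loops i f -> loops i g -> loops i (scomp f g).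
Proof.
move=> [p pi <-] [q qi <-]; exists (p ++ q); last exact: path_sim_cat.
exact: gd_path_cat pi qi.
Qed.

Lemma loops_group i :
  smallest (@is_orthogonal_subgroup R n) [set sorth f | f in loops i] = gd_transformation_group i.
Proof.
rewrite /gd_transformation_group; congr smallest; apply/seteqP; split.
  by move=> _ [_ [p pi <-] <-]; exists p => //; rewrite sorth_path_sim.
by move=> _ [p pi <-]; exists (path_sim p); [exists p|rewrite sorth_path_sim].
Qed.

(** The address of x is followed until the ratio first drops to delta or below; the last edge
    overshoots by a factor of at least amin. The induction is on t with amax^t <= delta. *)
Lemma address (amin amax : R) : (forall e, amin <= gd_ratio e <= amax) -> 0 < amin -> amax < 1 ->
  forall delta i x, 0 < delta -> delta < 1 -> F i x ->
  exists j p y, [/\ gd_path i j p, F j y, x = sapp (path_sim p) y &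
    amin * delta <= srat (path_sim p) <= delta].
Proof.
move=> ar a0 a1 delta i x d0 d1 Fx.
have amax0 : 0 <= amax.
  move: Fx; have [_ ->] := FA => -[j _ [e _ _]]; have /andP[h1 h2] := ar e.
  by rewrite (le_trans (ltW a0))// (le_trans h1).
have [t ht] : exists t : nat, amax ^+ t <= delta.
  have /cvgr0Pnorm_lt/(_ _ d0)[t _ ht] := cvg_expr (z := amax) ltac:(by rewrite ger0_norm).
  by exists t; have := ht t (leqnn t); rewrite /= ger0_norm ?exprn_ge0// => /ltW.
elim: t delta i x d0 d1 Fx ht => [|t IH] delta i x d0 d1 Fx ht.
  by move: ht; rewrite expr0 leNgt d1.
move: Fx; have [_ ->] := FA => -[j _ [e [ei ej] [y Fy xy]]].
have /andP[re1 re2] := ar e; have re0 : 0 < gd_ratio e by rewrite (lt_le_trans a0).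
have [h|h] := leP (gd_ratio e) delta.
  exists j, [:: e], y; split=> //.
  - by rewrite gd_path_cons ei ej !eqxx.
  - by rewrite sapp_path_sim_cons sapp1 xy.
  - by rewrite /srat /= mulr1 h andbT (le_trans _ re1)// ler_piMr// ltW.
have [|||j' [p [z [pp Fz yz /andP[h1 h2]]]]] := IH (delta / gd_ratio e) j y _ _ Fy.
- by rewrite divr_gt0.
- by rewrite ltr_pdivrMr// mul1r.
- rewrite ler_pdivlMr// (le_trans _ ht)// exprSr ler_wpM2l// exprn_ge0//.
exists j', (e :: p), z; split=> //.
- by rewrite gd_path_cons ei eqxx ej /=; case: (p) pp.
- by rewrite sapp_path_sim_cons -yz xy.
have -> : srat (path_sim (e :: p)) = gd_ratio e * srat (path_sim p) by [].
apply/andP; split.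
  by rewrite [leRHS]mulrC -ler_pdivrMr// -mulrA.
by rewrite mulrC -ler_pdivlMr//.
Qed.

(** A maximal separated set in [F i] is large, since it is also a cover. The addresses of its points
    are cut at scale delta and closed to loops by fixed return paths, which change ratios only by a
    bounded factor. *)
Lemma loops_separated i : separated_pieces (F i) (loops i).
Proof.
move=> a a0 aK.
have [|amin amin0 hmin] := @exists_pos_lb R _ (enum (gd_edge S)) (@gd_ratio R n S).
  by move=> e _; have /andP[] := gd_ratioP e.
have [|b b0 hb] := @exists_pos_lb R _ (enum (gd_edge S)) (fun e => 1 - gd_ratio e).
  by move=> e _; rewrite subr_gt0; have /andP[] := gd_ratioP e.
have ar e : amin <= gd_ratio e <= 1 - b.
  by rewrite hmin ?mem_enum//= lerBrDl -lerBrDr hb// mem_enum.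
have b1 : 1 - b < 1 by rewrite gtrBl.
have /choice[q hq] := fun j => tr j i.
have [|cmin cmin0 hc] := @exists_pos_lb R _ (enum 'I_(gd_size S)) (fun j => srat (path_sim (q j))).
  by move=> j _; have [] := path_sim_ratio (q j).
have /choice[Dj hDj] : forall j, exists D : R, 0 < D /\ forall x, F j x -> enorm x <= D.
  by move=> j; have [/(_ j)[_ cF] _] := FA; have [D D0 hD] := compact_enorm cF; exists D.
pose D := 2 * \sum_j Dj j.
have Dj0 j : 0 <= Dj j by rewrite ltW//; have [] := hDj j.
have D0 : 0 <= D by rewrite mulr_ge0// sumr_ge0.
have hD j x y : F j x -> F j y -> enorm (x - y) <= D.
  move=> Fx Fy; rewrite (le_trans (enormD _ _))// enormN /D mulrDl mul1r.
  have h z : F j z -> enorm z <= \sum_j Dj j.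
    by move=> Fz; rewrite (le_trans ((hDj j).2 _ Fz))// (bigD1 j)//= lerDl sumr_ge0.
  by rewrite lerD// h.
(* Each piece lies within D delta of its point, so points M delta apart give pieces delta apart. *)
pose M := 2 * D + 1; have M0 : 0 < M by rewrite ltr_wpDl// mulr_ge0.
(* Cheap covers at arbitrarily small scales would give dim <= a by [hausdorff_dim_le_cover]. *)
have [eps [eps0 heps]] : exists eps : R, 0 < eps /\ forall delta, 0 < delta -> delta <= eps ->
    forall cs : seq (euclid R n), (forall x, F i x -> exists2 y, y \in cs & mdist y x <= delta) ->
    M `^ a < (size cs)%:R * delta `^ a.
  apply: contrapT => no; move: aK; apply/negP; rewrite -leNgt.
  apply: (@hausdorff_dim_le_cover _ _ _ _ (M `^ a)) => //; first exact: powR_ge0.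
  move=> eps eps0; apply: contrapT => no2; apply: no; exists eps; split=> // delta d0 de cs hcs.
  rewrite ltNge; apply/negP => h; apply: no2; exists delta; split=> //.
  by exists cs.
exists (Num.min 1 (amin * cmin)), (Num.min (eps / M) 2^-1); split.
- by rewrite lt_min ltr01 mulr_gt0.
- by rewrite ge_min lexx.
- by rewrite lt_min divr_gt0// invr_gt0 ltr0n.
move=> delta d0; rewrite le_min => /andP[dM d2].
have d1 : delta < 1 by rewrite (le_lt_trans d2)// invf_lt1// ltr1n.
have [E [sE EF NE]] : exists E : seq (euclid R n), [/\ separated (M * delta) E,
    forall x, x \in E -> F i x & delta `^ (- a) <= (size E)%:R].
  apply: contrapT => no.
  have [||E [sE EF cE]] := @maximal_separated R _ (F i) (M * delta) (delta `^ (- a)).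
  - by rewrite mulr_ge0 ?(ltW M0)// ltW.
  - move=> E sE EF; rewrite leNgt; apply/negP => h; apply: no; exists E; split=> //.
    exact: ltW.
  apply: no; exists E; split=> //.
  have hM : M * delta <= eps by rewrite mulrC -ler_pdivlMr.
  have := heps _ (mulr_gt0 M0 d0) hM E cE.
  rewrite powRM ?(ltW M0) ?(ltW d0)// mulrCA -[X in X < _]mulr1 ltr_pM2l ?powR_gt0// => h.
  by rewrite powRN -[leLHS]mul1r ler_pdivrMr ?powR_gt0// ltW.
have Fw (w : 'I_(size E)) : F i (nth 0 E w) by apply/EF/mem_nth.
have /choice[W hW] : forall w : 'I_(size E), exists f : sim R n, [/\ loops i f,
    Num.min 1 (amin * cmin) * delta <= srat f <= delta &
    forall x, F i x -> enorm (sapp f x - nth 0 E w) <= D * delta].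
  move=> w; have [j [p [y [pp Fy xy /andP[h1 h2]]]]] := address ar amin0 b1 d0 d1 (Fw w).
  have [q0 q1] := path_sim_ratio (q j).
  have qn : q j != [::] by have := hq j; case: (q j).
  exists (path_sim (p ++ q j)); split.
  - by exists (p ++ q j) => //; exact: gd_path_cat pp (hq j).
  - have [p0 _] := path_sim_ratio p.
    rewrite path_sim_cat /srat /= -!/(srat _); apply/andP; split.
      rewrite (@le_trans _ _ ((amin * delta) * cmin))//.
        by rewrite mulrAC ler_wpM2r ?(ltW d0)// ge_min lexx orbT.
      by rewrite ler_pM ?mulr_ge0 ?(ltW amin0) ?(ltW d0) ?(ltW cmin0)//; apply: hc; rewrite mem_enum.
    by rewrite -[leRHS]mulr1 ler_pM ?(ltW p0) ?(ltW q0)//; exact/ltW/q1.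
  - move=> x Fx; rewrite path_sim_cat sapp_comp xy enorm_sappB; last exact: path_sim_orth.
    have [p0 _] := path_sim_ratio p; rewrite gtr0_norm// mulrC ler_pM ?enorm_ge0 ?(ltW p0)//.
    apply: hD Fy; exact: path_sim_attractor (hq j) Fx.
exists (size E), W; split=> //.
- by move=> w; have [] := hW w.
- by move=> w; have [] := hW w.
move=> w w' x y ww Fx Fy.
have [_ _ h1] := hW w; have [_ _ h2] := hW w'.
have {}h1 := h1 _ Fx; have {}h2 := h2 _ Fy.
have [uE sep] := sE.
have : M * delta < enorm (nth 0 E w - nth 0 E w').
  by rewrite -edistE; apply: sep; rewrite ?mem_nth// nth_uniq.
have : enorm (nth 0 E w - nth 0 E w') <= enorm (sapp (W w) x - sapp (W w') y) + (D * delta + D * delta).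
  set a1 := nth 0 E w in h1 *; set a2 := nth 0 E w' in h2 *; set b1' := sapp _ x in h1 *; set b2 := sapp _ y in h2 *.
  have -> : a1 - a2 = (b1' - b2) + (- (b1' - a1) + (b2 - a2)).
    by apply/matrixP => i1 i2; rewrite !mxE; ring.
  rewrite (le_trans (enormD _ _))// lerD2l (le_trans (enormD _ _))// enormN lerD//.
rewrite /M mulrDl mul1r -mulrA; move: (D * delta) (enorm _) (enorm _) => *; lra.
Qed.

End GraphPieces.

Section Conclusion.
Context {R : realType} {n k : nat}.

Lemma packing_dim_set0 (F : set (grassmannian R n k)) (r : R) : 0 <= r ->
  (forall V, ~ F V) -> (packing_dim F <= r%:E)%E.
Proof.
move=> r0 F0; apply: (@packing_dim_le _ _ _ (fun _ => set0)) => //.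
- by exists 2 => V W _ _; exact: mdist_Gr_le2.
- by move=> V /F0.
- move=> _; exists 0; split=> //; exists 0%N => q E _ _ hE; rewrite mul0r.
  by case: E hE => // V E /(_ V (mem_head _ _)).
Qed.

Lemma packing_dim_Gr (F : set (grassmannian R n k)) (r : R) : (0 < n)%N ->
  (k * (n - k))%:R <= r -> (packing_dim F <= r%:E)%E.
Proof.
move=> n0 hr; have r0 : 0 <= r by rewrite (le_trans _ hr).
have [C C0 hC] := @Gr_count R n k n0.
pose u : euclid R n := delta_mx (Ordinal n0) ord0.
have u0 : u != 0.
  by apply/negP => /eqP/matrixP/(_ (Ordinal n0) ord0)/eqP; rewrite !mxE !eqxx /= oner_eq0.
apply: (@packing_dim_le _ _ _ (fun _ => setT)) => //.
- by exists 2 => V W _ _; exact: mdist_Gr_le2.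
- by move=> V _; exists 0%N.
- move=> _; exists C; split; first exact: ltW.
  exists 0%N => q E _ sE _.
  have e1 : exp2 (- q%:R) <= 1 :> R by rewrite exp2_le1// oppr_le0.
  have := hC _ 1 u E (exp2_gt0 (- q%:R)) e1 e1 u0 sE.
  rewrite expr1n mulr1 => h; apply: le_trans (h _) _.
    by move=> V _; rewrite mul1r enorm_orthproj.
  rewrite ler_wpM2l ?(ltW C0)// -exp2N opprK -powR_mulrn ?exp2_ge0// -exp2M exp2_le//.
  by rewrite mulrC ler_wpM2r.
Qed.

End Conclusion.

Theorem corollary1p6 (R : realType) (n k : nat) (K : set (euclid R n)) :
  (1 <= k)%N -> (k < n)%N ->
  homogeneous K \/
  (exists (S : graph_directed_ifs R n)
          (F : 'I_(gd_size S) -> set (euclid R n)) (i : 'I_(gd_size S)),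
     [/\ gd_transitive S, gd_attractor F, K = F i &
         finite_set (gd_transformation_group i) \/
         has_dense_orbit k (gd_transformation_group i)]) ->
  forall s : R, 0 <= s -> (s%:E < hausdorff_dim K)%E ->
  (packing_dim [set V : grassmannian R n k |
                  (hausdorff_dim (orthproj (val V) @` K) <= s%:E)%E]
   <= ((k * (n - k))%:R - (k%:R - s))%:E)%E.
Proof.
move=> k0 kn [hK|[S [F [i [tr FA -> hG]]]]] s s0 sK.
  exact: packing_dim_homogeneous kn hK s0 sK _.
have [[/(_ i)[F0 cF] _] n0] := (FA, leq_ltn_trans (leq0n k) kn).
have LK := @loops_simset _ _ S F FA i; have LC := @loops_comp _ _ S i.
have sep : separated_pieces (F i) (loops i) by exact: loops_separated.
case: hG => hG.
  have LG f : loops i f -> gd_transformation_group i (sorth f).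
    by move=> [p pi <-]; rewrite sorth_path_sim => H [_ HP]; apply: HP; exists p.
  exact: (packing_dim_finite_rotations F0 cF LK LC sep kn hG LG s0 sK).
(* For s >= k the bound is at least k(n-k), which holds for every set of subspaces. The entropy
   argument needs s < k, as the potential estimate uses an exponent between s and k. *)
have [ks|sk] := leP k%:R s.
  by apply: packing_dim_Gr => //; rewrite opprB lerDl subr_ge0.
apply: packing_dim_set0.
  rewrite opprB addrCA addr_ge0// subr_ge0 ler_nat leq_pmulr// subn_gt0//.
move=> V /=; apply/negP; rewrite -ltNge.
apply: (dense_rotations_dim n0 (ltnW kn) F0 cF LK LC sep _ s0 sk sK).
by rewrite loops_group.
Qed.
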